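(* Consider the additive Gaussian channel with finite input alphabet $\mathcal{Y}=\{1,\dots,l\}$, output alphabet $\mathbb{R}$ and densities $$q(z|i)=\frac{1}{\sqrt{2\pi}\,\sigma_i}\,e^{-(z-\mu_i)^2/(2\sigma_i^2)},\qquad i=1,\dots,l,$$ parameterized by $(\sigma_i,\mu_i)$ with $\sigma_i>0$, $\mu_i\in\mathbb{R}$. Suppose that some $\sigma_i$ is strictly larger than all the other ones. If all entries of $\Pi^{\vec{\varepsilon}_0}$ are strictly positive at $\vec{\varepsilon}_0\in\Omega_1$, then the entropy rate $H(Z)$, as a function of $\vec{\varepsilon}$ and of the channel parameters, is analytic around $(\vec{\varepsilon}_0,(\sigma_1,\mu_1,\sigma_2,\mu_2,\dots,\sigma_l,\mu_l))$.
   Context: Let $\Omega_1\subset\mathbb{R}^{m_1}$ be a bounded domain (open connected set). For $\vec{\varepsilon}\in\Omega_1$, $\Pi^{\vec{\varepsilon}}$ is an $l\times l$ stochastic matrix depending real-analytically on $\vec{\varepsilon}$, and $Y=(Y_n)$ is the $\mathcal{Y}$-valued stationary first-order Markov chain with transition matrix $\Pi^{\vec{\varepsilon}}$. The hidden Markov chain $Z$ is the output of the memoryless channel with input $Y$: conditionally on $Y$, the $Z_n$ are independent and $Z_n$ has density $q(\cdot|Y_n)$. Let $p$ denote the resulting joint densities, with $z_{-n}^0=(z_{-n},\dots,z_0)$. The entropy rate is $$H(Z)=\lim_{n\to\infty}\frac{1}{n+1}H(Z_{-n}^0),\qquad H(Z_{-n}^0)=-\int_{\mathbb{R}^{n+1}}p(z_{-n}^0)\log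 p(z_{-n}^0)\,dz_{-n}^0.$$ ''Analytic around'' a point means real analytic, jointly in all the parameters, on a neighborhood of that point. *)

(* Defs.v *)
From HB Require Import structures.
From mathcomp Require Import all_boot all_order all_algebra.
From mathcomp Require Import finmap.
From mathcomp Require Import all_classical all_reals all_analysis.
From mathcomp.analysis.showcase Require Import summability.

Set Implicit Arguments.
Unset Strict Implicit.
Unset Printing Implicit Defensive.

Import Order.TTheory GRing.Theory Num.Theory.
Import numFieldNormedType.Exports.

Local Open Scope classical_set_scope.
Local Open Scope ring_scope.

Definition monomial_at (R : realType) (d : nat) (h : 'rV[R]_d)
    (k : {ffun 'I_d -> nat}) : R :=
  \prod_(i < d) h 0 i ^+ k i.

(* On a whole neighbourhood of [a], [f] is the sum of a power series centred
   at [a]. The sum over multi-indices is unordered (limit of the finite partial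
   sums along inclusion), which over the reals amounts to absolute
   convergence. *)
Definition real_analytic_at (R : realType) (d : nat) (f : 'rV[R]_d -> R)
    (a : 'rV[R]_d) : Prop :=
  exists c : {ffun 'I_d -> nat} -> R,
    \forall x \near a,
      partial_sum (fun k => c k * monomial_at (x - a) k) @ totally --> f x.

Definition stochastic (R : realType) (l : nat) (P : 'M[R]_l) : Prop :=
  (forall i j, 0 <= P i j) /\ (forall i, \sum_(j < l) P i j = 1).

Definition stationary_distribution (R : realType) (l : nat) (P : 'M[R]_l)
    (pi : 'rV[R]_l) : Prop :=
  [/\ forall i, 0 <= pi 0 i, \sum_(i < l) pi 0 i = 1 & pi *m P = pi].

(* Lebesgue measure on R^n, the n-fold product of [lebesgue_measure], carried
   over from R * R^n to (n+1)-tuples by consing. *)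
Fixpoint tuple_lebesgue (R : realType) (n : nat) :
    set (n.-tuple (measurableTypeR R)) -> \bar R :=
  match n with
  | 0%N => dirac [tuple]
  | n'.+1 =>
      pushforward (lebesgue_measure \x tuple_lebesgue (n := n'))%E
        (fun u : measurableTypeR R * n'.-tuple (measurableTypeR R) =>
           [tuple of u.1 :: u.2])
  end.
Arguments tuple_lebesgue R n : clear implicits.

(* Blocks of length n+1 are listed from the oldest symbol to the most recent
   one: position [k] of a tuple holds the symbol at time k - n. *)
Definition markov_prob (R : realType) (l : nat) (pi : 'rV[R]_l)
    (P : 'M[R]_l) (n : nat) (y : n.+1.-tuple 'I_l) : R :=
  pi 0 (tnth y ord0) *
  \prod_(k < n) P (tnth y (widen_ord (leqnSn n) k)) (tnth y (lift ord0 k)).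

(* Joint density of Z_{-n}^0, the marginal on the outputs of the joint law of
   inputs and outputs: given Y = y the Z_k are independent with densities
   q y_k. *)
Definition hmc_density (R : realType) (l : nat) (pi : 'rV[R]_l)
    (P : 'M[R]_l) (q : 'I_l -> R -> R) (n : nat) (z : n.+1.-tuple R) : R :=
  \sum_(y : n.+1.-tuple 'I_l)
     markov_prob pi P y * \prod_(k < n.+1) q (tnth y k) (tnth z k).

Definition plogp (R : realType) (l : nat) (pi : 'rV[R]_l) (P : 'M[R]_l)
    (q : 'I_l -> R -> R) (n : nat) (z : n.+1.-tuple (measurableTypeR R)) :
    \bar R :=
  (hmc_density pi P q z * ln (hmc_density pi P q z))%:E.

Definition block_entropy (R : realType) (l : nat) (pi : 'rV[R]_l)
    (P : 'M[R]_l) (q : 'I_l -> R -> R) (n : nat) : R :=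
  - fine (\int[tuple_lebesgue R n.+1]_z plogp pi P q z)%E.

Definition entropy_seq (R : realType) (l : nat) (pi : 'rV[R]_l)
    (P : 'M[R]_l) (q : 'I_l -> R -> R) : R^nat :=
  fun n => block_entropy pi P q n / n.+1%:R.

Definition entropy_rate (R : realType) (l : nat) (pi : 'rV[R]_l)
    (P : 'M[R]_l) (q : 'I_l -> R -> R) : R :=
  limn (entropy_seq pi P q).

(* [fine] and [limn] return default values on infinite integrals and divergent
   sequences; this says that neither happens in [entropy_rate]. *)
Definition entropy_rate_defined (R : realType) (l : nat) (pi : 'rV[R]_l)
    (P : 'M[R]_l) (q : 'I_l -> R -> R) : Prop :=
  (forall n, (tuple_lebesgue R n.+1).-integrable setT (@plogp R l pi P q n)) /\
  cvgn (entropy_seq pi P q).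

Definition gaussian_channel (R : realType) (l : nat) (sigma mu : 'rV[R]_l) :
    'I_l -> R -> R :=
  fun i z => normal_pdf (mu 0 i) (sigma 0 i) z.

(* Main.v *)
(** Filter the chain by the vector [w] of predictive probabilities of the next
    input.  Conditioning the outputs one by one turns the block entropy into
    sum_i pi_i sum_(k <= n) (K^k u)(i, pi), where u(i, w) is the expected loss
    - int q_i ln <w, q> of the next output and K is the Markov operator of the
    pair (input, predictive vector).  So the rate is the limit of K^k u.

    Analyticity comes from running this dynamics on functions of the parameters:
    [analytic_bound a r f M] says that f is a power series on the polydisc of
    radius r around a whose coefficients satisfy sum |c_k| r^|k| <= M, a real
    substitute for boundedness on a complex polydisc.  For parameters near
    [theta0], the prediction step contracts the differences of the ratios
    x_i / y_i of two parameter-dependent predictive vectors (Doeblin, because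
    the transition probabilities are positive), K contracts the oscillation of
    its argument, and hence K^k u converges geometrically for this norm.  The
    state i* of largest variance makes the estimates uniform in the output z:
    only the ratios q_j(z) / q_i*(z) matter for the prediction, these are
    bounded, and their perturbations are uniformly small in z. *)

From HB Require Import structures.
Require Import Defs.
From mathcomp Require Import all_boot all_order all_algebra.
From mathcomp Require Import finmap ring lra.
From mathcomp Require Import all_classical all_reals all_analysis.
From mathcomp.analysis Require Import measurable_realfun.
From mathcomp.analysis.showcase Require Import summability.
Import Order.TTheory GRing.Theory Num.Theory.
Import numFieldNormedType.Exports.

Set Implicit Arguments.
Unset Strict Implicit.
Unset Printing Implicit Defensive.

Local Open Scope classical_set_scope.
Local Open Scope ring_scope.

(* The weighted coefficient sum is submultiplicative and survives pointwise limits, but it ignores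
   signs: the bounds of the entries of an analytic probability vector add up to more than 1 unless
   the vector is constant. Every averaging argument therefore loses a factor close to 1, and a
   margin must be kept: the rate [1 - c] becomes [1 - c / 2], and one application of K may multiply
   sizes by [1 + c / 4]. Two devices make this harmless. The predictive vectors are kept within
   [eta] of constant vectors; prediction preserves this, because it contracts towards the image of a
   constant vector. And the iterates, whose size bounds may grow geometrically, are controlled
   through differences of their values: these contract, they bound the increments of K^k u, and
   summing the increments restores a uniform bound, which a compactness argument passes to the
   limit. Distances are differences of ratios because these are rational in the states, so they have
   an analytic bound, which an absolute value or a maximum would not have. *)
#[local] Existing Instance totally_filter.

(** * Power series with a weighted absolute bound *)

Section partial_sums.
Variables (R : realType) (K : choiceType).
Implicit Types (u : K -> R) (J : {fset K}).

Lemma partial_sumE u J : partial_sum u J = \sum_(k <- J) u k.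
Proof. by rewrite /partial_sum big_seq_fsetE. Qed.

Lemma partial_sum_funE u : partial_sum u = fun J => \sum_(k <- J) u k.
Proof. by apply/funext => J; exact: partial_sumE. Qed.

Lemma partial_sumU u J J' : [disjoint J & J']%fset ->
  \sum_(k <- (J `|` J')%fset) u k = \sum_(k <- J) u k + \sum_(k <- J') u k.
Proof.
move=> dJ; rewrite -big_cat; apply: perm_big; apply: uniq_perm.
- exact: fset_uniq.
- rewrite cat_uniq !fset_uniq/= andbT; apply/hasPn => k kJ'; apply/negP => kJ.
  by move/fdisjointP: dJ => /(_ _ kJ); rewrite kJ'.
- by move=> k; rewrite mem_cat inE.
Qed.

Lemma fdisjointXDX J J' : [disjoint J & (J' `\` J)]%fset.
Proof. by apply/fdisjointP => k kJ; rewrite inE kJ. Qed.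

Lemma partial_sumD u J J' : (J `<=` J')%fset ->
  \sum_(k <- J') u k = \sum_(k <- J) u k + \sum_(k <- (J' `\` J)%fset) u k.
Proof.
move=> JJ'; rewrite -partial_sumU ?fdisjointXDX//; congr bigop.
congr enum_fset; apply/fsetP => k; rewrite !inE; case: (boolP (k \in J)) => //= kJ.
exact: (fsubsetP JJ').
Qed.

(** Beyond a finite set [J0] that realizes the limit up to 1, every finite sum disjoint from [J0] is
    at most 2 in absolute value. Applied to the positive and the negative terms separately, this
    bounds the sum of absolute values. *)
Lemma unordered_sum_abs_bounded u (l : R) : partial_sum u @ totally --> l ->
  exists M, forall J, \sum_(k <- J) `|u k| <= M.
Proof.
move=> /cvgrPdist_le/(_ 1 ltr01)[J0 _ hJ0].
exists (\sum_(k <- J0) `|u k| + 4) => J.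
have part (J' : {fset K}) : [disjoint J0 & J']%fset -> `|\sum_(k <- J') u k| <= 2.
  move=> dJ; have h1 := hJ0 _ (fsubset_refl J0).
  have h2 := hJ0 (J0 `|` J')%fset (fsubsetUl J0 J').
  rewrite /= partial_sumE in h1; rewrite /= partial_sumE partial_sumU // in h2.
  by move: h1 h2; rewrite !ler_norml; lra.
pose Jp := [fset k in (J `\` J0)%fset | 0 <= u k]%fset.
pose Jn := [fset k in (J `\` J0)%fset | u k < 0]%fset.
have pP : `|\sum_(k <- Jp) u k| <= 2.
  apply: part; apply/fdisjointP => k kJ0; rewrite !inE/= kJ0/=.
  by rewrite ?andbF.
have nP : `|\sum_(k <- Jn) u k| <= 2.
  apply: part; apply/fdisjointP => k kJ0; rewrite !inE/= kJ0/=.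
  by rewrite ?andbF.
have dpn : [disjoint Jp & Jn]%fset.
  apply/fdisjointP => k; rewrite !inE/= => /andP[_ uk].
  by rewrite ltNge uk andbF.
have JE : (J `\` J0)%fset = (Jp `|` Jn)%fset.
  apply/fsetP => k; rewrite !inE/= -andb_orr; case: (leP 0 (u k)) => _; by rewrite ?andbT.
have le1 : \sum_(k <- J) `|u k| <= \sum_(k <- (J0 `|` (J `\` J0))%fset) `|u k|.
  rewrite (@partial_sumD _ J (J0 `|` (J `\` J0))%fset).
    by rewrite lerDl sumr_ge0.
  by apply/fsubsetP => k kJ; rewrite !inE kJ andbT orbN.
apply: (le_trans le1); rewrite partial_sumU ?fdisjointXDX// lerD2l JE partial_sumU//.
have -> : \sum_(k <- Jp) `|u k| = \sum_(k <- Jp) u k.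
  by apply: eq_big_seq => k; rewrite !inE/= => /andP[_ uk]; rewrite ger0_norm.
have -> : \sum_(k <- Jn) `|u k| = - \sum_(k <- Jn) u k.
  by rewrite -sumrN; apply: eq_big_seq => k; rewrite !inE/= => /andP[_ uk]; rewrite ltr0_norm.
by move: pP nP; rewrite !ler_norml; lra.
Qed.

End partial_sums.

Section analytic_norm.
Variables (R : realType) (d : nat) (a : 'rV[R]_d) (r : R).
Hypothesis r_gt0 : 0 < r.
Local Notation K := {ffun 'I_d -> nat}.

Definition polydisc : set 'rV[R]_d :=
  [set x | forall i, `|x 0 i - a 0 i| < r].

Definition multideg (k : K) : nat := \sum_(i < d) k i.

(** A relation between a function and an admissible bound rather than a norm: no supremum is taken,
    and the coefficients stay existential. *)
Definition analytic_bound (f : 'rV[R]_d -> R) (M : R) : Prop :=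
  exists c : K -> R,
    (forall J : {fset K}, \sum_(k <- J) `|c k| * r ^+ multideg k <= M) /\
    forall x, polydisc x ->
      partial_sum (fun k => c k * monomial_at (x - a) k) @ totally --> f x.

Local Notation AN := analytic_bound.

Lemma analytic_bound_ext f g M :
  (forall x, polydisc x -> f x = g x) -> AN f M -> AN g M.
Proof.
by move=> fg [c [cM cf]]; exists c; split => // x Dx; rewrite -fg//; exact: cf.
Qed.

Lemma analytic_bound_le f M M' : M <= M' -> AN f M -> AN f M'.
Proof.
by move=> MM' [c [cM cf]]; exists c; split => // J; exact: le_trans (cM J) MM'.
Qed.

Lemma analytic_bound_ge0 f M : AN f M -> 0 <= M.
Proof. by move=> [c [/(_ fset0)]]; rewrite big_seq_fset0. Qed.

Lemma norm_monomial_le (x : 'rV[R]_d) s k : (forall i, `|x 0 i| <= s) ->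
  `|monomial_at x k| <= s ^+ multideg k.
Proof.
move=> xs; rewrite /monomial_at /multideg normr_prod -prodrXr.
apply: ler_prod => i _; rewrite normrX exprn_ge0//=.
by rewrite lerXn2r ?nnegrE// (le_trans _ (xs i)).
Qed.

Lemma polydisc_sub x : polydisc x ->
  exists2 s, 0 <= s < r & forall i, `|(x - a) 0 i| <= s.
Proof.
move=> Dx; exists (\big[Order.max/0]_(i < d) `|(x - a) 0 i|).
  apply/andP; split.
    by elim/big_ind: _ => // u v u0 v0; rewrite le_max u0.
  elim/big_ind: _ => // [u v u0 v0|i _]; first by rewrite gt_max u0.
  by rewrite !mxE; exact: Dx.
by move=> i; exact: (le_bigmax _ (fun i => `|(x - a) 0 i|)).
Qed.

Lemma norm_monomial_polydisc x k : polydisc x ->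
  `|monomial_at (x - a) k| <= r ^+ multideg k.
Proof.
move=> Dx; apply: norm_monomial_le => i.
by rewrite ltW// !mxE; exact: Dx.
Qed.

Lemma sum_monomial_le (c : K -> R) (M : R) x (J : {fset K}) : polydisc x ->
  (forall J : {fset K}, \sum_(k <- J) `|c k| * r ^+ multideg k <= M) ->
  `|\sum_(k <- J) c k * monomial_at (x - a) k| <= M.
Proof.
move=> Dx cM; apply: le_trans (cM J); apply: le_trans (ler_norm_sum _ _ _) _.
apply: ler_sum => k _; rewrite normrM ler_wpM2l//.
exact: norm_monomial_polydisc.
Qed.

Lemma cvg_norm_le (T : Type) (F : set_system T) {FF : ProperFilter F}
    (u : T -> R) (l M : R) :
  u t @[t --> F] --> l -> (\forall t \near F, `|u t| <= M) -> `|l| <= M.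
Proof.
move=> ul uM; have nl : `|u t| @[t --> F] --> `|l| by exact: cvg_norm.
by rewrite -(cvg_lim _ nl)//; apply: limr_le => //; apply/cvg_ex; exists `|l|.
Qed.

Lemma cvg_sum_seq (T : Type) (F : set_system T) {FF : Filter F} (I : Type)
    (s : seq I) (u : I -> T -> R) (l : I -> R) :
  (forall i, u i t @[t --> F] --> l i) ->
  \sum_(i <- s) u i t @[t --> F] --> \sum_(i <- s) l i.
Proof.
move=> ul; elim: s => [|i s IH].
  by under eq_fun do rewrite big_nil; rewrite big_nil; exact: cvg_cst.
by under eq_fun do rewrite big_cons; rewrite big_cons; exact: cvgD.
Qed.

Lemma analytic_bound_norm f M x : AN f M -> polydisc x -> `|f x| <= M.
Proof.
move=> [c [cM cf]] Dx; have := cf _ Dx; rewrite partial_sum_funE => /cvg_norm_le.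
by apply; apply: nearW => J; exact: sum_monomial_le.
Qed.

Lemma low_degree_fset N :
  exists J : {fset K}, forall k, k \notin J -> (N <= multideg k)%N.
Proof.
pose h (j : {ffun 'I_d -> 'I_N}) : K := [ffun i => nat_of_ord (j i)].
exists [fset k in map h (enum {ffun 'I_d -> 'I_N})]%fset => k kJ.
rewrite leqNgt; apply/negP => kN; move/negP: kJ; apply.
have kiN i : (k i < N)%N.
  by apply: leq_ltn_trans kN; rewrite /multideg (bigD1 i)//= leq_addr.
rewrite !inE/=; apply/mapP; exists [ffun i => Ordinal (kiN i)].
  by rewrite mem_enum.
by apply/ffunP => i; rewrite !ffunE.
Qed.

(** Compared with the weight [r ^+ multideg k], each monomial gains [(s / r) ^+ multideg k], hence
    at least the power [N]. The estimate sees [c] only through [M], so it is uniform over families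
    with a common bound. *)
Lemma tail_sum_le (c : K -> R) (M : R) x (s : R) N (J0 J : {fset K}) :
  0 <= s < r -> (forall i, `|(x - a) 0 i| <= s) ->
  (forall J : {fset K}, \sum_(k <- J) `|c k| * r ^+ multideg k <= M) ->
  (forall k, k \notin J0 -> (N <= multideg k)%N) -> [disjoint J0 & J]%fset ->
  `|\sum_(k <- J) c k * monomial_at (x - a) k| <= (s / r) ^+ N * M.
Proof.
move=> /andP[s0 sr] xs cM J0P dJ.
have q1 : 0 <= s / r <= 1.
  by rewrite divr_ge0 ?(ltW r_gt0)//= ler_pdivrMr// mul1r ltW.
apply: le_trans (ler_norm_sum _ _ _) _.
apply: (@le_trans _ _ ((s / r) ^+ N * \sum_(k <- J) `|c k| * r ^+ multideg k)); last first.
  by rewrite ler_wpM2l// exprn_ge0//; case/andP: q1.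
rewrite mulr_sumr big_seq [leRHS]big_seq; apply: ler_sum => k kJ.
have kJ0 : k \notin J0.
  by apply/negP => kJ0; move/fdisjointP: dJ => /(_ _ kJ0); rewrite kJ.
rewrite normrM mulrCA ler_wpM2l//.
apply: le_trans (norm_monomial_le k xs) _.
have -> : s ^+ multideg k = (s / r) ^+ multideg k * r ^+ multideg k.
  by rewrite -exprMn divfK// gt_eqF.
rewrite ler_wpM2r ?exprn_ge0 ?(ltW r_gt0)//.
by case/andP: q1 => q0 q1; rewrite (ler_wiXn2l q0 q1)// J0P.
Qed.

(* A Montel-type compactness: along an ultrafilter finer than [F] every
   coefficient converges, and the weights make the tails uniformly small on
   each smaller closed polydisc. *)
Lemma analytic_bound_lim (T : Type) (F : set_system T) {FF : ProperFilter F}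
    (f_ : T -> 'rV[R]_d -> R) (M_ : T -> R) f M :
  (forall t, AN (f_ t) (M_ t)) ->
  (forall e, 0 < e -> \forall t \near F, M_ t <= M + e) ->
  (forall x, polydisc x -> f_ t x @[t --> F] --> f x) -> AN f M.
Proof.
move=> /choice[c_ cP] MF ff.
have [U [Uultra FU]] := ultraFilterLemma FF.
have Ucvg (u : T -> R) (B : R) : (\forall t \near U, `|u t| <= B) ->
    exists l : R, u t @[t --> U] --> l.
  move=> uB.
  have [|l [_ lcl]] := @segment_compact R (- B) B (u @ U) _.
    by near=> t; rewrite /= in_itv/= -ler_norml; near: t.
  exists l => A lA; have [//|UnA] := @in_ultra_setVsetC _ U (u @^-1` A) Uultra.
  by have [y []] := lcl (~` A) A UnA lA.
have MU e : 0 < e -> \forall t \near U, M_ t <= M + e.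
  by move=> /MF; exact: FU.
have ck k : exists l : R, c_ t k @[t --> U] --> l.
  apply: (Ucvg _ ((M + 1) / r ^+ multideg k)); near=> t.
  rewrite ler_pdivlMr ?exprn_gt0//.
  have := (cP t).1 [fset k]%fset; rewrite big_seq_fset1 => /le_trans; apply.
  by near: t; exact: MU.
have {ck}/choice[c cU] := ck.
have sumc (w : K -> R) J : (\sum_(k <- J) c_ t k * w k) @[t --> U] --> \sum_(k <- J) c k * w k.
  by apply: cvg_sum_seq => k; apply: cvgMl; exact: cU.
have sumn (w : K -> R) J : (\sum_(k <- J) `|c_ t k| * w k) @[t --> U] --> \sum_(k <- J) `|c k| * w k.
  by apply: cvg_sum_seq => k; apply: cvgMl; apply: cvg_norm; exact: cU.
exists c; split.
  move=> J; apply/ler_addgt0Pr => e e0.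
  apply: (closed_cvg (fun y : R => y <= M + e) _ _ _ (sumn (fun k => r ^+ multideg k) J)); first exact: closed_le.
  near=> t; apply: le_trans ((cP t).1 J) _; near: t; exact: MU.
move=> x Dx; have [s sr xs] := polydisc_sub Dx.
apply/cvgrPdist_le => e e0.
have M0 : 0 <= M + 1.
  have [t Mt] : exists t, M_ t <= M + 1 by apply: (filter_ex (MU _ ltr01)).
  apply: le_trans Mt; exact: analytic_bound_ge0 (ex_intro _ _ (cP t)).
have [N hN] : exists N, (s / r) ^+ N * (M + 1) <= e.
  have : (fun N => (s / r) ^+ N * (M + 1)) @ \oo --> 0 * (M + 1).
    apply: cvgMl; apply: cvg_expr.
    by case/andP: sr => s0 sr; rewrite ger0_norm ?divr_ge0 ?(ltW r_gt0)// ltr_pdivrMr// mul1r.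
  rewrite mul0r => /cvgrPdist_le/(_ _ e0)[N _ /(_ N)/= h]; exists N.
  by have := h (leqnn N); rewrite sub0r normrN => /(le_trans (ler_norm _)).
have [J0 J0P] := low_degree_fset N.
exists J0 => //= J J0J; rewrite partial_sumE.
(* Two nested limits: for fixed [J] the remainder passes to the limit in [t], and for fixed [t] the
   remainder is itself a limit of tails along [J']. The tail bound is uniform in both. *)
have h1 : f_ t x - \sum_(k <- J) c_ t k * monomial_at (x - a) k @[t --> U] -->
    f x - \sum_(k <- J) c k * monomial_at (x - a) k.
  by apply: cvgB; [exact: cvg_trans (cvg_app _ FU) (ff _ Dx)|exact: sumc].
apply: (cvg_norm_le h1); near=> t.
have tM : M_ t <= M + 1 by near: t; exact: MU.
apply: le_trans hN; set p := fun k => c_ t k * monomial_at (x - a) k.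
have h2 : partial_sum p J' - \sum_(k <- J) p k @[J' --> totally] -->
    f_ t x - \sum_(k <- J) p k.
  by apply: cvgB; [exact: (cP t).2|exact: cvg_cst].
apply: (@le_trans _ _ ((s / r) ^+ N * M_ t)); last first.
  case/andP: sr => s0 _; by rewrite ler_wpM2l// exprn_ge0// divr_ge0// ltW.
apply: (cvg_norm_le h2); exists J => //= J' JJ'.
rewrite !partial_sumE (@partial_sumD _ _ _ _ _ JJ') addrAC subrr add0r.
apply: (tail_sum_le sr xs (cP t).1 J0P).
by apply/fdisjointP => k kJ0; rewrite inE (fsubsetP J0J _ kJ0).
Unshelve. all: by end_near. Qed.

Lemma cvg_partial_sum_finite (u : K -> R) (J : {fset K}) :
  (forall k, k \notin J -> u k = 0) ->
  partial_sum u @ totally --> \sum_(k <- J) u k.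
Proof.
move=> u0; apply/cvgrPdist_le => e e0; exists J => //= J' JJ'.
rewrite partial_sumE (@big_fset_incl _ _ _ _ J J') ?subrr ?normr0 ?ltW//.
by move=> k _; exact: u0.
Qed.

Lemma analytic_bound_monomial k :
  AN (fun x => monomial_at (x - a) k) (r ^+ multideg k).
Proof.
exists (fun j => (j == k)%:R); split.
  move=> J; apply: (@le_trans _ _ (\sum_(j <- [fset k]%fset) r ^+ multideg j)).
    rewrite (bigID (pred1 k))/= [X in _ + X]big1 ?addr0; last first.
      by move=> j /negPf ->; rewrite normr0 mul0r.
    case: (boolP (k \in J)) => kJ; last first.
      rewrite big_seq_cond big1 ?sumr_ge0// => [j _|j /andP[jJ /eqP jk]].
        by rewrite exprn_ge0 ?(ltW r_gt0).
      by move: kJ; rewrite -jk jJ.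
    rewrite big_fset_condE/= (_ : [fset i in J | i == k]%fset = [fset k]%fset).
      by rewrite !big_seq_fset1 eqxx normr1 mul1r.
    by apply/fsetP => j; rewrite !inE/= andb_idl// => /eqP ->.
  by rewrite big_seq_fset1.
move=> x Dx; have := @cvg_partial_sum_finite (fun j => (j == k)%:R * monomial_at (x - a) j) [fset k]%fset.
rewrite big_seq_fset1 eqxx mul1r; apply => j; rewrite inE => /negPf ->.
by rewrite mul0r.
Qed.

Lemma analytic_bound_scale b f M : AN f M -> AN (fun x => b * f x) (`|b| * M).
Proof.
move=> [c [cM cf]]; exists (fun k => b * c k); split.
  move=> J; apply: le_trans (ler_wpM2l (normr_ge0 b) (cM J)).
  by rewrite mulr_sumr ler_sum// => k _; rewrite normrM mulrA.
move=> x Dx; have := cf _ Dx; rewrite !partial_sum_funE => h.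
have -> : (fun J : {fset K} => \sum_(k <- J) b * c k * monomial_at (x - a) k) =
  (fun J : {fset K} => b * \sum_(k <- J) c k * monomial_at (x - a) k).
  by apply/funext => J; rewrite mulr_sumr; apply: eq_bigr => k _; rewrite mulrA.
exact: cvgMr.
Qed.

Lemma analytic_boundD f g M M' : AN f M -> AN g M' ->
  AN (fun x => f x + g x) (M + M').
Proof.
move=> [c [cM cf]] [e [eM eg]]; exists (fun k => c k + e k); split.
  move=> J; apply: le_trans (lerD (cM J) (eM J)).
  rewrite -big_split ler_sum// => k _ /=; rewrite -mulrDl ler_wpM2r ?ler_normD//.
  by rewrite exprn_ge0 ?(ltW r_gt0).
move=> x Dx; have := cf _ Dx; have := eg _ Dx; rewrite !partial_sum_funE => h h'.
have -> : (fun J : {fset K} => \sum_(k <- J) (c k + e k) * monomial_at (x - a) k) =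
  (fun J : {fset K} => \sum_(k <- J) c k * monomial_at (x - a) k + \sum_(k <- J) e k * monomial_at (x - a) k).
  by apply/funext => J; rewrite -big_split; apply: eq_bigr => k _; rewrite mulrDl.
exact: cvgD.
Qed.

Lemma monomial0 (x : 'rV[R]_d) : monomial_at x [ffun=> 0%N] = 1.
Proof. by rewrite /monomial_at big1// => i _; rewrite ffunE expr0. Qed.

Lemma multideg0 : multideg [ffun=> 0%N] = 0%N.
Proof. by rewrite /multideg big1// => i _; rewrite ffunE. Qed.

Lemma analytic_bound_cst b : AN (fun=> b) `|b|.
Proof.
have := analytic_bound_scale b (analytic_bound_monomial [ffun=> 0%N]).
rewrite multideg0 expr0 mulr1; apply: analytic_bound_ext => x _.
by rewrite monomial0 mulr1.
Qed.

Lemma analytic_bound_coord i : AN (fun x => x 0 i - a 0 i) r.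
Proof.
pose k : K := [ffun j => (j == i) : nat].
have dk : multideg k = 1%N.
  rewrite /multideg (bigD1 i)//= ffunE eqxx big1 ?addn0// => j /negPf.
  by rewrite ffunE => ->.
have := analytic_bound_monomial k; rewrite dk expr1.
apply: analytic_bound_ext => x _.
rewrite /monomial_at (bigD1 i)//= ffunE eqxx expr1 big1 ?mulr1 ?mxE//.
by move=> j /negPf; rewrite ffunE => ->; rewrite expr0.
Qed.

Lemma analytic_boundN f M : AN f M -> AN (fun x => - f x) M.
Proof.
move=> /(analytic_bound_scale (-1)); rewrite normrN1 mul1r.
by apply: analytic_bound_ext => x _; rewrite mulN1r.
Qed.

Lemma analytic_boundB f g M M' : AN f M -> AN g M' ->
  AN (fun x => f x - g x) (M + M').
Proof. by move=> fM /analytic_boundN; exact: analytic_boundD. Qed.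

Lemma analytic_bound_sum (I : Type) (s : seq I) (P : pred I)
    (f : I -> 'rV[R]_d -> R) (M : I -> R) :
  (forall i, P i -> AN (f i) (M i)) ->
  AN (fun x => \sum_(i <- s | P i) f i x) (\sum_(i <- s | P i) M i).
Proof.
move=> fM; elim: s => [|i s IH].
  have c0 := analytic_bound_cst 0; rewrite normr0 in c0; rewrite big_nil.
  by apply: analytic_bound_ext c0 => x _; rewrite big_nil.
rewrite big_cons; case: ifPn => Pi.
  apply: analytic_bound_ext (analytic_boundD (fM _ Pi) IH) => x _.
  by rewrite big_cons Pi.
by apply: analytic_bound_ext IH => x _; rewrite big_cons (negPf Pi).
Qed.

Lemma monomialD (x : 'rV[R]_d) (k k' : K) :
  monomial_at x k * monomial_at x k' = monomial_at x [ffun i => (k i + k' i)%N].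
Proof.
by rewrite /monomial_at -big_split; apply: eq_bigr => i _; rewrite ffunE exprD.
Qed.

Lemma multidegD (k k' : K) :
  multideg [ffun i => (k i + k' i)%N] = (multideg k + multideg k')%N.
Proof. by rewrite /multideg -big_split; apply: eq_bigr => i _; rewrite ffunE. Qed.

(** Instead of forming Cauchy products of coefficients, the product is taken as the pointwise limit
    of products of partial sums over a common finite set, which are polynomials with the right
    bound. *)
Lemma analytic_boundM f g M M' : AN f M -> AN g M' ->
  AN (fun x => f x * g x) (M * M').
Proof.
move=> fM gM'; have M0 := analytic_bound_ge0 fM; have M'0 := analytic_bound_ge0 gM'.
move: fM gM' => [c [cM cf]] [e [eM eg]].
pose F (J : {fset K}) x : R := (\sum_(k <- J) c k * monomial_at (x - a) k) *
  (\sum_(k <- J) e k * monomial_at (x - a) k).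
apply: (@analytic_bound_lim _ totally _ F (fun=> M * M')).
- move=> J; apply: (@analytic_bound_le _ ((\sum_(k <- J) `|c k| * r ^+ multideg k) * (\sum_(k <- J) `|e k| * r ^+ multideg k))).
    by apply: ler_pM => //; apply: sumr_ge0 => k _; rewrite mulr_ge0// exprn_ge0 ?(ltW r_gt0).
  rewrite big_distrl/=.
  have : AN (fun x => \sum_(k <- J) \sum_(j <- J) c k * e j * monomial_at (x - a) [ffun i => (k i + j i)%N])
     (\sum_(k <- J) \sum_(j <- J) `|c k * e j| * r ^+ multideg [ffun i => (k i + j i)%N]).
    apply: analytic_bound_sum => k _; apply: analytic_bound_sum => j _.
    exact/analytic_bound_scale/analytic_bound_monomial.
  rewrite (_ : \sum_(k <- J) \sum_(j <- J) _ = \sum_(i <- J) (`|c i| * r ^+ multideg i * \sum_(k <- J) `|e k| * r ^+ multideg k)).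
    apply: analytic_bound_ext => x _; rewrite /F big_distrl/=; apply: eq_bigr => k _.
    rewrite big_distrr/=; apply: eq_bigr => j _; rewrite -monomialD; ring.
  apply: eq_bigr => k _; rewrite big_distrr/=; apply: eq_bigr => j _.
  rewrite multidegD normrM exprD; ring.
- by move=> e' e'0; apply: nearW => _; rewrite lerDl ltW.
- move=> x Dx; have := cf _ Dx; have := eg _ Dx; rewrite !partial_sum_funE => h h'.
  exact: cvgM.
Qed.

Lemma analytic_boundX f M n : AN f M -> AN (fun x => f x ^+ n) (M ^+ n).
Proof.
move=> fM; elim: n => [|n IH].
  rewrite expr0 -normr1; exact: analytic_bound_cst.
rewrite exprS; apply: analytic_bound_ext (analytic_boundM fM IH) => x _.
by rewrite exprS.
Qed.

(** The majorant principle: by submultiplicativity the bound of [F (f x)] is the series of absolute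
    coefficients evaluated at [M]. *)
Lemma analytic_bound_powerseries (c : nat -> R) f M B (F : R -> R) :
  AN f M -> series (fun n => `|c n| * M ^+ n) @ \oo --> B ->
  (forall y, `|y| <= M -> series (fun n => c n * y ^+ n) @ \oo --> F y) ->
  AN (fun x => F (f x)) B.
Proof.
move=> fM cB cF.
apply: (@analytic_bound_lim _ \oo _ (fun n x => \sum_(0 <= i < n) c i * f x ^+ i)
   (fun n => \sum_(0 <= i < n) `|c i| * M ^+ i)).
- move=> n; apply: analytic_bound_sum => i _.
  exact/analytic_bound_scale/analytic_boundX.
- move=> e e0; move/cvgrPdist_le: cB => /(_ _ e0); apply: filterS => n.
  by rewrite ler_distl lerBlDr => /andP[].
- by move=> x Dx; apply: cF; exact: analytic_bound_norm fM Dx.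
Qed.

Lemma analytic_bound_exp f M : AN f M -> AN (fun x => expR (f x)) (expR M).
Proof.
move=> fM; have M0 := analytic_bound_ge0 fM.
have E (y : R) : series (fun n => (n`!%:R)^-1 * y ^+ n) @ \oo --> expR y.
  rewrite (_ : series _ = series (exp_coeff y)).
    exact: is_cvg_series_exp_coeff.
  by congr series; apply/funext => n; rewrite exp_coeffE/= mulrC.
apply: (analytic_bound_powerseries fM _ (fun y _ => E y)).
rewrite (_ : (fun n => _) = (fun n => (n`!%:R)^-1 * M ^+ n)); first exact: E.
by apply/funext => n; rewrite ger0_norm// invr_ge0.
Qed.

Lemma analytic_bound_geom f M : AN f M -> M < 1 ->
  AN (fun x => (1 - f x)^-1) (1 - M)^-1.
Proof.
move=> fM M1; have M0 := analytic_bound_ge0 fM.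
have E (y : R) : `|y| < 1 -> series (fun n => 1 * y ^+ n) @ \oo --> (1 - y)^-1.
  by move=> y1; rewrite -[X in _ --> X]mul1r; exact: cvg_geometric_series.
apply: (analytic_bound_powerseries (c := fun=> 1) (F := fun y => (1 - y)^-1) fM).
  rewrite normr1; apply: E; by rewrite ger0_norm.
by move=> y yM; apply: E; exact: le_lt_trans yM M1.
Qed.

(** Geometric series around the constant [b]; the bound is the largest inverse compatible with a
    deviation [M]. *)
Lemma analytic_bound_inv f b M : AN (fun x => f x - b) M -> M < b ->
  AN (fun x => (f x)^-1) (b - M)^-1.
Proof.
move=> fM Mb; have M0 := analytic_bound_ge0 fM; have b0 := le_lt_trans M0 Mb.
have h : AN (fun x => - b^-1 * (f x - b)) (M / b).
  by have := analytic_bound_scale (- b^-1) fM; rewrite normrN ger0_norm ?invr_ge0 ?(ltW b0)// mulrC.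
have Mb1 : M / b < 1 by rewrite ltr_pdivrMr// mul1r.
have := analytic_bound_scale b^-1 (analytic_bound_geom h Mb1).
rewrite ger0_norm ?invr_ge0 ?(ltW b0)// -invfM (_ : b * _ = b - M); last first.
  by field; rewrite gt_eqF.
apply: analytic_bound_ext => x Dx; rewrite -invfM; congr (_^-1).
by field; rewrite gt_eqF.
Qed.

(** Both sides come from ln (1 + x) <= x, applied to [q / p] and to [p / q]. This is the error of
    one cell of a left Riemann sum of the integral of 1/x. *)
Lemma ln_ratio_bounds (p q : R) : 0 < p -> 0 < q ->
  0 <= (q - p) / p - ln (q / p) <= (q - p) ^+ 2 / (p * q).
Proof.
move=> p0 q0.
have h (x y : R) : 0 < x -> 0 < y -> ln (y / x) <= (y - x) / x.
  move=> x0 y0; have -> : y / x = 1 + (y - x) / x by field; rewrite gt_eqF.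
  apply: le_ln1Dx; rewrite ltr_pdivlMr//; lra.
rewrite subr_ge0 h//= lerBlDr -lerBlDl -subr_ge0.
have -> : ln (q / p) = - ln (p / q).
  by rewrite -lnV ?posrE ?divr_gt0// invf_div.
have := h _ _ q0 p0; rewrite -subr_ge0; congr (0 <= _).
by field; rewrite !gt_eqF.
Qed.

(** The sums are left Riemann sums of u / (1 + t u) over t in [0, 1]. They present the logarithm as
    a limit of rational functions, each of which is bounded through the geometric series. *)
Lemma ln1p_riemann_cvg (u M : R) : `|u| <= M -> M < 1 ->
  \sum_(k < n.+1) u / n.+1%:R / (1 + k%:R / n.+1%:R * u) @[n --> \oo] -->
  ln (1 + u).
Proof.
move=> uM M1; have M0 : 0 <= M by apply: le_trans uM.
(* One cell has error at most (u / n)^2 divided by two consecutive nodes, each at least [1 - M],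
   where n is the number of cells; summing over the cells leaves [C] over n. *)
pose C := (M / (1 - M)) ^+ 2.
have key n : 0 <= \sum_(k < n.+1) u / n.+1%:R / (1 + k%:R / n.+1%:R * u) - ln (1 + u)
    <= C / n.+1%:R.
  have n0 : 0 < n.+1%:R :> R by [].
  pose t k : R := 1 + k%:R / n.+1%:R * u.
  have tM k : (k <= n.+1)%N -> 1 - M <= t k.
    move=> kn; rewrite /t lerD2l lerNl -mulrN.
    have k1 : 0 <= (k%:R : R) / n.+1%:R <= 1.
      by rewrite divr_ge0//= ler_pdivrMr// mul1r ler_nat.
    case/andP: k1 => k0 k1; move: uM; rewrite ler_norml => /andP[u1 u2].
    apply: le_trans (_ : k%:R / n.+1%:R * M <= _); first by rewrite ler_wpM2l// lerNl.
    by rewrite ler_piMl.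
  have t0 k : (k <= n.+1)%N -> 0 < t k by move=> /tM; apply: lt_le_trans; lra.
  have tS k : t k.+1 - t k = u / n.+1%:R.
    by rewrite /t -natr1; field; rewrite gt_eqF.
  have -> : ln (1 + u) = \sum_(k < n.+1) ln (t k.+1 / t k).
    transitivity (\sum_(0 <= k < n.+1) (ln (t k.+1) - ln (t k))).
      rewrite telescope_sumr// /t divff ?gt_eqF// mul1r mul0r mul0r addr0 ln1.
      by rewrite subr0.
    rewrite big_mkord; apply: eq_bigr => k _.
    by rewrite ln_div// posrE t0// ltnW// ltnS.
  rewrite -sumrB.
  have b (k : 'I_n.+1) : 0 <= u / n.+1%:R / (1 + k%:R / n.+1%:R * u) - ln (t k.+1 / t k)
      <= C / n.+1%:R ^+ 2.
    have kn : (k <= n.+1)%N by rewrite ltnW.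
    have := ln_ratio_bounds (t0 _ kn) (t0 _ (ltn_ord k)); rewrite tS -/(t k).
    move=> /andP[-> /le_trans]; apply.
    rewrite expr_div_n /C expr_div_n -mulrA [leRHS]mulrAC -mulrA.
    rewrite [leRHS](_ : _ = M ^+ 2 * ((n.+1%:R ^+ 2)^-1 * ((1 - M) ^+ 2)^-1)); last first.
      by rewrite -!mulrA.
    apply: ler_pM => //.
    - by rewrite sqr_ge0.
    - by rewrite mulr_ge0// invr_ge0 ?sqr_ge0// mulr_ge0// ltW// t0.
    - by rewrite -real_normK ?num_real// lerXn2r ?nnegrE.
    - rewrite ler_wpM2l// ?invr_ge0 ?sqr_ge0// lef_pV2 ?posrE ?mulr_gt0 ?t0//.
        by rewrite expr2 ler_pM// ?tM// subr_ge0 ltW.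
      by rewrite subr_gt0.
      by rewrite subr_gt0.
  apply/andP; split; first by apply: sumr_ge0 => k _; case/andP: (b k).
  apply: (@le_trans _ _ (\sum_(k < n.+1) C / n.+1%:R ^+ 2)).
    by apply: ler_sum => k _; case/andP: (b k).
  rewrite sumr_const card_ord -[_ *+ _]mulr_natr expr2 invfM.
  by rewrite mulrA mulfVK// gt_eqF.
have C0 : (fun n => C / n.+1%:R) @ \oo --> (0 : R).
  rewrite -(mulr0 C); apply: cvgMr; exact: cvg_harmonic.
have h : (fun n => \sum_(k < n.+1) u / n.+1%:R / (1 + k%:R / n.+1%:R * u) - ln (1 + u))
    @ \oo --> (0 : R).
  apply: (squeeze_cvgr _ (cvg_cst 0) C0); exact: nearW.
rewrite -[X in _ --> X]add0r; apply: cvg_trans (cvgD h (cvg_cst (ln (1 + u)))).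
by apply: near_eq_cvg; apply: nearW => n; rewrite /= subrK.
Qed.

Lemma analytic_bound_ln1p f M : AN f M -> M < 1 ->
  AN (fun x => ln (1 + f x)) (M / (1 - M)).
Proof.
move=> fM M1; have M0 := analytic_bound_ge0 fM.
apply: (@analytic_bound_lim _ \oo _
  (fun n x => \sum_(k < n.+1) f x / n.+1%:R / (1 + k%:R / n.+1%:R * f x)) (fun=> M / (1 - M))).
- move=> n.
  have -> : M / (1 - M) = \sum_(k < n.+1) n.+1%:R^-1 * (M / (1 - M)).
    by rewrite sumr_const card_ord -[_ *+ _]mulr_natl mulrA divff ?mul1r.
  apply: analytic_bound_sum => k _.
  have k1 : 0 <= (k%:R : R) / n.+1%:R <= 1.
    by rewrite divr_ge0//= ler_pdivrMr// mul1r ler_nat ltnW.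
  have kM : k%:R / n.+1%:R * M <= M by case/andP: k1 => k0 k1; rewrite ler_piMl.
  have h := analytic_bound_scale (- (k%:R / n.+1%:R)) fM.
  rewrite normrN ger0_norm in h; last by case/andP: k1.
  have {}h := analytic_bound_geom h (le_lt_trans kM M1).
  have := analytic_boundM (analytic_bound_scale n.+1%:R^-1 fM) h.
  rewrite ger0_norm ?invr_ge0// -mulrA => h'.
  apply: (@analytic_bound_le _ (n.+1%:R^-1 * (M * (1 - k%:R / n.+1%:R * M)^-1))).
    rewrite ler_wpM2l ?invr_ge0// ler_wpM2l// lef_pV2 ?posrE ?subr_gt0 ?(le_lt_trans kM M1)//.
    by rewrite lerD2l lerN2.
  apply: analytic_bound_ext h' => x _.
  by rewrite mulNr opprK [f x / _]mulrC.
- by move=> e e0; apply: nearW => _; rewrite lerDl ltW.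
- by move=> x Dx; apply: ln1p_riemann_cvg M1; exact: analytic_bound_norm fM Dx.
Qed.

Lemma analytic_bound_real_analytic f M : AN f M -> real_analytic_at f a.
Proof.
move=> [c [_ cf]]; exists c; near=> x; apply: cf; near: x.
apply/nbhs_ballP; exists r => //= x; rewrite /ball/= => h i.
by have := h.2 0 i; rewrite /ball/= distrC.
Unshelve. all: by end_near. Qed.

End analytic_norm.

(** A Schwarz lemma: once the constant coefficient is removed, every remaining weight decreases at
    least by the factor [r / r0]. Hence on small polydiscs the data are arbitrarily close to their
    value at the centre. *)
Lemma analytic_bound_shrink (R : realType) (d : nat) (a : 'rV[R]_d) (r0 r : R)
    (f : 'rV[R]_d -> R) (M : R) : 0 < r -> r <= r0 ->
  analytic_bound a r0 f M ->
  analytic_bound a r (fun x => f x - f a) (r / r0 * M).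
Proof.
move=> r0' rr0; have r00 := lt_le_trans r0' rr0 => -[c [cM cf]].
pose z : {ffun 'I_d -> nat} := [ffun=> 0%N].
have Da x : polydisc a r x -> polydisc a r0 x by move=> h i; apply: lt_le_trans (h i) rr0.
have mz (k : {ffun 'I_d -> nat}) : (multideg k == 0%N) = (k == z).
  apply/eqP/eqP => [|->]; last exact: multideg0.
  move=> /eqP; rewrite sum_nat_eq0 => /forallP k0; apply/ffunP => i; rewrite ffunE.
  exact/eqP/k0.
have fa : f a = c z.
  have aD : polydisc a r0 a by move=> i; rewrite subrr normr0.
  have h := cf _ aD.
  have h' : partial_sum (fun k => c k * monomial_at (a - a) k) @ totally --> c z.
    have := @cvg_partial_sum_finite _ d (fun k => c k * monomial_at (a - a) k) [fset z]%fset.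
    rewrite big_seq_fset1 monomial0 mulr1; apply => k; rewrite inE -mz => kz.
    rewrite /monomial_at; move: kz; rewrite sum_nat_eq0 negb_forall => /existsP[i ki].
    by rewrite (bigD1 i)//= !mxE subrr expr0n; move: ki; rewrite /= => /negPf ->; rewrite mul0r mulr0.
  by have := cvg_unique _ h h'; apply; exact: norm_hausdorff.
exists (fun k => if k == z then 0 else c k); split.
  move=> J; apply: le_trans (ler_wpM2l _ (cM J)); last by rewrite divr_ge0// ltW.
  rewrite mulr_sumr; apply: ler_sum => k _; case: ifPn => [_|]; last first.
    rewrite -mz -lt0n => mk; rewrite mulrCA ler_wpM2l// -ler_pdivrMr ?exprn_gt0//.
    rewrite -expr_div_n -[leRHS]expr1 ler_wiXn2l// ?divr_ge0 ?(ltW r00) ?(ltW r0')//.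
    by rewrite ler_pdivrMr// mul1r.
  by rewrite normr0 mul0r !mulr_ge0// ?invr_ge0 ?exprn_ge0// ltW.
move=> x /Da Dx; have h := cf _ Dx.
have h' := @cvg_partial_sum_finite _ d (fun k => if k == z then - c z else 0) [fset z]%fset.
rewrite big_seq_fset1 eqxx in h'; rewrite fa.
set u := fun k => c k * monomial_at (x - a) k in h.
set v := fun k => if k == z then - c z else 0 in h'.
rewrite [X in X @ _](_ : _ = fun J => partial_sum u J + partial_sum v J).
  by apply: cvgD => //; apply: h' => k; rewrite inE /v => /negPf ->.
apply/funext => J; rewrite !partial_sumE -big_split.
apply: eq_bigr => k _; rewrite /u /v /=; case: eqP => [->|_]; last by rewrite addr0.
by rewrite monomial0 !mulr1 subrr.
Qed.

(** At the corner [a + const_mx (e / 2)] every monomial equals the weight of radius [e / 2], so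
    absolute boundedness of the partial sums at this single point is the weighted bound. *)
Lemma real_analytic_bound (R : realType) (d : nat) (a : 'rV[R]_d)
    (f : 'rV[R]_d -> R) : real_analytic_at f a ->
  exists2 r, 0 < r & exists M, analytic_bound a r f M.
Proof.
move=> [c /nbhs_ballP[e /= e0 ce]]; exists (e / 2); first by rewrite divr_gt0.
have Dball (x : 'rV[R]_d) : (forall i, `|x 0 i - a 0 i| <= e / 2) -> ball a e x.
  move=> h; split=> // i j; rewrite (ord1 i) /ball/= distrC.
  by apply: le_lt_trans (h j) _; lra.
have e2 : 0 <= e / 2 by rewrite divr_ge0 // ltW.
have yB : ball a e (a + const_mx (e / 2)).
  by apply: Dball => i; rewrite !mxE addrAC subrr add0r ger0_norm.
have [M cM] := unordered_sum_abs_bounded (ce _ yB).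
exists M, c; split; last by move=> x Dx; apply/ce/Dball => i; exact/ltW/Dx.
move=> J; apply: le_trans (cM J); apply: ler_sum => k _.
rewrite normrM ler_wpM2l// addrAC subrr add0r /monomial_at /multideg.
rewrite normr_prod -prodrXr; apply: ler_prod => i _.
by rewrite mxE normrX ger0_norm// exprn_ge0//= lexx.
Qed.

(** The partial sums are rebuilt as polynomials in the larger set of variables and the limit is
    taken there, which avoids reindexing multi-indices. *)
Lemma analytic_bound_lsubmx (R : realType) (m n : nat) (a : 'rV[R]_m)
    (b : 'rV[R]_n) (r : R) (f : 'rV[R]_m -> R) (M : R) : 0 < r ->
  analytic_bound a r f M ->
  analytic_bound (row_mx a b) r (fun x => f (lsubmx x)) M.
Proof.
move=> r0 [c [cM cf]].
apply: (@analytic_bound_lim _ _ _ _ r0 _ totally _ (fun J x => \sum_(k <- J) c k * monomial_at (lsubmx x - a) k)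
   (fun=> M)).
- move=> J; apply: (@analytic_bound_le _ _ _ _ _ (\sum_(k <- J) `|c k| * r ^+ multideg k) _ (cM J)).
  apply: analytic_bound_sum => // k _.
  apply: analytic_bound_scale.
  rewrite /multideg -prodrXr.
  have : forall s : seq 'I_m, analytic_bound (row_mx a b) r
      (fun x => \prod_(i <- s) (lsubmx x - a) 0 i ^+ k i) (\prod_(i <- s) r ^+ k i).
    elim => [|i s IH].
      rewrite big_nil; have := analytic_bound_cst (row_mx a b) r0 (1 : R).
      by rewrite normr1; apply: analytic_bound_ext => x _; rewrite big_nil.
    rewrite big_cons; have h := analytic_boundX r0 (k i) (analytic_bound_coord (row_mx a b) r0 (lshift n i)).
    apply: analytic_bound_ext (analytic_boundM r0 h IH) => x _.
    by rewrite big_cons row_mxEl !mxE.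
  exact.
- by move=> e e0; apply: nearW => _; rewrite lerDl ltW.
- move=> x Dx; have := cf (lsubmx x); rewrite partial_sum_funE; apply => i.
  by have := Dx (lshift n i); rewrite row_mxEl mxE.
Qed.

(** * Integrals with Gaussian majorants *)

Section gaussian_domination.
Variable R : realType.
Implicit Types (g : R -> R) (C k z : R).
Local Notation mu := (@lebesgue_measure R).

Definition gauss_dominated g := exists C k, 0 < k /\
  forall z, `|g z| <= C * expR (- (k * z ^+ 2)).

Lemma integrable_gauss C k : 0 < k ->
  mu.-integrable setT (fun z => (C * expR (- (k * z ^+ 2)))%:E).
Proof.
(* The standard deviation for which 2 s^2 = 1 / k, so that the normal density with mean 0 has
   exponent - k z^2. *)
move=> k0; pose s := Num.sqrt (2 * k)^-1.
have s2 : s ^+ 2 *+ 2 = k^-1.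
  rewrite sqr_sqrtr ?invr_ge0 ?mulr_ge0 ?ltW// -mulr_natl.
  by field; rewrite gt_eqF.
have s0 : s != 0 by rewrite sqrtr_eq0 -ltNge invr_gt0 mulr_gt0.
have p0 : normal_peak s != 0 by rewrite gt_eqF// normal_peak_gt0.
have := integrableZl measurableT (C / normal_peak s) (integrable_normal_pdf 0 s).
apply: eq_integrable => // z _; rewrite -EFinM normal_pdfE// /normal_fun s2.
by rewrite mulrA divfK// subr0 invrK mulNr [k * _]mulrC.
Qed.

Lemma gauss_dominated_integrable g : continuous g -> gauss_dominated g ->
  mu.-integrable setT (EFin \o g).
Proof.
move=> cg [C [k [k0 gC]]].
apply: (le_integrable measurableT _ _ (integrable_gauss C k0)).
  by apply/measurable_EFinP; exact: continuous_measurable_fun.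
move=> z _ /=; rewrite lee_fin; apply: le_trans (gC z) _; exact: ler_norm.
Qed.

(** Left Riemann sum of mesh 1 / (n + 1) over the window from - (n + 1) to n + 1: a single index
    refines the mesh and exhausts the line. *)
Definition riemann_sum (n : nat) g : R :=
  \sum_(i < (n.+1 ^ 2).*2) n.+1%:R^-1 * g ((i%:R - (n.+1 ^ 2)%:R) / n.+1%:R).

Section riemann_step.
Variables (g : R -> R) (n : nat).
Local Notation h := (n.+1%:R : R).
Local Notation N := (n.+1 ^ 2)%N.

Let x_ (i : nat) : R := (i%:R - N%:R) / h.
Let I_ (i : nat) : set R := [set` `[x_ i, x_ i.+1[].

Definition riemann_step z : R := \sum_(i < N.*2) g (x_ i) * \1_(I_ i) z.

Let IE i z : I_ i z <-> (i%:R <= z * h + N%:R < i.+1%:R).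
Proof.
rewrite /I_ /= in_itv/= /x_ ler_pdivrMr// ltr_pdivlMr//.
by rewrite lerBlDr ltrBrDr.
Qed.

Let stepE i z : (i < N.*2)%N -> I_ i z -> riemann_step z = g (x_ i).
Proof.
move=> iN Iz; rewrite /riemann_step (bigD1 (Ordinal iN))//= indicE mem_set// mulr1.
rewrite big1 ?addr0// => j ji; rewrite indicE memNset ?mulr0// => Ij.
move: Iz Ij; rewrite !IE => /andP[i1 i2] /andP[j1 j2].
have ij := le_lt_trans i1 j2; have ji' := le_lt_trans j1 i2.
rewrite !ltr_nat !ltnS in ij ji'.
by move/eqP: ji; apply; apply/val_inj => /=; apply/eqP; rewrite eqn_leq ij ji'.
Qed.

(** Serves the domination, which must hold for all [z]: outside the window the step function takes
    the value 0. The next lemma serves the pointwise convergence, where [z] is eventually inside the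
    window. *)
Lemma riemann_step_cases z : riemann_step z = 0 \/
  exists2 x, riemann_step z = g x & x <= z < x + h^-1.
Proof.
have [/existsP[i /asboolP Iz]|/existsPn nI] := boolP [exists i : 'I_(N.*2), `[< I_ i z >]].
  right; exists (x_ i); first exact: stepE.
  move: Iz; rewrite /I_ /= in_itv/= /x_ => /andP[-> ]; congr (_ < _).
  by rewrite -natr1; field; rewrite gt_eqF.
left; rewrite /riemann_step big1// => i _; rewrite indicE memNset ?mulr0// => Ii.
by have /asboolP := nI i; apply.
Qed.

Lemma riemann_step_near z : `|z| < h ->
  exists2 x, riemann_step z = g x & x <= z < x + h^-1.
Proof.
rewrite ltr_norml => /andP[z1 z2].
have h0 : 0 < h by [].
have y0 : 0 <= z * h + N%:R.
  rewrite natrX -lerBlDr sub0r expr2 -mulNr ler_pM2r//; exact: ltW.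
have y1 : z * h + N%:R < N.*2%:R.
  by rewrite -addnn natrD ltrD2r natrX expr2 ltr_pM2r.
have /andP[t1 t2] := truncn_itv y0.
have tN : (Num.truncn (z * h + N%:R) < N.*2)%N.
  by rewrite -(ltr_nat R); exact: le_lt_trans y1.
have Iz : I_ (Num.truncn (z * h + N%:R)) z by rewrite IE t1.
exists (x_ (Num.truncn (z * h + N%:R))); first exact: stepE.
move: Iz; rewrite /I_ /= in_itv/= /x_ => /andP[-> ]; congr (_ < _).
by rewrite -natr1; field; rewrite gt_eqF.
Qed.

Lemma measurable_riemann_step : measurable_fun setT riemann_step.
Proof.
apply: measurable_sum => i; apply: measurable_funM; first exact: measurable_cst.
by rewrite /I_; apply: measurable_indic; exact: measurable_itv.
Qed.

Lemma integral_riemann_step :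
  (\int[mu]_z (riemann_step z)%:E)%E = (riemann_sum n g)%:E.
Proof.
have iI (i : nat) : mu.-integrable setT (EFin \o (\1_(I_ i) : R -> R)).
  exact: integrable_indic_itv.
under eq_integral do rewrite -sumEFin.
rewrite integral_sum//=; last first.
  by move=> i; exact: (integrableZl measurableT (g (x_ i)) (iI i)).
rewrite /riemann_sum -sumEFin; apply: eq_bigr => i _.
under eq_integral do rewrite EFinM.
rewrite integralZl//=; last exact: iI.
have -> : (\int[mu]_x (\1_(I_ i) x)%:E)%E = mu (I_ i).
  rewrite integral_indic//; first by rewrite setIT.
  exact: measurable_itv.
rewrite lebesgue_measure_itv/= lte_fin.
have xx : x_ i < x_ i.+1.
  by rewrite /x_ ltr_pM2r ?invr_gt0// ltrD2r ltr_nat.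
rewrite xx -EFinB -EFinM mulrC; congr ((_ * _)%:E).
by rewrite /x_ -natr1; field; rewrite gt_eqF.
Qed.

End riemann_step.

(** Since (x + y)^2 / 2 <= x^2 + y^2, moving the argument by at most 1 costs a constant and half of
    the rate. One Gaussian thus dominates the step functions of all meshes. *)
Lemma expR_gauss_shift k x z : 0 < k -> `|z - x| <= 1 ->
  expR (- (k * x ^+ 2)) <= expR k * expR (- (k / 2 * z ^+ 2)).
Proof.
move=> k0 xz; rewrite -expRD ler_expR.
have : (z - x) ^+ 2 <= 1 by rewrite -real_normK ?num_real// exprn_ile1.
have e : z = x + (z - x) by ring.
move: (z - x) e => y -> y1.
have : 0 <= 1 + x ^+ 2 - (x + y) ^+ 2 / 2.
  have := sqr_ge0 (x - y); lra.
move=> /(mulr_ge0 (ltW k0)); lra.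
Qed.

Lemma riemann_sum_cvg g : continuous g -> gauss_dominated g ->
  riemann_sum ^~ g @ \oo --> (\int[mu]_z g z : R).
Proof.
move=> cg dg; have ig := gauss_dominated_integrable cg dg.
move: dg => [C [k [k0 gC]]].
have C0 : 0 <= C.
  by have := gC 0; rewrite expr0n mulr0 oppr0 expR0 mulr1; apply: le_trans.
have := @dominated_convergence _ _ _ mu setT measurableT
  (fun n z => (riemann_step g n z)%:E) (EFin \o g)
  (fun z => (C * expR k * expR (- (k / 2 * z ^+ 2)))%:E).
case.
- by move=> n; apply/measurable_EFinP; exact: measurable_riemann_step.
- by apply/measurable_EFinP; exact: continuous_measurable_fun.
- apply: aeW => z _ /=; apply: cvg_EFin; first exact: nearW.
  apply/cvgrPdist_le => e e0.
  have /cvgrPdist_le/(_ _ e0)/nbhs_ballP[d /= d0 dP] := cg z.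
  have : (fun n => n.+1%:R^-1 : R) @ \oo --> (0 : R) by exact: cvg_harmonic.
  move=> /cvgrPdist_lt/(_ _ d0) hd.
  have hz : \forall n \near \oo, `|z| < n.+1%:R.
    exists (Num.truncn `|z|) => //= n /= hn.
    apply: lt_le_trans (truncnS_gt _) _; by rewrite ler_nat ltnS.
  near=> n; have [|x /= -> /andP[xz zx]] := @riemann_step_near g n z; first by near: n.
  apply: dP; rewrite /ball/= ger0_norm ?subr_ge0//.
  apply: (@lt_trans _ _ n.+1%:R^-1); first by rewrite ltrBlDl.
  near: n; apply: filterS hd => n; by rewrite sub0r normrN ger0_norm ?invr_ge0.
- by apply: integrable_gauss; rewrite divr_gt0.
- apply: aeW => z n _ /=; rewrite lee_fin.
  have [->|[x -> /andP[xz zx]]] := riemann_step_cases g n z.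
    by rewrite normr0 !mulr_ge0// expR_ge0.
  apply: le_trans (gC x) _; rewrite -mulrA ler_wpM2l//.
  apply: expR_gauss_shift => //; rewrite ger0_norm ?subr_ge0//.
  rewrite lerBlDl; apply: le_trans (ltW zx) _; rewrite lerD2l invf_le1//.
  by rewrite ler1n.
move=> _ _ h.
have {}h : (fun n => (riemann_sum n g)%:E) @ \oo --> (\int[mu]_z g z)%:E.
  rewrite /Rintegral fineK; last exact: integrable_fin_num.
  by under eq_fun do rewrite -integral_riemann_step.
exact: (fine_cvg h).
Unshelve. all: by end_near. Qed.

End gaussian_domination.

(* Riemann sums are finite combinations of the [f z], so no measurability of
   power-series coefficients is ever needed. *)
Lemma analytic_bound_integral (R : realType) (d : nat) (a : 'rV[R]_d) (r : R)
    (f : R -> 'rV[R]_d -> R) (B : R -> R) : 0 < r ->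
  (forall z, analytic_bound a r (f z) (B z)) ->
  (forall x, polydisc a r x -> continuous (f ^~ x)) ->
  continuous B -> gauss_dominated B ->
  analytic_bound a r (fun x => \int[lebesgue_measure]_z f z x)
    (\int[lebesgue_measure]_z B z).
Proof.
move=> r0 fB cf cB dB.
apply: (@analytic_bound_lim _ _ _ _ r0 _ \oo _ (fun n x => riemann_sum n (f ^~ x))
   (fun n => riemann_sum n B)).
- move=> n; apply: analytic_bound_sum => // i _.
  have := analytic_bound_scale n.+1%:R^-1 (fB ((i%:R - (n.+1 ^ 2)%:R) / n.+1%:R)).
  by rewrite ger0_norm ?invr_ge0.
- move=> e e0; have /cvgrPdist_le/(_ _ e0) := riemann_sum_cvg cB dB.
  by apply: filterS => n; rewrite ler_distl lerBlDr => /andP[].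
- move=> x Dx; apply: riemann_sum_cvg; first exact: cf.
  have [C [k [k0 BC]]] := dB; exists C, k; split=> // z.
  exact: le_trans (analytic_bound_norm (fB z) Dx) (le_trans (ler_norm _) (BC z)).
Qed.

(** * The prediction filter *)

Section prediction_filter.
Variables (R : realType) (l : nat).
Implicit Types (P : 'M[R]_l) (g w x y : 'I_l -> R).

Definition simplex (c : R) w := (forall i, c <= w i) /\ \sum_i w i = 1.

Definition weight g w : R := \sum_i w i * g i.

Definition posterior g w i : R := w i * g i / weight g w.

Definition predict P g w j : R := (\sum_i w i * g i * P i j) / weight g w.

(** The backward kernel: the conditional law of the current input [i], given the current output and
    the next input [j]. *)
Definition smoothing P g w j i : R :=
  w i * g i * P i j / (\sum_m w m * g m * P m j).

(** The product coupling of two weights of equal mass: a difference of two averages is estimated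
    from the differences [f i - f m] alone. *)
Lemma sum_coupling (s : R) (e e' f : 'I_l -> R) : \sum_i e i = s -> \sum_i e' i = s ->
  \sum_i \sum_m e i * e' m * (f i - f m) = s * (\sum_i e i * f i - \sum_i e' i * f i).
Proof.
move=> es e's.
transitivity (\sum_i \sum_m (e i * f i * e' m - e i * (e' m * f m))).
  by apply: eq_bigr => i _; apply: eq_bigr => m _; ring.
under eq_bigr do rewrite sumrB -!mulr_sumr.
by rewrite sumrB -!mulr_suml es e's; ring.
Qed.

Lemma simplex_le1 c w i : 0 <= c -> simplex c w -> w i <= 1.
Proof.
move=> c0 [cw <-]; rewrite (bigD1 i)//= lerDl sumr_ge0// => j _.
exact: le_trans (cw j).
Qed.

Lemma weight_ge c g w i : 0 <= c -> simplex c w -> (forall i, 0 <= g i) -> g i = 1 ->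
  c <= weight g w.
Proof.
move=> c0 [cw _] g0 gi; rewrite /weight (bigD1 i)//= gi mulr1.
rewrite -[leLHS]addr0 lerD// sumr_ge0// => j _.
by rewrite mulr_ge0// (le_trans c0).
Qed.

Lemma sum_posterior g w : weight g w != 0 -> \sum_i posterior g w i = 1.
Proof. by move=> S0; rewrite /posterior -mulr_suml divff. Qed.

Lemma sum_smoothing P g w j : \sum_m w m * g m * P m j != 0 ->
  \sum_i smoothing P g w j i = 1.
Proof. by move=> S0; rewrite /smoothing -mulr_suml divff. Qed.

Lemma weight_ratio g x y : (forall i, y i != 0) ->
  weight g x / weight g y = \sum_i posterior g y i * (x i / y i).
Proof.
move=> y0; rewrite {1}/weight mulr_suml; apply: eq_bigr => i _.
rewrite /posterior.
(* If the weight vanishes, both sides are 0 by the convention on inverses. *)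
have [->|W0] := eqVneq (weight g y) 0; first by rewrite invr0 !(mulr0, mul0r).
by field; rewrite y0.
Qed.

Lemma simplex_predict c P g w : 0 <= c -> (forall i, 0 <= w i) -> (forall i, 0 <= g i) ->
  0 < weight g w ->
  (forall i, \sum_j P i j = 1) -> (forall i j, c <= P i j) ->
  simplex c (predict P g w).
Proof.
move=> c0 w0 g0 W0 P1 Pc; split=> [j|].
  rewrite /predict ler_pdivlMr// /weight mulr_sumr; apply: ler_sum => i _.
  by rewrite mulrC ler_wpM2l// mulr_ge0.
rewrite /predict -mulr_suml exchange_big/=.
under eq_bigr do rewrite -mulr_sumr P1 mulr1.
by rewrite divff// gt_eqF.
Qed.

(* The smoothing weights dominate [c] times the posterior weights (Doeblin), so
   the difference of two predicted ratios is an average, of total mass [1 - c],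
   of differences of the ratios before prediction. *)
Lemma predict_ratioB c P g x y j k :
  let e j i := (smoothing P g y j i - c * posterior g y i) / (1 - c) in
  c < 1 -> (forall i, y i != 0) -> weight g x != 0 -> weight g y != 0 ->
  (forall j, \sum_m y m * g m * P m j != 0) ->
  predict P g x j / predict P g y j - predict P g x k / predict P g y k =
  weight g y / weight g x * ((1 - c) *
    \sum_i \sum_m e j i * e k m * (x i / y i - x m / y m)).
Proof.
move=> e c1 y0 Wx Wy N0; have c10 : 1 - c != 0 by rewrite subr_eq0 gt_eqF.
have e1 j' : \sum_i e j' i = 1.
  rewrite /e -mulr_suml sumrB -mulr_sumr sum_smoothing// sum_posterior// mulr1.
  by rewrite divff.
rewrite (sum_coupling _ (e1 j) (e1 k)) mul1r.
have p j' : predict P g x j' / predict P g y j' =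
    weight g y / weight g x * \sum_i smoothing P g y j' i * (x i / y i).
  rewrite /predict (_ : \sum_i smoothing P g y j' i * (x i / y i) =
    (\sum_i x i * g i * P i j') / (\sum_i y i * g i * P i j')).
    by field; rewrite Wx Wy N0.
  rewrite mulr_suml; apply: eq_bigr => i _; rewrite /smoothing; field.
  by rewrite y0 N0.
rewrite !p -mulrBr; congr (_ * _).
rewrite mulrBr !mulr_sumr -!sumrB; apply: eq_bigr => i _.
by rewrite /e; move: (x i / y i) => q; field.
Qed.

End prediction_filter.

(** * Predictive vectors depending analytically on the parameters *)

Section analytic_filter.
Variables (R : realType) (d : nat) (a : 'rV[R]_d) (r : R) (l : nat).
Hypothesis r_gt0 : 0 < r.
Local Notation AN := (analytic_bound a r).
Local Notation D := (polydisc a r).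
Implicit Types (x y : 'rV[R]_d -> 'I_l -> R).

(** The substitute for an l1 norm of at most [K], which pairs with a uniform bound on the entries of
    another vector. *)
Definition l1_bound (v : 'rV[R]_d -> 'I_l -> R) (K : R) := exists m : 'I_l -> R,
  (forall i, AN (fun s => v s i) (m i)) /\ \sum_i m i <= K.

(** A rational stand-in for Hilbert's projective metric: the oscillation of the ratios vanishes
    exactly when the vectors are proportional. *)
Definition close x y t :=
  forall i k, AN (fun s => x s i / y s i - x s k / y s k) t.

Lemma analytic_bound_of_near (f : 'rV[R]_d -> R) b t :
  AN (fun s => f s - b) t -> AN f (`|b| + t).
Proof.
move=> fb; apply: analytic_bound_ext (analytic_boundD r_gt0 (analytic_bound_cst a r_gt0 b) fb).
by move=> s _; rewrite addrC subrK.
Qed.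

(** The source of all the factors [1 + l%:R * e]: a vector near a constant non-negative one has
    nearly the mass of the latter as its l1 bound. *)
Lemma l1_bound_near (v : 'rV[R]_d -> 'I_l -> R) (v0 : 'I_l -> R) (K e K' : R) :
  (forall i, 0 <= v0 i) -> \sum_i v0 i = K ->
  (forall i, AN (fun s => v s i - v0 i) e) -> K + l%:R * e <= K' ->
  l1_bound v K'.
Proof.
move=> v00 v0K ve eK; exists (fun i => v0 i + e); split.
  by move=> i; have := analytic_bound_of_near (ve i); rewrite ger0_norm.
by rewrite big_split/= sumr_const card_ord -[_ *+ _]mulr_natl v0K.
Qed.

Lemma l1_bound_dot (v : 'rV[R]_d -> 'I_l -> R) (f : 'I_l -> 'rV[R]_d -> R) K t :
  0 <= t -> l1_bound v K -> (forall i, AN (f i) t) ->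
  AN (fun s => \sum_i v s i * f i s) (K * t).
Proof.
move=> t0 [m [vm mK]] ft; apply: (@analytic_bound_le _ _ _ _ _ (\sum_i m i * t)).
  by rewrite -mulr_suml ler_wpM2r.
by apply: analytic_bound_sum => // i _; exact: analytic_boundM.
Qed.

(** Averaging [x_i / y_i - x_k / y_k] over k with weights [y_k] gives [x_i / y_i - 1], because both
    vectors sum to 1. *)
Lemma close_sub1 x y K t : 0 <= t -> l1_bound y K -> close x y t ->
  (forall s, D s -> (forall i, y s i != 0) /\ \sum_i y s i = 1 /\ \sum_i x s i = 1) ->
  forall i, AN (fun s => x s i / y s i - 1) (K * t).
Proof.
move=> t0 yK xyt xy1 i.
apply: analytic_bound_ext (l1_bound_dot t0 yK (xyt i)) => s Ds.
have [y0 [y1 x1]] := xy1 _ Ds.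
under eq_bigr do rewrite mulrBr.
rewrite sumrB -mulr_suml y1 mul1r; congr (_ - _); rewrite -[RHS]x1.
by apply: eq_bigr => k _; rewrite mulrC divfK.
Qed.

Lemma close_cst_near x xi t c : 0 < c -> simplex c xi -> close x (fun=> xi) t ->
  (forall s, D s -> \sum_i x s i = 1) ->
  forall i, AN (fun s => x s i - xi i) t.
Proof.
move=> c0 xic xt x1 i; have xi0 j : 0 < xi j := lt_le_trans c0 (xic.1 j).
have t0 := analytic_bound_ge0 (xt i i).
have h : l1_bound (fun=> xi) 1.
  exists xi; split; last by rewrite xic.2.
  by move=> j; have := analytic_bound_cst a r_gt0 (xi j); rewrite ger0_norm// ltW.
have := close_sub1 t0 h xt.
move=> /(_ _ i) h'; apply: (@analytic_bound_le _ _ _ _ _ (xi i * (1 * t))).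
  by rewrite mul1r ler_piMl// (simplex_le1 _ (ltW c0) xic).
have := analytic_bound_scale (xi i) (h' _).
rewrite (ger0_norm (ltW (xi0 i))) => h''.
apply: analytic_bound_ext (h'' _) => s Ds.
  by rewrite mulrBr mulr1 mulrC divfK// gt_eqF.
by split=> [j|]; [rewrite gt_eqF|rewrite xic.2 x1].
Qed.

(** The difference is ((f - f0) - (f0 / h0) (h - h0)) / h; the numerator has bound 2 t because |f0 /
    h0| <= 1, and the inverse of [h] has bound 2 / c because t <= c / 2. *)
Lemma analytic_bound_ratio_near (f h : 'rV[R]_d -> R) (f0 h0 c t : R) :
  0 < c -> c <= h0 -> `|f0| <= h0 -> t <= c / 2 ->
  AN (fun s => f s - f0) t -> AN (fun s => h s - h0) t ->
  AN (fun s => f s / h s - f0 / h0) (4 * t / c).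
Proof.
move=> c0 ch f0h tc fAN hAN.
have t0 := analytic_bound_ge0 fAN; have h00 := lt_le_trans c0 ch.
have th : t < h0 by apply: le_lt_trans tc _; lra.
have hi := analytic_bound_inv r_gt0 hAN th.
have q1 : `|f0 / h0| <= 1.
  by rewrite normrM normfV (ger0_norm (ltW h00)) ler_pdivrMr// mul1r.
have num := analytic_boundB r_gt0 fAN (analytic_bound_scale (f0 / h0) hAN).
have := analytic_boundM r_gt0 num hi.
move=> H; apply: (@analytic_bound_le _ _ _ _ _ ((t + `|f0 / h0| * t) * (h0 - t)^-1)).
  have -> : 4 * t / c = (t + t) * (c / 2)^-1 by field; rewrite gt_eqF.
  apply: ler_pM.
  - by rewrite addr_ge0// mulr_ge0.
  - by rewrite invr_ge0 subr_ge0 ltW.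
  - by rewrite lerD2l ler_piMl.
  - rewrite lef_pV2 ?posrE ?divr_gt0 ?subr_gt0//; lra.
apply: analytic_bound_ext H => s Ds.
have hs : h s != 0.
  have := analytic_bound_norm hAN Ds; rewrite ler_norml => /andP[hs _].
  by rewrite gt_eqF//; lra.
by field; rewrite hs gt_eqF.
Qed.

End analytic_filter.

(** * One prediction step: perturbation and contraction *)

Section one_step.
Variables (R : realType) (d : nat) (a : 'rV[R]_d) (r : R) (l : nat).
Hypothesis r_gt0 : 0 < r.
Local Notation AN := (analytic_bound a r).
Local Notation D := (polydisc a r).
Variables (Pi : 'rV[R]_d -> 'M[R]_l) (Pi0 : 'M[R]_l).
Variables (g : 'rV[R]_d -> 'I_l -> R) (g0 : 'I_l -> R) (istar : 'I_l).
Variables (c G de : R).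
Hypotheses (c_gt0 : 0 < c) (c_le : c <= 1 / 2) (de1 : de <= 1).
Hypothesis Pi0_ge : forall i j, c <= Pi0 i j.
Hypothesis Pi0_sum : forall i, \sum_j Pi0 i j = 1.
Hypothesis Pi_ge : forall s, D s -> forall i j, c <= Pi s i j.
Hypothesis Pi_sum : forall s, D s -> forall i, \sum_j Pi s i j = 1.
Hypothesis Pi_near : forall i j, AN (fun s => Pi s i j - Pi0 i j) de.
Hypothesis g0_ge0 : forall i, 0 <= g0 i.
Hypothesis g0_le : forall i, g0 i <= G.
Hypothesis g0_star : g0 istar = 1.
Hypothesis g_ge0 : forall s, D s -> forall i, 0 <= g s i.
Hypothesis g_star : forall s, D s -> g s istar = 1.
Hypothesis g_near : forall i, AN (fun s => g s i - g0 i) de.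
Implicit Types (x y : 'rV[R]_d -> 'I_l -> R) (xi : 'I_l -> R).

(** Error of a sum of [l] products x_i g_i Pi_ij whose factors are off by [eta], [de] and [de];
    [G + 1] bounds g and [2] bounds Pi. *)
Definition step_error (eta : R) : R :=
  l%:R * (2 * (eta * (G + 1) + de) + G * de).

Definition step_next x s := predict (Pi s) (g s) (x s).

Let de0 : 0 <= de := analytic_bound_ge0 (g_near istar).
Let G0 : 0 <= G := le_trans (g0_ge0 istar) (g0_le istar).

Let Pi0_le1 i j : Pi0 i j <= 1.
Proof.
rewrite -(Pi0_sum i) (bigD1 j)//= lerDl sumr_ge0// => k _.
exact: le_trans (ltW c_gt0) (Pi0_ge i k).
Qed.

Let Pi0_ge0 i j : 0 <= Pi0 i j := le_trans (ltW c_gt0) (Pi0_ge i j).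

Let l1 : 1 <= l%:R :> R.
Proof. by rewrite ler1n; case: l istar => [[]|]. Qed.

Section near_point.
Variables (x : 'rV[R]_d -> 'I_l -> R) (xi : 'I_l -> R) (eta : R).
Hypothesis xi_simplex : simplex c xi.
Hypothesis x_simplex : forall s, D s -> simplex c (x s).
Hypothesis x_near : forall i, AN (fun s => x s i - xi i) eta.
Local Notation tau := (step_error eta).

Let eta0 : 0 <= eta := analytic_bound_ge0 (x_near istar).
Let xi_ge0 i : 0 <= xi i := le_trans (ltW c_gt0) (xi_simplex.1 i).
Let xi_le1 i : xi i <= 1 := simplex_le1 i (ltW c_gt0) xi_simplex.

Let num1 i : AN (fun s => x s i * g s i - xi i * g0 i) (eta * (G + 1) + de).
Proof.
have gG : AN (fun s => g s i) (G + 1).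
  apply: analytic_bound_le (analytic_bound_of_near r_gt0 (g_near i)).
  by rewrite ger0_norm// lerD.
have := analytic_boundD r_gt0 (analytic_boundM r_gt0 (x_near i) gG)
  (analytic_bound_scale (xi i) (g_near i)).
move=> h; apply: (@analytic_bound_le _ _ _ _ _ (eta * (G + 1) + `|xi i| * de)).
  by rewrite lerD2l ger0_norm// ler_piMl.
by apply: analytic_bound_ext h => s _; ring.
Qed.

Let num2 i j : AN (fun s => x s i * g s i * Pi s i j - xi i * g0 i * Pi0 i j)
  (2 * (eta * (G + 1) + de) + G * de).
Proof.
have pG : AN (fun s => Pi s i j) 2.
  apply: analytic_bound_le (analytic_bound_of_near r_gt0 (Pi_near i j)).
  rewrite (ger0_norm (Pi0_ge0 i j)); have := Pi0_le1 i j; have := de1; lra.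
have := analytic_boundD r_gt0 (analytic_boundM r_gt0 (num1 i) pG)
  (analytic_bound_scale (xi i * g0 i) (Pi_near i j)).
move=> h; apply: (@analytic_bound_le _ _ _ _ _ ((eta * (G + 1) + de) * 2 + `|xi i * g0 i| * de)).
  rewrite mulrC lerD2l ler_wpM2r// ger0_norm ?mulr_ge0//.
  by rewrite -[G]mul1r ler_pM.
by apply: analytic_bound_ext h => s _; ring.
Qed.

Let err1 : 0 <= eta * (G + 1) + de.
Proof. by rewrite addr_ge0// mulr_ge0// addr_ge0. Qed.

Let num1_tau : eta * (G + 1) + de <= tau.
Proof.
rewrite /step_error; apply: (@le_trans _ _ (2 * (eta * (G + 1) + de) + G * de)).
  have := mulr_ge0 G0 de0; have := err1; lra.
by rewrite ler_peMl// addr_ge0// mulr_ge0.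
Qed.

Let num2_tau : 2 * (eta * (G + 1) + de) + G * de <= tau.
Proof. by rewrite /step_error ler_peMl// addr_ge0// mulr_ge0. Qed.

Let sum_const (t : R) : \sum_(i < l) t = l%:R * t.
Proof. by rewrite sumr_const card_ord -[_ *+ _]mulr_natl. Qed.

Lemma weight_near : AN (fun s => weight (g s) (x s) - weight g0 xi) tau.
Proof.
apply: (@analytic_bound_le _ _ _ _ _ (\sum_(i < l) (eta * (G + 1) + de))).
  rewrite sum_const /step_error ler_wpM2l//.
  have := mulr_ge0 G0 de0; have := err1; lra.
apply: analytic_bound_ext (analytic_bound_sum r_gt0 (index_enum _) (P := xpredT) (fun i _ => num1 i)) => s _.
by rewrite sumrB.
Qed.

Let den_near j : AN (fun s => \sum_m x s m * g s m * Pi s m j -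
  \sum_m xi m * g0 m * Pi0 m j) tau.
Proof.
rewrite /step_error -sum_const.
apply: analytic_bound_ext (analytic_bound_sum r_gt0 (index_enum _) (P := xpredT) (fun i _ => num2 i j)) => s _.
by rewrite sumrB.
Qed.

Let weight0_ge : c <= weight g0 xi.
Proof. exact: weight_ge (ltW c_gt0) xi_simplex g0_ge0 g0_star. Qed.

Let term0_ge0 i : 0 <= xi i * g0 i. Proof. exact: mulr_ge0. Qed.

Let term0_le i : xi i * g0 i <= weight g0 xi.
Proof. by rewrite /weight (bigD1 i)//= lerDl sumr_ge0. Qed.

Let den0_le j : \sum_m xi m * g0 m * Pi0 m j <= weight g0 xi.
Proof. by apply: ler_sum => m _; rewrite ler_piMr. Qed.

Let den0_ge j : c ^+ 2 <= \sum_m xi m * g0 m * Pi0 m j.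
Proof.
rewrite expr2; apply: (@le_trans _ _ (weight g0 xi * c)); first by rewrite ler_wpM2r// ltW.
by rewrite mulr_suml; apply: ler_sum => m _; rewrite ler_wpM2l.
Qed.

Let termP0_ge0 i j : 0 <= xi i * g0 i * Pi0 i j. Proof. exact: mulr_ge0. Qed.

Let termP0_le i j : xi i * g0 i * Pi0 i j <= \sum_m xi m * g0 m * Pi0 m j.
Proof. by rewrite [leRHS](bigD1 i)//= lerDl sumr_ge0. Qed.

Hypothesis tau_le : tau <= c ^+ 2 / 2.
(** The error of [analytic_bound_ratio_near] for the smallest denominators, those of the smoothing
    weights, which are at least c^2; it also covers the denominators bounded below by [c]. *)
Local Notation eps := (4 * tau / c ^+ 2).

Let tau0 : 0 <= tau. Proof. exact: le_trans err1 num1_tau. Qed.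

Let c2_le : c ^+ 2 <= c.
Proof. by rewrite expr2 ler_piMr ?(ltW c_gt0)//; have := c_le; lra. Qed.

Let tau_le' : tau <= c / 2.
Proof. by apply: le_trans tau_le _; rewrite ler_wpM2r ?invr_ge0. Qed.

Let eps_ge : 4 * tau / c <= eps.
Proof.
apply: ler_wpM2l; first exact: mulr_ge0.
by rewrite lef_pV2 ?posrE ?exprn_gt0.
Qed.

Let eps0 : 0 <= eps.
Proof. by apply: divr_ge0; [exact: mulr_ge0|exact: sqr_ge0]. Qed.

Lemma posterior_near i : AN (fun s => posterior (g s) (x s) i - posterior g0 xi i) eps.
Proof.
apply: (analytic_bound_le eps_ge); apply: analytic_bound_ratio_near => //.
- by rewrite ger0_norm.
- exact: analytic_bound_le num1_tau (num1 i).
- exact: weight_near.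
Qed.

Lemma predict_near j :
  AN (fun s => step_next x s j - predict Pi0 g0 xi j) eps.
Proof.
apply: (analytic_bound_le eps_ge); apply: analytic_bound_ratio_near => //.
- by rewrite ger0_norm// sumr_ge0.
- exact: weight_near.
Qed.

Lemma smoothing_near j i :
  AN (fun s => smoothing (Pi s) (g s) (x s) j i - smoothing Pi0 g0 xi j i) eps.
Proof.
apply: analytic_bound_ratio_near => //.
- by rewrite exprn_gt0.
- by rewrite ger0_norm.
- exact: analytic_bound_le num2_tau (num2 i j).
Qed.

Let weight0_gt0 : 0 < weight g0 xi := lt_le_trans c_gt0 weight0_ge.

Let den0_gt0 j : 0 < \sum_m xi m * g0 m * Pi0 m j.
Proof. by apply: lt_le_trans (den0_ge j); rewrite exprn_gt0. Qed.

Let leps : 0 <= l%:R * eps. Proof. exact: mulr_ge0. Qed.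

Lemma posterior_l1 K : 1 + 3 * (l%:R * eps) <= K ->
  l1_bound a r (fun s => posterior (g s) (x s)) K.
Proof.
move=> eK; apply: (l1_bound_near r_gt0 _ _ posterior_near).
- by move=> i; rewrite divr_ge0// ltW.
- by rewrite sum_posterior// gt_eqF.
- have := leps; lra.
Qed.

Let e j s i := (smoothing (Pi s) (g s) (x s) j i - c * posterior (g s) (x s) i) / (1 - c).

Let c1 : 0 < 1 - c. Proof. have := c_le; lra. Qed.

(** At the base point a smoothing weight dominates [c] times the posterior weight: [Pi0 i j] is at
    least [c], and the denominator is at most the total weight. The factor 3 bounds (1 + c) / (1 -
    c) for c <= 1/2. *)
Lemma excess_l1 K j : 1 + 3 * (l%:R * eps) <= K -> l1_bound a r (e j) K.
Proof.
move=> eK; pose e0 i := (smoothing Pi0 g0 xi j i - c * posterior g0 xi i) / (1 - c).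
apply: (@l1_bound_near _ _ _ _ _ r_gt0 _ e0 1 (3 * eps)).
- move=> i; rewrite divr_ge0 ?(ltW c1)// subr_ge0 /smoothing /posterior mulrA.
  apply: ler_pM.
  + by rewrite mulr_ge0// ltW.
  + by rewrite invr_ge0 ltW.
  + by rewrite mulrC ler_wpM2l.
  + by rewrite lef_pV2 ?posrE.
- rewrite /e0 -mulr_suml sumrB -mulr_sumr sum_smoothing ?gt_eqF//.
  by rewrite sum_posterior ?gt_eqF// mulr1 divff// gt_eqF.
- move=> i; have := analytic_boundB r_gt0 (smoothing_near j i) (analytic_bound_scale c (posterior_near i)).
  move=> /(analytic_bound_scale (1 - c)^-1) h.
  apply: (@analytic_bound_le _ _ _ _ _ (`|(1 - c)^-1| * (eps + `|c| * eps))).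
    rewrite !ger0_norm ?invr_ge0 ?(ltW c_gt0) ?(ltW c1)// mulrC ler_pdivrMr//.
    have -> : eps + c * eps = (1 + c) * eps by ring.
    have -> : 3 * eps * (1 - c) = 3 * (1 - c) * eps by ring.
    apply: ler_wpM2r => //; have := c_le; lra.
  by apply: analytic_bound_ext h => s _; rewrite /e /e0; field; rewrite gt_eqF.
- have := leps; rewrite mulrCA; lra.
Qed.

Let x_gt0 s i : D s -> 0 < x s i.
Proof. by move=> Ds; exact: lt_le_trans c_gt0 ((x_simplex Ds).1 i). Qed.

Variables (u : 'rV[R]_d -> 'I_l -> R) (t K : R).
Hypothesis u_simplex : forall s, D s -> simplex c (u s).
Hypothesis ux_close : close a r u x t.
Hypothesis eps_K : 1 + 3 * (l%:R * eps) <= K.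
Hypothesis eta_K : 1 + l%:R * eta <= K.

Let t0 : 0 <= t := analytic_bound_ge0 (ux_close istar istar).
Let K0 : 0 <= K.
Proof. have := leps; have := eps_K; lra. Qed.

Let ratio_near i : AN (fun s => u s i / x s i - 1) (K * t).
Proof.
apply: (close_sub1 r_gt0) => //.
  by apply: (l1_bound_near r_gt0 _ _ x_near) => //; rewrite xi_simplex.2.
move=> s Ds; split=> [j|]; first by rewrite gt_eqF// x_gt0.
by rewrite (x_simplex Ds).2 (u_simplex Ds).2.
Qed.

Let weight_gt0 (y : 'I_l -> R) s : simplex c y -> D s -> 0 < weight (g s) y.
Proof.
move=> ys Ds; apply: lt_le_trans c_gt0 _.
by apply: (weight_ge (ltW c_gt0) ys (g_ge0 Ds) (g_star Ds)).
Qed.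

Lemma weight_ratio_near :
  AN (fun s => weight (g s) (u s) / weight (g s) (x s) - 1) (K * (K * t)).
Proof.
have := l1_bound_dot r_gt0 (mulr_ge0 K0 t0) (posterior_l1 eps_K) ratio_near.
apply: analytic_bound_ext => s Ds; rewrite weight_ratio.
  under eq_bigr do rewrite mulrBr mulr1.
  by rewrite sumrB sum_posterior// gt_eqF// weight_gt0//; exact: x_simplex.
by move=> i; rewrite gt_eqF// x_gt0.
Qed.

(** In [predict_ratioB], each of the two families of excess weights costs a factor [K] where a
    probability vector would cost 1, and the prefactor costs the inverse of [1 - K * (K * t)]. The
    last hypothesis says that the rate [1 - c] with these losses is still at most [rho]. *)
Lemma close_step rho : K * (K * t) < 1 ->
  (1 - c) * (K * K) <= rho * (1 - K * (K * t)) ->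
  close a r (step_next u) (step_next x) (rho * t).
Proof.
move=> Kt Krho j k.
have hW := analytic_bound_inv r_gt0 weight_ratio_near Kt.
have hS : AN (fun s => \sum_i e j s i * (\sum_m e k s m * (u s i / x s i - u s m / x s m))) (K * (K * t)).
  apply: (l1_bound_dot r_gt0); [exact: mulr_ge0|exact: excess_l1|move=> i].
  by apply: (l1_bound_dot r_gt0) => //; exact: excess_l1.
have := analytic_boundM r_gt0 hW (analytic_bound_scale (1 - c) hS).
move=> h; apply: (@analytic_bound_le _ _ _ _ _ ((1 - K * (K * t))^-1 * (`|1 - c| * (K * (K * t))))).
  rewrite (ger0_norm (ltW c1)) mulrC ler_pdivrMr ?subr_gt0//.
  have -> : (1 - c) * (K * (K * t)) = (1 - c) * (K * K) * t by ring.
  by rewrite [leRHS]mulrAC ler_wpM2r.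
apply: analytic_bound_ext h => s Ds; rewrite invf_div /step_next.
have Wu := weight_gt0 (u_simplex Ds) Ds; have Wx := weight_gt0 (x_simplex Ds) Ds.
have gs := g_ge0 Ds; have Ps := Pi_ge Ds; have xs i := x_gt0 i Ds.
rewrite (@predict_ratioB _ _ c)//.
- congr (_ * (_ * _)); apply: eq_bigr => i _; rewrite mulr_sumr.
  by apply: eq_bigr => m _; rewrite mulrA.
- by have := c_le; lra.
- by move=> i; rewrite gt_eqF.
- by rewrite gt_eqF.
- by rewrite gt_eqF.
- move=> j'; rewrite gt_eqF//; apply: (@lt_le_trans _ _ (x s istar * g s istar * Pi s istar j')).
    by rewrite g_star// mulr1 mulr_gt0// (lt_le_trans c_gt0).
  rewrite [leRHS](bigD1 istar)//= lerDl sumr_ge0// => m _.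
  by apply: mulr_ge0; [apply: mulr_ge0 => //; exact: ltW|exact: le_trans (ltW c_gt0) (Ps _ _)].
Qed.

End near_point.

Lemma step_next_simplex x s : D s -> simplex c (x s) -> simplex c (step_next x s).
Proof.
move=> Ds xs; apply: simplex_predict; rewrite ?(ltW c_gt0)//.
- by move=> i; apply: le_trans (ltW c_gt0) (xs.1 i).
- exact: g_ge0.
- by apply: (lt_le_trans c_gt0); apply: (weight_ge (ltW c_gt0) xs (g_ge0 Ds) (g_star Ds)).
- exact: Pi_sum.
- exact: Pi_ge.
Qed.

Lemma analytic_bound_self (y : 'I_l -> R) i : AN (fun=> y i - y i) 0.
Proof.
by rewrite subrr; have := analytic_bound_cst a r_gt0 (0 : R); rewrite normr0.
Qed.

(** Positivity has to be required pointwise, since analytic bounds do not see signs. Closeness to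
    one constant vector is what gives analytic bounds for inverses and logarithms. *)
Definition near_simplex eta x := (forall s, D s -> simplex c (x s)) /\
  exists2 xi, simplex c xi & close a r x (fun=> xi) eta.

Lemma near_simplex_cst eta xi : 0 <= eta -> simplex c xi -> near_simplex eta (fun=> xi).
Proof.
move=> eta0 xic; split=> //; exists xi => // i k.
have xi0 j : xi j != 0 by rewrite gt_eqF// (lt_le_trans c_gt0 (xic.1 j)).
by rewrite !divff//; apply: analytic_bound_le eta0 (analytic_bound_self (fun=> 1) i).
Qed.

(** Let [y] be the constant state [xi] near [x]. By contraction [step_next x] is within [rho * eta]
    of [step_next y], which differs from the constant [predict Pi0 g0 xi] by at most [e0], an error
    due to the variation of the parameters alone. Invariance follows when [e0] is small compared
    with [(1 - rho) * eta]. *)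
Lemma near_simplex_step eta rho K x :
  let e := 4 * step_error eta / c ^+ 2 in let e0 := 4 * step_error 0 / c ^+ 2 in
  step_error eta <= c ^+ 2 / 2 ->
  1 + 3 * (l%:R * e) <= K -> 1 + l%:R * eta <= K ->
  K * (K * eta) < 1 -> (1 - c) * (K * K) <= rho * (1 - K * (K * eta)) ->
  rho <= 1 -> 6 * e0 / c <= (1 - rho) * eta -> eta <= 1 / 2 -> K <= 2 ->
  near_simplex eta x -> near_simplex eta (step_next x).
Proof.
move=> e e0 tau_le eK etaK Keta Krho rho1 e0eta eta2 K2 [xD [xi xic xxi]].
have eta0 : 0 <= eta := analytic_bound_ge0 (xxi istar istar).
split; first by move=> s Ds; apply: step_next_simplex => //; exact: xD.
pose y : 'rV[R]_d -> 'I_l -> R := fun=> xi.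
have tau0_le : step_error 0 <= step_error eta.
  by rewrite /step_error ler_wpM2l// lerD2r ler_wpM2l// lerD2r mul0r mulr_ge0// addr_ge0.
have e0e : e0 <= e.
  by rewrite /e0 /e ler_wpM2r ?invr_ge0 ?sqr_ge0// ler_wpM2l.
have y_near i : AN (fun s => y s i - xi i) 0 by exact: analytic_bound_self.
have yD s : D s -> simplex c (y s) by [].
have tau0' : step_error 0 <= c ^+ 2 / 2 by exact: le_trans tau0_le tau_le.
have e0K : 1 + 3 * (l%:R * e0) <= K.
  by apply: le_trans eK; rewrite lerD2l ler_wpM2l// ler_wpM2l.
have zK : 1 + l%:R * 0 <= K.
  by apply: le_trans etaK; rewrite lerD2l ler_wpM2l.
have cl := close_step xic yD y_near tau0' xD xxi e0K zK Keta Krho.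
have yn := predict_near xic y_near tau0'; rewrite -/e0 in yn.
set xi' := predict Pi0 g0 xi in yn.
have xi'c : simplex c xi'.
  apply: simplex_predict; rewrite ?(ltW c_gt0)//.
    by move=> i; apply: le_trans (ltW c_gt0) (xic.1 i).
  by apply: (lt_le_trans c_gt0); apply: (weight_ge (ltW c_gt0) xic g0_ge0 g0_star).
have e00 : 0 <= e0 := analytic_bound_ge0 (yn istar).
have xi'0 i : 0 < xi' i := lt_le_trans c_gt0 (xi'c.1 i).
exists xi' => // j k.
have q_near i : AN (fun s => step_next y s i / xi' i - 1) (e0 / c).
  have := analytic_bound_scale (xi' i)^-1 (yn i); rewrite ger0_norm ?invr_ge0 ?(ltW (xi'0 i))// => h.
  apply: (@analytic_bound_le _ _ _ _ _ ((xi' i)^-1 * e0)).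
    by rewrite mulrC ler_wpM2l// lef_pV2 ?posrE// xi'c.1.
  by apply: analytic_bound_ext h => s _; rewrite mulrBr mulVf ?gt_eqF// mulrC.
have yl : l1_bound a r (step_next y) K.
  apply: (l1_bound_near r_gt0 _ xi'c.2 yn) => [i|]; first exact: ltW.
  apply: le_trans e0K; rewrite lerD2l; have : 0 <= l%:R * e0 by exact: mulr_ge0.
  lra.
have rhoe : rho * eta <= eta by rewrite ler_piMl.
have rho0 : 0 <= rho * eta := analytic_bound_ge0 (cl istar istar).
have p_near i : AN (fun s => step_next x s i / step_next y s i) 2.
  have h : AN (fun s => step_next x s i / step_next y s i - 1) (K * (rho * eta)).
    apply: (close_sub1 r_gt0 rho0 yl cl) => s Ds.
    have [ysc ys1] := step_next_simplex Ds (yD s Ds).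
    have [_ xs1] := step_next_simplex Ds (xD s Ds).
    by split=> // m; rewrite gt_eqF// (lt_le_trans c_gt0).
  apply: analytic_bound_le (analytic_bound_of_near r_gt0 h).
  rewrite normr1; have : K * (rho * eta) <= 2 * (1 / 2).
    apply: ler_pM => //; last exact: le_trans rhoe eta2.
    by move: zK; rewrite mulr0; lra.
  lra.
(* Write the ratio to [xi'] as p q, with p the ratio of the two steps and q that of [step_next y] to
   [xi']. Its difference between j and k is p_j - p_k, plus p_j (q_j - 1), minus p_k (q_k - 1). *)
have pq i := analytic_boundM r_gt0 (p_near i) (q_near i).
have := analytic_boundD r_gt0 (cl j k) (analytic_boundB r_gt0 (pq j) (pq k)).
move=> h; apply: (@analytic_bound_le _ _ _ _ _ (rho * eta + (2 * (e0 / c) + 2 * (e0 / c)))).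
  have : 0 <= e0 / c by rewrite divr_ge0// ltW.
  move: e0eta; rewrite -mulrA; lra.
apply: analytic_bound_ext h => s Ds.
have [ysc _] := step_next_simplex Ds (yD s Ds).
have ys0 i : step_next y s i != 0 by rewrite gt_eqF// (lt_le_trans c_gt0).
by field; rewrite !ys0 !gt_eqF.
Qed.

End one_step.

(** * The Markov operator of the filter *)

Section filter_operator.
Variables (R : realType) (l : nat).
Local Notation mu := (@lebesgue_measure R).
Implicit Types (P : 'M[R]_l) (q : 'I_l -> R -> R) (w : 'I_l -> R).

Definition filter_op P q (phi : 'I_l -> ('I_l -> R) -> R) i w : R :=
  \int[mu]_z (q i z * \sum_j P i j * phi j (predict P (q ^~ z) w)).

Definition log_gain q i w : R :=
  - \int[mu]_z (q i z * ln (weight (q ^~ z) w)).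

Lemma continuous_sum_ord (n : nat) (f : 'I_n -> R -> R) :
  (forall i, continuous (f i)) -> continuous (fun z => \sum_i f i z).
Proof. by move=> cf z; apply: (cvg_sum_seq (l := fun i => f i z)) => i; exact: cf. Qed.

Lemma weight_gt0_of_simplex c (g : 'I_l -> R) w (istar : 'I_l) : 0 < c -> simplex c w ->
  (forall i, 0 < g i) -> 0 < weight g w.
Proof.
move=> c0 [wc _] g0; rewrite /weight (bigD1 istar)//= ltr_pwDl//.
  by rewrite mulr_gt0// (lt_le_trans c0).
by rewrite sumr_ge0// => i _; rewrite mulr_ge0// ltW// (lt_le_trans c0).
Qed.

Lemma continuous_weight q w : (forall i, continuous (q i)) ->
  continuous (fun z => weight (q ^~ z) w).
Proof.
move=> cq; apply: continuous_sum_ord => i z; apply: cvgM; first exact: cvg_cst.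
exact: cq.
Qed.

Lemma continuous_predict P q w c (istar j : 'I_l) : 0 < c -> simplex c w ->
  (forall i, continuous (q i)) -> (forall i z, 0 < q i z) ->
  continuous (fun z => predict P (q ^~ z) w j).
Proof.
move=> c0 wc cq q0 z; apply: cvgM.
  move: z; apply: continuous_sum_ord => i z; apply: cvgM; last exact: cvg_cst.
  by apply: cvgM; [exact: cvg_cst|exact: cq].
apply: cvgV; last exact: continuous_weight.
by rewrite gt_eqF// (weight_gt0_of_simplex istar c0 wc).
Qed.

Lemma gauss_dominatedM (g B : R -> R) C : 0 <= C -> gauss_dominated B ->
  (forall z, `|g z| <= B z * C) -> gauss_dominated g.
Proof.
move=> C0 [A [k [k0 BA]]] gB; exists (A * C), k; split=> // z.
apply: le_trans (gB z) _; rewrite mulrAC ler_wpM2r//.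
exact: le_trans (ler_norm _) (BA z).
Qed.

End filter_operator.

(** * The Markov operator acting on functions of the parameters *)

Section analytic_operator.
Variables (R : realType) (d : nat) (a : 'rV[R]_d) (r : R) (l : nat).
Hypothesis r_gt0 : 0 < r.
Local Notation AN := (analytic_bound a r).
Local Notation D := (polydisc a r).
Local Notation mu := (@lebesgue_measure R).
Variables (Pi : 'rV[R]_d -> 'M[R]_l) (q : 'rV[R]_d -> 'I_l -> R -> R).
Variables (Q : 'I_l -> R -> R) (istar : 'I_l).
Variables (c eta rho M kA KP KE : R).
Local Notation X := (near_simplex a r c eta).
Hypotheses (c_gt0 : 0 < c) (eta_gt0 : 0 < eta) (lc1 : l%:R * c < 1) (rho_le1 : rho <= 1).
Hypothesis Pi_ge : forall s, D s -> forall i j, c <= Pi s i j.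
Hypothesis Pi_sum : forall s, D s -> forall i, \sum_j Pi s i j = 1.
Hypothesis q_gt0 : forall s, D s -> forall i z, 0 < q s i z.
Hypothesis q_cont : forall s, D s -> forall i, continuous (q s i).
Hypothesis q_int : forall s, D s -> forall i, \int[mu]_z q s i z = 1.
Hypothesis qQ : forall i z, AN (fun s => q s i z) (Q i z).
Hypothesis Q_cont : forall i, continuous (Q i).
Hypothesis Q_dom : forall i, gauss_dominated (Q i).
Hypothesis Pi_l1 : forall i, l1_bound a r (fun s => Pi s i) KP.
Hypothesis KP_ge1 : 1 <= KP.
Hypothesis Pi_excess : forall i, l1_bound a r (fun s j => Pi s i j - c) KE.
Hypothesis KE_le : KE * KE <= kA * (1 - l%:R * c).
Hypothesis Q_int : forall i, (\int[mu]_z Q i z) * KP <= M.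

Definition next z (x : 'rV[R]_d -> 'I_l -> R) s := predict (Pi s) (q s ^~ z) (x s).

Hypothesis next_near : forall z x, X x -> X (next z x).
Hypothesis next_close : forall z x y t, X x -> X y -> t <= eta -> close a r x y t ->
  close a r (next z x) (next z y) (rho * t).

(** [U] is a size, [A] measures the dependence on the input, and [L] is a Lipschitz constant in the
    predictive vector. The latter is only local, for distances up to [eta], the range in which
    inverses and logarithms are under control. *)
Definition tame (phi : 'rV[R]_d -> 'I_l -> ('I_l -> R) -> R) (U A L : R) :=
  [/\ forall x i, X x -> AN (fun s => phi s i (x s)) U,
      forall x i j, X x -> AN (fun s => phi s i (x s) - phi s j (x s)) A &
      forall x y t i, X x -> X y -> t <= eta -> close a r x y t ->
        AN (fun s => phi s i (x s) - phi s i (y s)) (L * t)].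

Let Q_ge0 i z : 0 <= Q i z := analytic_bound_ge0 (qQ i z).

Let Q_integrable i : mu.-integrable setT (EFin \o Q i).
Proof. exact: gauss_dominated_integrable. Qed.

Let KP_ge0 : 0 <= KP := le_trans ler01 KP_ge1.

Let cst_near (xi : 'I_l -> R) : simplex c xi -> X (fun=> xi).
Proof. by move=> xic; apply: near_simplex_cst => //; exact: ltW. Qed.

Let a_in_D : D a. Proof. by move=> i; rewrite subrr normr0. Qed.

Let simplex0 : simplex c (fun j => Pi a istar j).
Proof. by split; [move=> j; exact: Pi_ge|exact: Pi_sum]. Qed.

Section tame_function.
Variables (phi : 'rV[R]_d -> 'I_l -> ('I_l -> R) -> R) (U A L : R).
Hypothesis phi_tame : tame phi U A L.

Lemma tame_bound_ge0 : [/\ 0 <= U, 0 <= A & 0 <= L].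
Proof.
case: phi_tame => h1 h2 h3; have Xc := cst_near simplex0; split.
- exact: analytic_bound_ge0 (h1 _ istar Xc).
- exact: analytic_bound_ge0 (h2 _ istar istar Xc).
- have cl : close a r (fun=> fun j => Pi a istar j) (fun=> fun j => Pi a istar j) eta.
    move=> i k; have p0 j : Pi a istar j != 0.
      by rewrite gt_eqF// (lt_le_trans c_gt0)// Pi_ge.
    rewrite !divff//; apply: analytic_bound_le (ltW eta_gt0) _.
    exact: (analytic_bound_self a r_gt0 (fun=> 1) i).
  have := analytic_bound_ge0 (h3 _ _ _ istar Xc Xc (lexx _) cl).
  by rewrite pmulr_lge0.
Qed.

Lemma tame_norm s i w : D s -> simplex c w -> `|phi s i w| <= U.
Proof.
by case: phi_tame => h1 _ _ Ds /cst_near Xw; exact: analytic_bound_norm (h1 _ i Xw) Ds.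
Qed.

Lemma close_cst (w w' : 'I_l -> R) (t : R) : simplex c w' ->
  (forall i, `|w i - w' i| <= t * c) -> close a r (fun=> w) (fun=> w') (2 * t).
Proof.
move=> wc' ww i k.
have w'0 j : 0 < w' j := lt_le_trans c_gt0 (wc'.1 j).
have h j : `|w j / w' j - 1| <= t.
  have -> : w j / w' j - 1 = (w j - w' j) / w' j by field; rewrite gt_eqF.
  have t0 : 0 <= t by rewrite -(pmulr_lge0 _ c_gt0); apply: le_trans (ww j).
  rewrite normrM normfV (gtr0_norm (w'0 j)) ler_pdivrMr//.
  by apply: le_trans (ww j) _; rewrite ler_wpM2l// wc'.1.
apply: analytic_bound_le (analytic_bound_cst a r_gt0 _).
have -> : w i / w' i - w k / w' k = (w i / w' i - 1) - (w k / w' k - 1) by ring.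
apply: le_trans (ler_normB _ _) _; have := h i; have := h k; lra.
Qed.

(** Continuity in the output, which integration by Riemann sums requires, is read off from the
    Lipschitz bound on constant states. *)
Lemma tame_continuous s i (w : R -> 'I_l -> R) : D s ->
  (forall j, continuous (w ^~ j)) -> (forall z, simplex c (w z)) ->
  continuous (fun z => phi s i (w z)).
Proof.
move=> Ds cw wc z; apply/cvgrPdist_le => e e0.
have [_ _ L0] := tame_bound_ge0.
pose t := Num.min eta (e / (L + 1)).
have t0 : 0 < t by rewrite lt_min eta_gt0 divr_gt0// ltr_wpDl.
have : \forall z' \near z, forall j, `|w z j - w z' j| <= t / 2 * c.
  apply: (@filter_forall _ _ (fun (j : 'I_l) (z' : R) => `|w z j - w z' j| <= t / 2 * c) (nbhs z) _) => j; have /cvgrPdist_le := cw j z; apply.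
  by rewrite mulr_gt0// divr_gt0.
apply: filterS => z' hz'.
have h : close a r (fun=> w z) (fun=> w z') t.
  by have := close_cst (wc z') hz'; rewrite mulrC divfK.
case: phi_tame => _ _ /(_ _ _ _ i (cst_near (wc z)) (cst_near (wc z'))) h3.
have te : t <= eta by rewrite ge_min lexx.
apply: le_trans (analytic_bound_norm (h3 _ te h) Ds) _.
apply: (@le_trans _ _ ((L + 1) * t)); first by rewrite ler_wpM2r ?(ltW t0)// lerDl.
by rewrite mulrC -ler_pdivlMr ?ltr_wpDl// ge_min lexx orbT.
Qed.

(** Large enough for 1 / N <= c * eta / 2, so that consecutive points of a segment divided into [N]
    pieces are at distance at most [eta] for [close]. *)
Let N := (Num.truncn (2 / (c * eta))).+1.

(** [N] steps between two constant states, and one more at each end to reach a constant state from a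
    parameter-dependent one. *)
Definition chain_length : R := (N%:R + 2) * eta.

(* Constant states form a convex set, so any two of them are joined by [N] steps
   short enough for the local Lipschitz bound. *)
Lemma tame_chain_cst i (w w' : 'I_l -> R) : simplex c w -> simplex c w' ->
  AN (fun s => phi s i w - phi s i w') (N%:R * (L * eta)).
Proof.
move=> wc wc'; pose p (k : nat) j : R := w' j + k%:R / N%:R * (w j - w' j).
have N0 : 0 < N%:R :> R by [].
have pc k : (k <= N)%N -> simplex c (p k).
  move=> kN; have /andP[k0 k1] : 0 <= (k%:R : R) / N%:R <= 1.
    by rewrite divr_ge0//= ler_pdivrMr// mul1r ler_nat.
  split=> [j|].
    rewrite /p; have := wc.1 j; have := wc'.1 j => h1 h2.
    have := mulr_ge0 k0 (_ : 0 <= w j - c); rewrite subr_ge0 => /(_ h2).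
    have : 0 <= (1 - k%:R / N%:R) * (w' j - c) by rewrite mulr_ge0 ?subr_ge0.
    lra.
  by rewrite big_split/= -mulr_sumr sumrB wc.2 wc'.2 subrr mulr0 addr0.
have pS k : (k < N)%N -> AN (fun s => phi s i (p k.+1) - phi s i (p k)) (L * eta).
  move=> kN; case: phi_tame => _ _; apply => //; try exact/cst_near/pc; try exact/cst_near/pc/ltnW.
  have -> : eta = 2 * (eta / 2) by field.
  apply: close_cst; first exact/pc/ltnW.
  move=> j; have -> : p k.+1 j - p k j = (w j - w' j) / N%:R.
    by rewrite /p -natr1; field; rewrite gt_eqF.
  rewrite normrM normfV (ger0_norm (ltW N0)) ler_pdivrMr//.
  apply: (@le_trans _ _ 1).
    have a1 := simplex_le1 j (ltW c_gt0) wc; have b1 := simplex_le1 j (ltW c_gt0) wc'.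
    have a0 := wc.1 j; have b0 := wc'.1 j; rewrite ler_norml; have := c_gt0; lra.
  have : 2 / (c * eta) <= N%:R by rewrite ltW// truncnS_gt.
  rewrite ler_pdivrMr ?mulr_gt0//; lra.
have -> : N%:R * (L * eta) = \sum_(0 <= k < N) L * eta.
  by rewrite big_mkord sumr_const card_ord -[RHS]mulr_natl.
have := @analytic_bound_sum _ _ a r r_gt0 nat (index_iota 0 N) (fun k => (k < N)%N)
  (fun k s => phi s i (p k.+1) - phi s i (p k)) (fun=> L * eta) pS.
rewrite [X in AN _ X](_ : _ = \sum_(0 <= k < N) L * eta).
  apply: analytic_bound_ext => s Ds.
  rewrite (_ : \sum_(_ <- _ | _) _ = \sum_(0 <= k < N) (phi s i (p k.+1) - phi s i (p k))).
    rewrite (telescope_sumr (fun k => phi s i (p k)))//; congr (phi s i _ - phi s i _).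
      by apply/funext => j; rewrite /p divff ?gt_eqF// mul1r addrC subrK.
    by apply/funext => j; rewrite /p mul0r mul0r addr0.
  rewrite big_seq_cond [RHS]big_seq_cond; apply: eq_bigl => k.
  by rewrite mem_index_iota /=; case: (k < N)%N.
rewrite big_seq_cond [RHS]big_seq_cond; apply: eq_bigl => k.
by rewrite mem_index_iota /=; case: (k < N)%N.
Qed.

Lemma tame_chain i x y : X x -> X y ->
  AN (fun s => phi s i (x s) - phi s i (y s)) (chain_length * L).
Proof.
move=> Xx Xy; have [_ [xi xic xxi]] := Xx; have [_ [yi yic yyi]] := Xy.
case: (phi_tame) => _ _ h3.
have h1 := h3 _ _ _ i Xx (cst_near xic) (lexx _) xxi.
have h2 := h3 _ _ _ i Xy (cst_near yic) (lexx _) yyi.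
have := analytic_boundB r_gt0 (analytic_boundD r_gt0 h1 (tame_chain_cst i xic yic)) h2.
have -> : L * eta + N%:R * (L * eta) + L * eta = chain_length * L by rewrite /chain_length; ring.
by apply: analytic_bound_ext => s _; ring.
Qed.

Lemma tame_osc i j x y : X x -> X y ->
  AN (fun s => phi s i (x s) - phi s j (y s)) (A + chain_length * L).
Proof.
move=> Xx Xy; case: (phi_tame) => _ h2 _.
apply: analytic_bound_ext (analytic_boundD r_gt0 (h2 _ i j Xx) (tame_chain j Xx Xy)) => s _.
by ring.
Qed.

Lemma next_simplex s z w : D s -> simplex c w -> simplex c (predict (Pi s) (q s ^~ z) w).
Proof.
move=> Ds wc; apply: simplex_predict; rewrite ?(ltW c_gt0)//.
- by move=> i; apply: le_trans (ltW c_gt0) (wc.1 i).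
- by move=> i; rewrite ltW// q_gt0.
- by apply: (weight_gt0_of_simplex istar c_gt0 wc) => i; exact: q_gt0.
- exact: Pi_sum.
- exact: Pi_ge.
Qed.

Lemma integrand_continuous s i w : D s -> simplex c w ->
  continuous (fun z => \sum_j Pi s i j * phi s j (predict (Pi s) (q s ^~ z) w)).
Proof.
move=> Ds wc; apply: continuous_sum_ord => j z; apply: cvgM; first exact: cvg_cst.
apply: (@tame_continuous s j (fun z => predict (Pi s) (q s ^~ z) w)) => //.
  by move=> k; apply: (continuous_predict istar c_gt0 wc); [exact: q_cont|exact: q_gt0].
by move=> z'; exact: next_simplex.
Qed.

End tame_function.

Lemma analytic_bound_integral_q (i : 'I_l) (f : R -> 'rV[R]_d -> R) (C : R) : 0 <= C ->
  (forall z, AN (f z) (KP * C)) ->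
  (forall s, D s -> continuous (f ^~ s)) ->
  AN (fun s => \int[mu]_z (q s i z * f z s)) (M * C).
Proof.
move=> C0 fC cf; have KC0 : 0 <= KP * C by rewrite mulr_ge0.
have h : AN (fun s => \int[mu]_z (q s i z * f z s)) (\int[mu]_z (Q i z * (KP * C))).
  apply: analytic_bound_integral => //.
  - by move=> z; exact: analytic_boundM.
  - by move=> s Ds z; apply: cvgM; [exact: q_cont|exact: cf].
  - by move=> z; apply: cvgM; [exact: Q_cont|exact: cvg_cst].
  - apply: (gauss_dominatedM KC0 (Q_dom i)) => z.
    by rewrite ger0_norm// mulr_ge0.
apply: analytic_bound_le h; rewrite RintegralZr//.
by rewrite mulrA ler_wpM2r.
Qed.

Lemma q_integrable s i (f : R -> R) C : D s -> continuous f -> 0 <= C ->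
  (forall z, `|f z| <= C) -> mu.-integrable setT (EFin \o (fun z => q s i z * f z)).
Proof.
move=> Ds cf C0 fC; apply: gauss_dominated_integrable.
  by move=> z; apply: cvgM; [exact: q_cont|exact: cf].
apply: (gauss_dominatedM C0 (Q_dom i)) => z; rewrite normrM.
by apply: ler_pM => //; exact: analytic_bound_norm (qQ i z) Ds.
Qed.

Let M_ge0 : 0 <= M.
Proof.
by apply: le_trans (Q_int istar); rewrite mulr_ge0// Rintegral_ge0.
Qed.

Section tame_operator.
Variables (phi : 'rV[R]_d -> 'I_l -> ('I_l -> R) -> R) (U A L : R).
Hypothesis phi_tame : tame phi U A L.

Local Notation Kphi := (fun s i w => filter_op (Pi s) (q s) (phi s) i w).

Let F s i w z := \sum_j Pi s i j * phi s j (predict (Pi s) (q s ^~ z) w).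

Let F_cont s i w : D s -> simplex c w -> continuous (F s i w).
Proof. exact: (integrand_continuous phi_tame). Qed.

Let U0 : 0 <= U. Proof. by case: (tame_bound_ge0 phi_tame). Qed.
Let L0 : 0 <= L. Proof. by case: (tame_bound_ge0 phi_tame). Qed.

Let F_norm s i w z : D s -> simplex c w -> `|F s i w z| <= U.
Proof.
move=> Ds wc; apply: le_trans (ler_norm_sum _ _ _) _.
rewrite -[leRHS]mul1r -(Pi_sum Ds i) mulr_suml; apply: ler_sum => j _.
have p0 : 0 <= Pi s i j by apply: le_trans (ltW c_gt0) (Pi_ge Ds i j).
rewrite normrM (ger0_norm p0) ler_wpM2l//; apply: (tame_norm phi_tame) => //.
exact: next_simplex.
Qed.

Lemma tame_integrable s i w : D s -> simplex c w ->
  mu.-integrable setT (EFin \o (fun z => q s i z * F s i w z)).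
Proof.
move=> Ds wc; apply: (@q_integrable s i _ U) => //; first exact: F_cont.
by move=> z; exact: F_norm.
Qed.

Let q_int1 s i : D s -> mu.-integrable setT (EFin \o q s i).
Proof.
move=> Ds; have := @q_integrable s i (fun=> 1) 1 Ds.
move=> h; apply: eq_integrable (h _ _ _) => //.
- by move=> z _ /=; rewrite mulr1.
- by move=> z; exact: cvg_cst.
- by move=> _; rewrite normr1.
Qed.

Let opB (b : R) s i w : D s -> simplex c w ->
  filter_op (Pi s) (q s) (phi s) i w - b = \int[mu]_z (q s i z * (F s i w z - b)).
Proof.
move=> Ds wc; under eq_Rintegral do rewrite mulrBr.
rewrite RintegralB//; [|exact: tame_integrable|].
  by rewrite RintegralZr ?q_int ?mul1r//; exact: q_int1.
have := @q_integrable s i (fun=> b) `|b| Ds; apply => // z; exact: cvg_cst.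
Qed.

(** As the outputs and the transitions have total mass 1, K phi minus one value of phi is an average
    of differences of values of phi. Increments of iterates are thus bounded by oscillations,
    without recourse to [U]. *)
Lemma tame_op_osc i j x y : X x -> X y ->
  AN (fun s => filter_op (Pi s) (q s) (phi s) i (x s) - phi s j (y s))
    (M * (A + chain_length * L)).
Proof.
move=> Xx Xy.
have h z : AN (fun s => \sum_k Pi s i k * (phi s k (next z x s) - phi s j (y s)))
    (KP * (A + chain_length * L)).
  have hz k : AN (fun s => phi s k (next z x s) - phi s j (y s)) (A + chain_length * L).
    by apply: (tame_osc phi_tame) => //; exact: next_near.
  by apply: (l1_bound_dot r_gt0) => //; exact: analytic_bound_ge0 (hz istar).
have E z s : D s -> \sum_k Pi s i k * (phi s k (next z x s) - phi s j (y s)) =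
    F s i (x s) z - phi s j (y s).
  move=> Ds; under eq_bigr do rewrite mulrBr.
  by rewrite sumrB -mulr_suml Pi_sum// mul1r.
have C0 : 0 <= A + chain_length * L.
  exact: analytic_bound_ge0 (tame_osc phi_tame istar istar Xx Xx).
apply: analytic_bound_ext (analytic_bound_integral_q i C0 h _) => s Ds.
  rewrite opB//; last exact: Xx.1.
  by apply: eq_Rintegral => z _; rewrite E.
rewrite (_ : (fun z => _) = (fun z => F s i (x s) z - phi s j (y s))).
  move=> z; apply: cvgB; last exact: cvg_cst.
  by apply: F_cont => //; exact: Xx.1.
by apply/funext => z; exact: E.
Qed.

(** The Lipschitz constant shrinks because prediction contracts distances by [rho]. The dependence
    on the input shrinks by Doeblin, up to a multiple of [L] from moving the predictive vector. The
    size may grow by the factor [M]. *)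
Lemma tame_op : tame Kphi (M * U) (kA * A + 2 * (M * (chain_length * L))) (M * rho * L).
Proof.
have [_ A0 _] := tame_bound_ge0 phi_tame.
case: (phi_tame) => h1 h2 h3; split.
- move=> x i Xx; apply: analytic_bound_integral_q => //.
    move=> z; apply: (l1_bound_dot r_gt0) => // k; exact/h1/next_near.
  by move=> s Ds; apply: F_cont => //; exact: Xx.1.
- move=> x i j Xx.
  have s0 : 0 < 1 - l%:R * c by rewrite subr_gt0.
  (* The error made in K phi when the predicted vector is frozen at [x s]; a chain of short steps
     bounds it by [L]. *)
  pose T k s := \int[mu]_z (q s k z * (F s k (x s) z - \sum_m Pi s k m * phi s m (x s))).
  have hT k : AN (T k) (M * (chain_length * L)).
    have C0 : 0 <= chain_length * L.
      exact: analytic_bound_ge0 (tame_chain phi_tame istar Xx Xx).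
    have h z : AN (fun s => F s k (x s) z - \sum_m Pi s k m * phi s m (x s)) (KP * (chain_length * L)).
      have : AN (fun s => \sum_m Pi s k m * (phi s m (next z x s) - phi s m (x s))) (KP * (chain_length * L)).
        by apply: (l1_bound_dot r_gt0) => // m; apply: (tame_chain phi_tame) => //; exact: next_near.
      by apply: analytic_bound_ext => s Ds; rewrite -sumrB; apply: eq_bigr => m _; rewrite mulrBr.
    apply: (analytic_bound_integral_q k C0 h) => s Ds z; apply: cvgB; last exact: cvg_cst.
    by apply: F_cont => //; exact: Xx.1.
  (* With frozen vector only the rows i and j of the transition matrix differ. Removing [c] from all
     entries keeps their difference and leaves rows of mass [1 - l%:R * c], which are then coupled
     as a product. *)
  have hS : AN (fun s => (1 - l%:R * c)^-1 * \sum_k (Pi s i k - c) * (\sum_m (Pi s j m - c) * (phi s k (x s) - phi s m (x s)))) (kA * A).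
    have KE0 : 0 <= KE.
      have [m [ma mK]] := Pi_excess istar; apply: le_trans mK; apply: sumr_ge0 => k _.
      exact: analytic_bound_ge0 (ma k).
    have h : AN (fun s => \sum_k (Pi s i k - c) * (\sum_m (Pi s j m - c) * (phi s k (x s) - phi s m (x s)))) (KE * (KE * A)).
      apply: (l1_bound_dot r_gt0) => //; first exact: mulr_ge0.
      by move=> k; apply: (l1_bound_dot r_gt0) => // m; exact: h2.
    apply: analytic_bound_le (analytic_bound_scale _ h).
    rewrite ger0_norm ?invr_ge0 ?(ltW s0)// mulrC ler_pdivrMr// mulrA.
    by rewrite [leRHS]mulrAC ler_wpM2r.
  have := analytic_boundD r_gt0 hS (analytic_boundB r_gt0 (hT i) (hT j)).
  have -> : M * (chain_length * L) + M * (chain_length * L) = 2 * (M * (chain_length * L)) by ring.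
  apply: analytic_bound_ext => s Ds; have xs := Xx.1 s Ds.
  rewrite /T -!opB//.
  have sc (k : 'I_l) : \sum_m (Pi s k m - c) = 1 - l%:R * c.
    by rewrite sumrB Pi_sum// sumr_const card_ord mulr_natl.
  under [X in _ * X + _]eq_bigr do rewrite mulr_sumr.
  under [X in _ * X + _]eq_bigr do under eq_bigr do rewrite mulrA.
  rewrite (sum_coupling _ (sc i) (sc j)) mulKf ?gt_eqF//.
  under eq_bigr do rewrite mulrBl.
  under [X in _ - X + _]eq_bigr do rewrite mulrBl.
  by rewrite !sumrB; ring.
- move=> x y t i Xx Xy te xyt.
  have t0 : 0 <= t := analytic_bound_ge0 (xyt istar istar).
  have hz z k : AN (fun s => phi s k (next z x s) - phi s k (next z y s)) (L * (rho * t)).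
    apply: h3; [exact: next_near|exact: next_near| |exact: next_close].
    apply: le_trans te; rewrite ler_piMl//; exact: rho_le1.
  have h z : AN (fun s => F s i (x s) z - F s i (y s) z) (KP * (L * (rho * t))).
    have : AN (fun s => \sum_k Pi s i k * (phi s k (next z x s) - phi s k (next z y s))) (KP * (L * (rho * t))).
      by apply: (l1_bound_dot r_gt0) => //; exact: analytic_bound_ge0 (hz 0 istar).
    by apply: analytic_bound_ext => s Ds; rewrite -sumrB; apply: eq_bigr => k _; rewrite mulrBr.
  have := analytic_bound_integral_q i (analytic_bound_ge0 (hz 0 istar)) h.
  have -> : M * (L * (rho * t)) = M * rho * L * t by ring.
  move=> h'; apply: analytic_bound_ext (h' _) => s Ds; have xs := Xx.1 s Ds; have ys := Xy.1 s Ds.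
    under eq_Rintegral do rewrite mulrBr.
    by rewrite RintegralB//; exact: tame_integrable.
  by move=> z; apply: cvgB; exact: F_cont.
Qed.

End tame_operator.

Variables (C1 L1 : R).
Hypothesis ln_weight_bound : forall z x, X x ->
  AN (fun s => ln (weight (q s ^~ z) (x s))) (C1 * (1 + z ^+ 2)).
Hypothesis ln_weight_close : forall z x y t, X x -> X y -> t <= eta -> close a r x y t ->
  AN (fun s => ln (weight (q s ^~ z) (x s)) - ln (weight (q s ^~ z) (y s))) (L1 * t).

Let ln_weight_cont s w : D s -> simplex c w ->
  continuous (fun z => ln (weight (q s ^~ z) w)).
Proof.
move=> Ds wc z; apply: (cvg_comp _ (@ln R)); first exact: (continuous_weight (q_cont Ds)).
apply: continuous_ln; apply: (weight_gt0_of_simplex istar c_gt0 wc) => i.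
exact: q_gt0.
Qed.

Let C1_ge0 : 0 <= C1.
Proof.
have := analytic_bound_ge0 (ln_weight_bound 0 (cst_near simplex0)).
by rewrite expr0n addr0 mulr1.
Qed.

Let lnB i z := Q i z * (C1 * (1 + z ^+ 2)).

Let lnB_cont i : continuous (lnB i).
Proof.
move=> z; apply: cvgM; first exact: Q_cont.
by apply: cvgMr; apply: cvgD; [exact: cvg_cst|exact: exprn_continuous].
Qed.

(** Half of the Gaussian rate absorbs the quadratic factor, through 1 + y <= exp y. *)
Let lnB_dom i : gauss_dominated (lnB i).
Proof.
have [B [k [k0 QB]]] := Q_dom i.
exists (B * C1 * (1 + 2 / k)), (k / 2); split; first by rewrite divr_gt0.
move=> z; rewrite /lnB ger0_norm; last by rewrite mulr_ge0// mulr_ge0// addr_ge0// sqr_ge0.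
have z2 : 1 + z ^+ 2 <= (1 + 2 / k) * expR (k / 2 * z ^+ 2).
  have e1 : 1 + k / 2 * z ^+ 2 <= expR (k / 2 * z ^+ 2) by exact: expR_ge1Dx.
  have k2 : 0 <= 2 / k by rewrite divr_ge0// ltW.
  have y0 : 0 <= k / 2 * z ^+ 2 by rewrite mulr_ge0 ?divr_ge0 ?sqr_ge0// ltW.
  apply: (@le_trans _ _ ((1 + 2 / k) * (1 + k / 2 * z ^+ 2))).
    have -> : (1 + 2 / k) * (1 + k / 2 * z ^+ 2) = 1 + z ^+ 2 + (k / 2 * z ^+ 2 + 2 / k).
      by field; rewrite gt_eqF.
    by rewrite lerDl addr_ge0.
  by rewrite ler_wpM2l// addr_ge0.
have -> : B * C1 * (1 + 2 / k) * expR (- (k / 2 * z ^+ 2)) =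
    (B * expR (- (k * z ^+ 2))) * (C1 * ((1 + 2 / k) * expR (k / 2 * z ^+ 2))).
  have -> : expR (- (k / 2 * z ^+ 2)) = expR (- (k * z ^+ 2)) * expR (k / 2 * z ^+ 2).
    by rewrite -expRD; congr expR; field.
  by ring.
apply: ler_pM => //.
- by rewrite mulr_ge0// addr_ge0// sqr_ge0.
- exact: le_trans (ler_norm _) (QB z).
- by rewrite ler_wpM2l.
Qed.

Lemma ln_weight_integrable s i w : D s -> simplex c w ->
  mu.-integrable setT (EFin \o (fun z => q s i z * ln (weight (q s ^~ z) w))).
Proof.
move=> Ds wc; apply: gauss_dominated_integrable.
  by move=> z; apply: cvgM; [exact: q_cont|exact: ln_weight_cont].
apply: (gauss_dominatedM ler01 (lnB_dom i)) => z; rewrite mulr1 normrM.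
apply: ler_pM => //; first exact: analytic_bound_norm (qQ i z) Ds.
exact: analytic_bound_norm (ln_weight_bound z (cst_near wc)) Ds.
Qed.

Lemma quadratic_integrable s i : D s ->
  mu.-integrable setT (EFin \o (fun z => q s i z * (C1 * (1 + z ^+ 2)))).
Proof.
move=> Ds; apply: gauss_dominated_integrable.
  move=> z; apply: cvgM; first exact: q_cont.
  by apply: cvgMr; apply: cvgD; [exact: cvg_cst|exact: exprn_continuous].
apply: (gauss_dominatedM ler01 (lnB_dom i)) => z.
have v0 : 0 <= C1 * (1 + z ^+ 2) by rewrite mulr_ge0// addr_ge0// sqr_ge0.
rewrite mulr1 normrM (ger0_norm v0) ler_wpM2r//.
exact: analytic_bound_norm (qQ i z) Ds.
Qed.

Lemma tame_log_gain : exists U A L, tame (fun s i w => log_gain (q s) i w) U A L.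
Proof.
pose U := \sum_i \int[mu]_z lnB i z.
have hU x i : X x -> AN (fun s => log_gain (q s) i (x s)) U.
  move=> Xx; have lnB0 j z : 0 <= lnB j z.
    by rewrite mulr_ge0// mulr_ge0// addr_ge0// sqr_ge0.
  apply: (@analytic_bound_le _ _ _ _ _ (\int[mu]_z lnB i z)).
    by rewrite /U (bigD1 i)//= lerDl sumr_ge0// => j _; exact: Rintegral_ge0.
  apply: analytic_boundN; apply: analytic_bound_integral => //.
    by move=> z; apply: analytic_boundM => //; exact: ln_weight_bound.
  move=> s Ds z; apply: cvgM; first exact: q_cont.
  by apply: ln_weight_cont => //; exact: Xx.1.
exists U, (U + U), (M * L1); split=> //.
- by move=> x i j Xx; apply: analytic_boundB => //; exact: hU.
- move=> x y t i Xx Xy te xyt.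
  have C0 := analytic_bound_ge0 (ln_weight_close 0 Xx Xy te xyt).
  have h z : AN (fun s => ln (weight (q s ^~ z) (x s)) - ln (weight (q s ^~ z) (y s))) (KP * (L1 * t)).
    by apply: analytic_bound_le (ln_weight_close z Xx Xy te xyt); rewrite ler_peMl.
  rewrite -mulrA.
  have := analytic_bound_integral_q i C0 h.
  move=> h'; apply: analytic_bound_ext (analytic_boundN (h' _)) => s Ds;
    have xs := Xx.1 s Ds; have ys := Xy.1 s Ds.
    under eq_Rintegral do rewrite mulrBr.
    by rewrite RintegralB//; [rewrite /log_gain; ring|exact: ln_weight_integrable|exact: ln_weight_integrable].
  by move=> z; apply: cvgB; exact: ln_weight_cont.
Qed.

Definition gain_iter n s := iter n (filter_op (Pi s) (q s)) (log_gain (q s)).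

Variable lam : R.
Hypotheses (kA_lam : kA <= lam) (Mrho_lam : M * rho < lam) (lam1 : lam < 1).
Hypothesis rho_ge0 : 0 <= rho.

Let lam0 : 0 <= lam. Proof. by apply: le_trans (ltW Mrho_lam); exact: mulr_ge0. Qed.

Let W0 : 0 <= chain_length. Proof. by rewrite mulr_ge0// ?ltW// addr_ge0. Qed.

(** [tame_op] acts on the pair (A, L) by a triangular system. The first summand makes [A + B * L]
    decrease by the factor [lam]; the second makes it dominate the oscillation
    [A + chain_length * L]. *)
Let B := 2 * M * chain_length / (lam - M * rho) + chain_length.

Let B_ge : chain_length <= B.
Proof.
rewrite lerDr; apply: divr_ge0; first exact: mulr_ge0 (mulr_ge0 _ M_ge0) W0.
by rewrite subr_ge0 ltW.
Qed.

Lemma tame_gain_iter : exists E, forall n, exists U A L,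
  tame (gain_iter n) U A L /\ A + B * L <= lam ^+ n * E.
Proof.
have [U [A [L T0]]] := tame_log_gain; exists (A + B * L).
elim=> [|n [Un [An [Ln [Tn En]]]]]; first by exists U, A, L; rewrite expr0 mul1r.
have [_ An0 Ln0] := tame_bound_ge0 Tn.
exists (M * Un), (kA * An + 2 * (M * (chain_length * Ln))), (M * rho * Ln).
split; first exact: tame_op Tn.
rewrite exprS -[leRHS]mulrA; apply: le_trans (ler_wpM2l lam0 En); rewrite mulrDr -addrA lerD//.
  by rewrite ler_wpM2r.
have -> : 2 * (M * (chain_length * Ln)) + B * (M * rho * Ln) =
  (2 * M * chain_length + B * (M * rho)) * Ln by ring.
rewrite [leRHS]mulrA ler_wpM2r//.
have d0 : 0 < lam - M * rho by rewrite subr_gt0.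
have : 2 * M * chain_length <= B * (lam - M * rho).
  by rewrite /B [leRHS]mulrDl divfK ?gt_eqF// lerDl mulr_ge0// ltW.
lra.
Qed.

Lemma gain_iter_integrable n s i w : D s -> simplex c w ->
  mu.-integrable setT (EFin \o (fun z => q s i z *
    \sum_j Pi s i j * gain_iter n s j (predict (Pi s) (q s ^~ z) w))).
Proof.
move=> Ds wc; have [E /(_ n)[U [A [L [T _]]]]] := tame_gain_iter.
exact: (tame_integrable T).
Qed.

Lemma geometric_cauchy (u : R^nat) C : (forall n, `|u n.+1 - u n| <= C * lam ^+ n) ->
  exists h : R, u @ \oo --> h /\ forall n, `|u n - h| <= C / (1 - lam) * lam ^+ n.
Proof.
move=> uC; have l1 : 0 < 1 - lam by rewrite subr_gt0.
have C0 : 0 <= C by have := uC 0%N; rewrite expr0 mulr1; exact: le_trans.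
pose C' := C / (1 - lam); have C'0 : 0 <= C' by rewrite divr_ge0// ltW.
have tail n p : `|u (n + p)%N - u n| <= C' * lam ^+ n.
  apply: (@le_trans _ _ (C' * (lam ^+ n - lam ^+ (n + p)))); last first.
    by rewrite ler_wpM2l// gerBl exprn_ge0.
  elim: p => [|p IH]; first by rewrite addn0 !subrr mulr0 normr0.
  have -> : u (n + p.+1)%N - u n = (u (n + p).+1 - u (n + p)%N) + (u (n + p)%N - u n).
    by rewrite addnS; ring.
  apply: le_trans (ler_normD _ _) _; apply: le_trans (lerD (uC _) IH) _.
  rewrite addnS exprS; have -> : C = C' * (1 - lam) by rewrite /C' divfK// gt_eqF.
  by rewrite le_eqVlt; apply/orP; left; apply/eqP; ring.
have lamn : (fun n => C' * lam ^+ n) @ \oo --> (0 : R).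
  rewrite -(mulr0 C'); apply: cvgMr; apply: cvg_expr; by rewrite ger0_norm.
have cu : cvgn u.
  apply/cauchy_cvgP; apply/cauchy_exP => e e0.
  have /cvgrPdist_lt/(_ _ e0)[N _ hN] := lamn; exists (u N); exists N => //= n Nn.
  rewrite /ball/= distrC -(subnKC Nn); apply: le_lt_trans (tail _ _) _.
  by have := hN N (leqnn N); rewrite /= sub0r normrN; apply: le_lt_trans (ler_norm _).
exists (limn u); split=> // n.
have h : (fun m => u n - u m) @ \oo --> u n - limn u by apply: cvgB => //; exact: cvg_cst.
apply: (cvg_norm_le h); exists n => //= m nm.
by rewrite distrC -(subnKC nm).
Qed.

(** The size bounds of [tame_gain_iter] need not be uniform in n, but the oscillations decay like
    lam^n and bound the increments. The geometric sum of these gives one bound for all iterates at a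
    reference state, hence for the limit; decay of the oscillations makes the limit the same for
    every input and vector. *)
Theorem gain_iter_limit : exists h Mh, AN h Mh /\ exists C, forall s, D s ->
  forall n i w, simplex c w -> `|gain_iter n s i w - h s| <= C * lam ^+ n.
Proof.
have [E TE] := tame_gain_iter.
pose w0 j := Pi a istar j; have Xw0 : X (fun=> w0) by exact: cst_near.
have osc n i j x y : X x -> X y -> AN (fun s => gain_iter n s i (x s) - gain_iter n s j (y s)) (lam ^+ n * E).
  move=> Xx Xy; have [U [A [L [T EL]]]] := TE n; have [_ _ L0] := tame_bound_ge0 T.
  apply: analytic_bound_le (tame_osc T i j Xx Xy); apply: le_trans EL.
  by rewrite lerD2l ler_wpM2r.
have E0 : 0 <= E.
  by have := analytic_bound_ge0 (osc 0%N istar istar _ _ Xw0 Xw0); rewrite expr0 mul1r.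
pose f n s := gain_iter n s istar w0.
have df n : AN (fun s => f n.+1 s - f n s) (M * E * lam ^+ n).
  have [U [A [L [T EL]]]] := TE n; have [_ _ L0] := tame_bound_ge0 T.
  have := tame_op_osc T istar istar Xw0 Xw0.
  apply: analytic_bound_le; rewrite -mulrA ler_wpM2l// [E * _]mulrC; apply: le_trans EL.
  by rewrite lerD2l ler_wpM2r.
have [U0 [_ [_ [[T0 _ _] _]]]] := TE 0%N.
have fM n : AN (f n) (U0 + M * E / (1 - lam)).
  have l1 : 0 < 1 - lam by rewrite subr_gt0.
  have : AN (f n) (U0 + M * E / (1 - lam) * (1 - lam ^+ n)).
    elim: n => [|n IH].
      by rewrite expr0 subrr mulr0 addr0; exact: T0.
    have := analytic_boundD r_gt0 IH (df n).
    have -> : U0 + M * E / (1 - lam) * (1 - lam ^+ n) + M * E * lam ^+ n =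
      U0 + M * E / (1 - lam) * (1 - lam ^+ n.+1).
      by rewrite exprS; field; rewrite gt_eqF.
    by apply: analytic_bound_ext => s _; rewrite addrC subrK.
  apply: analytic_bound_le; rewrite lerD2l ler_piMr// ?gerBl ?exprn_ge0//.
  by rewrite divr_ge0 ?mulr_ge0// ltW.
(* Stated for all [s] so that a choice function applies; outside the polydisc the value is
   unconstrained. *)
have lim s : exists h : R, D s -> f ^~ s @ \oo --> h /\
    forall n, `|f n s - h| <= M * E / (1 - lam) * lam ^+ n.
  have [Ds|nDs] := pselect (D s); last by exists 0.
  have [|h hP] := @geometric_cauchy (f ^~ s) (M * E); last by exists h.
  by move=> n; exact: analytic_bound_norm (df n) Ds.
have [h hP] := choice lim.
exists h, (U0 + M * E / (1 - lam)); split.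
  apply: (@analytic_bound_lim _ _ _ _ r_gt0 _ \oo _ f (fun=> U0 + M * E / (1 - lam))) => //.
    by move=> e e0; apply: nearW => _; rewrite lerDl ltW.
  by move=> s Ds; case: (hP s Ds).
exists (E + M * E / (1 - lam)) => s Ds n i w wc.
have -> : gain_iter n s i w - h s = (gain_iter n s i w - f n s) + (f n s - h s) by ring.
apply: le_trans (ler_normD _ _) _; rewrite mulrDl lerD//; last by case: (hP s Ds).
by rewrite mulrC; exact: analytic_bound_norm (osc n i istar _ _ (cst_near wc) Xw0) Ds.
Qed.

End analytic_operator.

(** * Block entropies *)

Section tuple_measure.
Variable R : realType.
Local Notation RT := (measurableTypeR R).
Local Notation mu := (@lebesgue_measure R).

Definition tcons n (u : RT * n.-tuple RT) : n.+1.-tuple RT := [tuple of u.1 :: u.2].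

Lemma measurable_tcons n : measurable_fun [set: RT * n.-tuple RT] (@tcons n).
Proof. by apply: measurable_cons; [exact: measurable_fst|exact: measurable_snd]. Qed.

Section cons_measure.
Variables (n : nat) (m : {sigma_finite_measure set (n.-tuple RT) -> \bar R}).

(** The recursion step of [tuple_lebesgue] over an abstract sigma-finite measure, so that it can
    carry the measure structures. *)
Definition cons_measure : set (n.+1.-tuple RT) -> \bar R :=
  pushforward (mu \x m)%E (@tcons n).

Let pm := measure_function_pushforward__canonical__measure_function_Measure
  (mu \x m)%E (@measurable_tcons n).

Let cons_measure0 : cons_measure set0 = 0%E. Proof. exact: (measure0 pm). Qed.
Let cons_measure_ge0 A : (0 <= cons_measure A)%E. Proof. exact: (measure_ge0 pm). Qed.
Let cons_measure_sigma : semi_sigma_additive cons_measure.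
Proof. exact: (@measure_semi_sigma_additive _ _ _ pm). Qed.

HB.instance Definition _ := isMeasure.Build _ _ _ cons_measure
  cons_measure0 cons_measure_ge0 cons_measure_sigma.

Let cons_measure_sigma_finite : sigma_finite setT cons_measure.
Proof.
have /sigma_finiteP[F [TF ndF Foo]] := sigma_finiteT mu.
have /sigma_finiteP[G [TG ndG Goo]] := sigma_finiteT m.
(* The inverse of [tcons]; preimages under it carry an exhausting sequence of rectangles over to
   tuples. *)
pose h (t : n.+1.-tuple RT) : RT * n.-tuple RT := (tnth t ord0, [tuple of behead t]).
have mh : measurable_fun setT h.
  apply: measurable_fun_pair; [exact: measurable_tnth|exact: measurable_behead].
exists (fun k => h @^-1` (F k `*` G k)).
  apply/seteqP; split=> // t _.
  have : [set: RT] (h t).1 by []; rewrite TF => -[i _ Fi].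
  have : [set: n.-tuple RT] (h t).2 by []; rewrite TG => -[j _ Gj].
  exists (maxn i j) => //; split.
    by move: (h t).1 Fi; exact/subsetPset/ndF/leq_maxl.
  by move: (h t).2 Gj; exact/subsetPset/ndG/leq_maxr.
move=> k; have [mF Fk] := Foo k; have [mG Gk] := Goo k; split.
  by rewrite -[X in measurable X]setTI; apply: mh => //; exact: measurableX.
have -> : cons_measure (h @^-1` (F k `*` G k)) = (mu \x m)%E (F k `*` G k).
  congr (_ \x _)%E; apply/funext.
  have E u : h (tcons u) = u.
    by case: u => x t; rewrite /h /tcons /=; congr (_, _); apply/val_inj.
  by move=> u; rewrite -[in RHS](E u).
by rewrite product_measure1E// lte_mul_pinfty// ge0_fin_numE.
Qed.

HB.instance Definition _ := Measure_isSigmaFinite.Build _ _ _ cons_measure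
  cons_measure_sigma_finite.

End cons_measure.

(** [tuple_lebesgue] is a fixpoint of bare set functions; rewriting with this equality replaces it
    by a bundled measure wherever integration lemmas are applied. *)
Lemma tuple_lebesgue_sigma_finite n :
  exists m : {sigma_finite_measure set (n.-tuple RT) -> \bar R},
    (m : set (n.-tuple RT) -> \bar R) = tuple_lebesgue R n.
Proof.
elim: n => [|n [m mE]]; first by exists (dirac [tuple] : {sigma_finite_measure set _ -> \bar R}).
exists (cons_measure m : {sigma_finite_measure set (n.+1.-tuple RT) -> \bar R}).
by rewrite /= -mE.
Qed.

Lemma tuple_tonelli n (f : n.+1.-tuple RT -> \bar R) :
  measurable_fun setT f -> (forall t, (0 <= f t)%E) ->
  (\int[tuple_lebesgue R n.+1]_t f t =
   \int[mu]_z \int[tuple_lebesgue R n]_t f (tcons (z, t)))%E.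
Proof.
move=> mf f0; have [m mE] := tuple_lebesgue_sigma_finite n.
rewrite [in LHS]/= -mE.
have := ge0_integral_pushforward (@measurable_tcons n) (mu \x m)%E measurableT mf (fun t _ => f0 t).
move=> ->; rewrite preimage_setT fubini_tonelli1//.
  exact: (measurableT_comp mf (@measurable_tcons n)).
by move=> u; exact: f0.
Qed.

Lemma tuple_fubini n (f : n.+1.-tuple RT -> \bar R) :
  (tuple_lebesgue R n.+1).-integrable setT f ->
  (\int[tuple_lebesgue R n.+1]_t f t =
   \int[mu]_z \int[tuple_lebesgue R n]_t f (tcons (z, t)))%E.
Proof.
move=> fi; have [mf fb] := integrableP _ _ _ fi.
have [m mE] := tuple_lebesgue_sigma_finite n.
have mc := measurableT_comp mf (@measurable_tcons n).
have gi : (mu \x m)%E.-integrable setT (f \o @tcons n).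
  apply/integrableP; split => //.
  rewrite fubini_tonelli1//; last exact: (measurableT_comp (@abse_measurable _ _) mc).
  move: fb; rewrite tuple_tonelli -?mE//.
  exact: (measurableT_comp (@abse_measurable _ _) mf).
rewrite [in LHS]/= -mE.
have := integral_pushforward (@measurable_tcons n) mf gi measurableT.
by move=> ->; rewrite preimage_setT -(integral12_prod_meas1 gi).
Qed.

End tuple_measure.

(** * Likelihoods of output blocks *)

Section likelihood.
Variables (R : realType) (l : nat).
Implicit Types (P : 'M[R]_l) (q : 'I_l -> R -> R) (w : 'I_l -> R).

(* Likelihood of an output block when the chain starts in state [i] at its
   first symbol; the last factor [\sum_j P i j] is [1]. *)
Fixpoint lik P q i (s : seq R) : R :=
  if s is z :: s' then q i z * \sum_j P i j * lik P q j s' else 1.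

Definition mlik P q w s : R := \sum_i w i * lik P q i s.

Lemma mlik_cons P q w z s : weight (q ^~ z) w != 0 ->
  mlik P q w (z :: s) = weight (q ^~ z) w * mlik P q (predict P (q ^~ z) w) s.
Proof.
move=> W0; rewrite /mlik /predict mulr_sumr /=.
transitivity (\sum_j \sum_i w i * q i z * P i j * lik P q j s).
  rewrite exchange_big; apply: eq_bigr => i _; rewrite mulrA mulr_sumr.
  by apply: eq_bigr => j _; rewrite mulrA.
apply: eq_bigr => j _; rewrite -mulr_suml; field; exact: W0.
Qed.

Lemma sum_tupleS n (F : n.+1.-tuple 'I_l -> R) :
  \sum_y F y = \sum_i \sum_(y : n.-tuple 'I_l) F [tuple of i :: y].
Proof.
rewrite pair_bigA/= (reindex (fun p : 'I_l * n.-tuple 'I_l => [tuple of p.1 :: p.2]))//=.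
exists (fun t => (thead t, [tuple of behead t])) => [[i y] _|t _] /=.
  by congr (_, _); apply/val_inj.
by apply/val_inj => /=; case: t => -[|x t].
Qed.

Lemma sum_tuple0 (F : 0.-tuple 'I_l -> R) : \sum_y F y = F [tuple].
Proof.
rewrite (bigD1 [tuple])//= big1 ?addr0// => y.
by have -> : y = [tuple] by exact: tuple0.
Qed.

Lemma hmc_densityE P q (pi : 'rV[R]_l) n (z : n.+1.-tuple R) :
  (forall i, \sum_j P i j = 1) ->
  hmc_density pi P q z = mlik P q (fun i => pi 0 i) z.
Proof.
move=> P1; elim: n pi z => [|n IH] pi z.
  rewrite /hmc_density /mlik sum_tupleS; apply: eq_bigr => i _.
  rewrite sum_tuple0.
  rewrite /markov_prob big_ord0 mulr1 big_ord_recl big_ord0 mulr1 (tuple_eta z)/=.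
  rewrite !(tnth_nth (i)) /= !(tnth_nth 0)/=.
  have -> : behead z = [::] by case: z => -[|x []].
  by under eq_bigr do rewrite /= mulr1; rewrite P1 mulr1.
rewrite (tuple_eta z); set z0 := thead z; set z' := [tuple of behead z].
rewrite /hmc_density /mlik sum_tupleS; apply: eq_bigr => i _.
have -> : lik P q i [tuple of z0 :: z'] = q i z0 * \sum_j P i j * lik P q j z' by [].
(* Once the first input is [i], the rest of the block belongs to a chain with initial law the row
   [i] of [P]; hence the induction over all initial vectors. *)
have := IH (row i P) z'; rewrite /mlik.
under [X in _ = X -> _]eq_bigr do rewrite mxE.
move=> <-; rewrite /hmc_density !mulr_sumr; apply: eq_bigr => y _.
rewrite big_ord_recl !tnth0.
have -> : \prod_(i0 < n.+1) q (tnth [tuple of i :: y] (lift ord0 i0)) (tnth [tuple of z0 :: z'] (lift ord0 i0)) =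
    \prod_(k < n.+1) q (tnth y k) (tnth z' k).
  by apply: eq_bigr => k _; rewrite !tnthS.
rewrite mulrA [RHS]mulrA [RHS]mulrA; congr (_ * _).
rewrite [RHS]mulrAC; congr (_ * _); rewrite /markov_prob big_ord_recl mxE tnth0; congr (_ * _).
rewrite (_ : widen_ord _ _ = ord0); last exact/val_inj.
rewrite tnth0 tnthS; congr (_ * _).
apply: eq_bigr => k _; rewrite !tnthS.
rewrite (_ : widen_ord _ (lift ord0 k) = lift ord0 (widen_ord (leqnSn n) k)) ?tnthS//.
exact/val_inj.
Qed.

End likelihood.

Section integral_lincomb.
Variables (R : realType) (dd : measure_display) (T : measurableType dd).
Variable m : {measure set T -> \bar R}.

Lemma integral_EFin_sum (n : nat) (f : 'I_n -> T -> R) (F : 'I_n -> R) :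
  (forall j, m.-integrable setT (EFin \o f j)) ->
  (forall j, \int[m]_t (f j t)%:E = (F j)%:E)%E ->
  (\int[m]_t (\sum_j f j t)%:E = (\sum_j F j)%:E)%E.
Proof.
move=> fi fF; under eq_integral do rewrite -sumEFin.
rewrite integral_sum//= -sumEFin; apply: eq_bigr => j _; exact: fF.
Qed.

Lemma integrable_EFin_sum (n : nat) (f : 'I_n -> T -> R) :
  (forall j, m.-integrable setT (EFin \o f j)) ->
  m.-integrable setT (fun t => (\sum_j f j t)%:E).
Proof.
move=> fi; rewrite (_ : (fun t => _) = (fun t => \sum_j (f j t)%:E)%E); last first.
  by apply/funext => t; rewrite sumEFin.
by apply: (integrable_sum measurableT) => j _; exact: fi.
Qed.

Lemma integrable_EFinZ (f : T -> R) (b : R) : m.-integrable setT (EFin \o f) ->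
  m.-integrable setT (EFin \o (fun t => b * f t)).
Proof. by move=> fi; exact: (integrableZl measurableT b fi). Qed.

Lemma integral_EFinZ (f : T -> R) (F b : R) : m.-integrable setT (EFin \o f) ->
  (\int[m]_t (f t)%:E = F%:E)%E -> (\int[m]_t (b * f t)%:E = (b * F)%:E)%E.
Proof.
move=> fi fF; under eq_integral do rewrite EFinM.
by rewrite integralZl// fF.
Qed.

Lemma integral_lincomb (n : nat) (f g : 'I_n -> T -> R) (F G al be : 'I_n -> R) :
  (forall j, m.-integrable setT (EFin \o f j)) ->
  (forall j, \int[m]_t (f j t)%:E = (F j)%:E)%E ->
  (forall j, m.-integrable setT (EFin \o g j)) ->
  (forall j, \int[m]_t (g j t)%:E = (G j)%:E)%E ->
  (\int[m]_t (\sum_j (al j * f j t + be j * g j t))%:E =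
   (\sum_j (al j * F j + be j * G j))%:E)%E.
Proof.
move=> fi fF gi gG; apply: integral_EFin_sum => j.
  exact: (integrableD measurableT (integrable_EFinZ (al j) (fi j)) (integrable_EFinZ (be j) (gi j))).
under eq_integral do rewrite EFinD.
rewrite (integralD measurableT (integrable_EFinZ (al j) (fi j)) (integrable_EFinZ (be j) (gi j)))/=.
by rewrite (integral_EFinZ (al j) (fi j) (fF j)) (integral_EFinZ (be j) (gi j) (gG j)).
Qed.

End integral_lincomb.

(** * Block entropy as a sum of iterated gains *)

Section block_entropy_formula.
Variables (R : realType) (l : nat) (P : 'M[R]_l) (q : 'I_l -> R -> R).
Variables (istar : 'I_l) (c C1 C3 : R).
Local Notation RT := (measurableTypeR R).
Local Notation mu := (@lebesgue_measure R).
Local Notation TL := (tuple_lebesgue R).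
Hypothesis c_gt0 : 0 < c.
Hypothesis P_ge : forall i j, c <= P i j.
Hypothesis P_sum : forall i, \sum_j P i j = 1.
Hypothesis q_gt0 : forall i z, 0 < q i z.
Hypothesis q_cont : forall i, continuous (q i).
Hypothesis q_integrable : forall i, mu.-integrable setT (EFin \o q i).
Hypothesis q_int : forall i, \int[mu]_z q i z = 1.
Let v (z : R) : R := C1 * (1 + z ^+ 2).
Hypothesis qv_integrable : forall i, mu.-integrable setT (EFin \o (fun z => q i z * v z)).
Hypothesis qv_int : forall i, \int[mu]_z (q i z * v z) <= C3.
Hypothesis ln_weight_bound : forall z w, simplex c w -> `|ln (weight (q ^~ z) w)| <= v z.
Local Notation gain k := (iter k (filter_op P q) (log_gain q)).
Hypothesis ln_integrable : forall i w, simplex c w ->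
  mu.-integrable setT (EFin \o (fun z => q i z * ln (weight (q ^~ z) w))).
Hypothesis gain_integrable : forall k i w, simplex c w ->
  mu.-integrable setT (EFin \o (fun z => q i z * \sum_j P i j * gain k j (predict P (q ^~ z) w))).

Let P_ge0 i j : 0 <= P i j := le_trans (ltW c_gt0) (P_ge i j).

Let integral_EFin (f : R -> R) : mu.-integrable setT (EFin \o f) ->
  (\int[mu]_z (f z)%:E = (\int[mu]_z f z)%:E)%E.
Proof. by move=> fi; rewrite /Rintegral fineK//; exact: integrable_fin_num. Qed.

Lemma lik_gt0 i s : 0 < lik P q i s.
Proof.
elim: s i => [//|z s IH] i /=; rewrite mulr_gt0// (bigD1 i)//= ltr_pwDl//.
  by rewrite mulr_gt0// (lt_le_trans c_gt0).
by rewrite sumr_ge0// => j _; rewrite mulr_ge0// ltW.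
Qed.

Lemma measurable_lik n i : measurable_fun [set: n.-tuple RT] (fun t => lik P q i t).
Proof.
elim: n i => [|n IH] i.
  rewrite (_ : (fun t => _) = fun=> 1); first exact: measurable_cst.
  by apply/funext => t; rewrite (tuple0 t).
rewrite (_ : (fun t => _) = (fun t : n.+1.-tuple RT => q i (tnth t ord0) *
    \sum_j P i j * lik P q j [tuple of behead t])); last first.
  by apply/funext => t; rewrite [in LHS](tuple_eta t).
apply: measurable_funM.
  apply: (@measurableT_comp _ _ _ _ _ _ (q i)); last exact: measurable_tnth.
  exact: continuous_measurable_fun.
apply: measurable_sum => j; apply: measurable_funM; first exact: measurable_cst.
apply: (@measurableT_comp _ _ _ _ _ _ (fun t : n.-tuple RT => lik P q j t)); first exact: IH.
exact: measurable_behead.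
Qed.

Let V (s : seq R) := \sum_(z <- s) v z.

Let measurable_V n : measurable_fun [set: n.-tuple RT] (fun t => V t).
Proof.
rewrite (_ : (fun t => _) = (fun t : n.-tuple RT => \sum_(k < n) v (tnth t k))); last first.
  by apply/funext => t; rewrite /V big_tuple.
apply: measurable_sum => k; apply: (@measurableT_comp _ _ _ _ _ _ v); last exact: measurable_tnth.
apply: continuous_measurable_fun => z.
by apply: cvgMr; apply: cvgD; [exact: cvg_cst|exact: exprn_continuous].
Qed.

Let v_ge0 z : 0 <= v z.
Proof.
have w1 : simplex c (P istar) by split.
exact: le_trans (ln_weight_bound z w1).
Qed.

Let V_ge0 s : 0 <= V s. Proof. by rewrite sumr_ge0. Qed.

Let tuple_integral0 (f : 0.-tuple RT -> R) : (\int[TL 0]_t (f t)%:E = (f [tuple])%:E)%E.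
Proof.
rewrite (_ : (fun t => _) = cst (f [tuple])%:E); last first.
  by apply/funext => t; rewrite (tuple0 t).
by rewrite integral_cst//= diracT mule1.
Qed.

(** [V] dominates the log-likelihood of a block and is additive along it, so its moment yields the
    integrability needed for Fubini. Mass and moment go through one induction, as the recursion step
    for [V] splits into both. *)
Lemma lik_integrals n :
  [/\ forall i, (TL n).-integrable setT (fun t => (lik P q i t)%:E),
      forall i, (\int[TL n]_t (lik P q i t)%:E = 1)%E,
      forall i, (TL n).-integrable setT (fun t => (lik P q i t * V t)%:E) &
      forall i, (\int[TL n]_t (lik P q i t * V t)%:E <= (n%:R * C3)%:E)%E].
Proof.
have int_of k i (F : k.-tuple RT -> R) (K : R) : measurable_fun [set: k.-tuple RT] F -> (forall t, 0 <= F t) ->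
    (\int[TL k]_t (lik P q i t * F t)%:E <= K%:E)%E ->
    (TL k).-integrable setT (fun t => (lik P q i t * F t)%:E).
  move=> mF F0 FK; have [m mE] := tuple_lebesgue_sigma_finite R k.
  move: FK; rewrite -mE => FK; apply/integrableP; split.
    by apply/measurable_EFinP; apply: measurable_funM => //; exact: measurable_lik.
  apply: le_lt_trans (ltry K); apply: le_trans FK.
  rewrite le_eqVlt; apply/orP; left; apply/eqP; apply: eq_integral => t _.
  by rewrite abse_EFin ger0_norm// mulr_ge0// ltW// lik_gt0.
have int1 i k : (\int[TL k]_t (lik P q i t)%:E = 1)%E ->
    (TL k).-integrable setT (fun t => (lik P q i t)%:E).
  move=> h; have := @int_of k i (fun=> 1) 1.
  rewrite (_ : (fun t : k.-tuple RT => (lik P q i t * 1)%:E) = (fun t => (lik P q i t)%:E)); last first.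
    by apply/funext => t; rewrite mulr1.
  by apply => //; rewrite h.
elim: n => [|n [IHi IH IHVi IHV]].
  have h1 i : (\int[TL 0]_t (lik P q i t)%:E = 1)%E by rewrite tuple_integral0.
  have h2 i : (\int[TL 0]_t (lik P q i t * V t)%:E <= (0%:R * C3)%:E)%E.
    by rewrite tuple_integral0 /V big_nil mulr0 mul0r.
  by split=> // i; [exact: int1|apply: int_of (h2 i)].
have [m mE] := tuple_lebesgue_sigma_finite R n.
have likm j : (\int[m]_t (lik P q j t)%:E = 1%:E)%E by rewrite mE IH.
have likmi j : m.-integrable setT (fun t => (lik P q j t)%:E) by rewrite mE.
have likVi j : m.-integrable setT (fun t => (lik P q j t * V t)%:E) by rewrite mE.
have h1 i : (\int[TL n.+1]_t (lik P q i t)%:E = 1)%E.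
  rewrite tuple_tonelli; last first.
  - by move=> t; rewrite lee_fin ltW// lik_gt0.
  - by apply/measurable_EFinP; exact: measurable_lik.
  transitivity (\int[mu]_z (q i z)%:E)%E.
    apply: eq_integral => z _; rewrite -mE (eq_integral (fun t : n.-tuple RT => (\sum_j (q i z * P i j * lik P q j t))%:E)).
      have := integral_EFin_sum (fun j => integrable_EFinZ (q i z * P i j) (likmi j))
        (fun j => integral_EFinZ (q i z * P i j) (likmi j) (likm j)).
      move=> ->; congr EFin; under eq_bigr do rewrite mulr1.
      by rewrite -mulr_sumr P_sum mulr1.
    by move=> t _ /=; congr EFin; rewrite mulr_sumr; apply: eq_bigr => j _; rewrite mulrA.
  by rewrite integral_EFin// q_int.
have C30 : 0 <= C3.
  apply: le_trans (qv_int istar); apply: Rintegral_ge0 => z _.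
  by rewrite mulr_ge0// ltW.
pose G j := fine (\int[m]_t (lik P q j t * V t)%:E)%E.
have GE j : (\int[m]_t (lik P q j t * V t)%:E = (G j)%:E)%E.
  by rewrite fineK//; exact: integrable_fin_num.
have Gn j : G j <= n%:R * C3 by have := IHV j; rewrite -mE GE lee_fin.
have h2 i : (\int[TL n.+1]_t (lik P q i t * V t)%:E <= (n.+1%:R * C3)%:E)%E.
  rewrite tuple_tonelli; last first.
  - by move=> t; rewrite lee_fin mulr_ge0// ltW// lik_gt0.
  - apply/measurable_EFinP; apply: (@measurable_funM _ _ _ _ (fun t : n.+1.-tuple RT => lik P q i t) (fun t : n.+1.-tuple RT => V t)); [exact: measurable_lik|exact: measurable_V].
  have -> : (\int[mu]_z \int[TL n]_t (lik P q i (tcons (z, t)) * V (tcons (z, t)))%:E =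
      \int[mu]_z (q i z * v z + (\sum_j P i j * G j) * q i z)%:E)%E.
    apply: eq_integral => z _; rewrite -mE.
    rewrite (eq_integral (fun t : n.-tuple RT => (\sum_j (q i z * P i j * v z * lik P q j t + q i z * P i j * (lik P q j t * V t)))%:E)).
      rewrite (integral_lincomb (fun j => q i z * P i j * v z) (fun j => q i z * P i j) likmi likm likVi GE).
      congr EFin; rewrite big_split/=; congr (_ + _).
        under eq_bigr do rewrite mulr1.
        by rewrite -mulr_suml -mulr_sumr P_sum mulr1.
      by rewrite mulr_suml; apply: eq_bigr => j _; ring.
    move=> t _ /=; congr EFin; rewrite /V big_cons -mulrA mulr_suml mulr_sumr.
    by apply: eq_bigr => j _; ring.
  under eq_integral do rewrite EFinD.
  rewrite (integralD measurableT (qv_integrable i) (integrable_EFinZ (\sum_j P i j * G j) (q_integrable i)))/=.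
  rewrite integral_EFin//.
  rewrite (integral_EFinZ _ (q_integrable i) (integral_EFin (q_integrable i))) q_int mulr1.
  rewrite -EFinD lee_fin -natr1 mulrDl mul1r addrC lerD//.
  have -> : n%:R * C3 = \sum_j P i j * (n%:R * C3) by rewrite -mulr_suml P_sum mul1r.
  by apply: ler_sum => j _; rewrite ler_wpM2l.
split=> // i; first exact: int1.
by apply: int_of (h2 i).
Qed.

Let next_simplex z w : simplex c w -> simplex c (predict P (q ^~ z) w).
Proof.
move=> wc; apply: simplex_predict; rewrite ?(ltW c_gt0)//.
- by move=> i; apply: le_trans (ltW c_gt0) (wc.1 i).
- by move=> i; rewrite ltW.
- by apply: (weight_gt0_of_simplex istar c_gt0 wc).
Qed.

Lemma mlik_gt0 w s : simplex c w -> 0 < mlik P q w s.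
Proof.
move=> [wc _]; rewrite /mlik (bigD1 istar)//= ltr_pwDl//.
  by rewrite mulr_gt0// ?lik_gt0// (lt_le_trans c_gt0).
rewrite sumr_ge0// => j _; apply: mulr_ge0; last exact/ltW/lik_gt0.
exact: le_trans (ltW c_gt0) (wc j).
Qed.

Lemma ln_mlik_cons w z s : simplex c w -> ln (mlik P q w (z :: s)) =
  ln (weight (q ^~ z) w) + ln (mlik P q (predict P (q ^~ z) w) s).
Proof.
move=> wc; have W0 := weight_gt0_of_simplex istar c_gt0 wc (q_gt0 ^~ z).
by rewrite mlik_cons ?gt_eqF// lnM ?posrE// mlik_gt0//; exact: next_simplex.
Qed.

Lemma ln_mlik_bound w s : simplex c w -> `|ln (mlik P q w s)| <= V s.
Proof.
elim: s w => [|z s IH] w wc.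
  rewrite /mlik /V big_nil; under eq_bigr do rewrite mulr1.
  by rewrite wc.2 ln1 normr0.
rewrite ln_mlik_cons// /V big_cons; apply: le_trans (ler_normD _ _) _.
by apply: lerD; [exact: ln_weight_bound|exact/IH/next_simplex].
Qed.

Lemma lik_ln_integrable n i w : simplex c w ->
  (TL n).-integrable setT (fun t => (lik P q i t * ln (mlik P q w t))%:E).
Proof.
move=> wc; have [_ _ hV _] := lik_integrals n; have := hV i.
have [m mE] := tuple_lebesgue_sigma_finite R n; rewrite -mE => hVm.
apply: (le_integrable measurableT _ _ hVm).
  apply/measurable_EFinP; apply: measurable_funM; first exact: measurable_lik.
  apply: (@measurableT_comp _ _ _ _ _ _ (@ln R)); first exact: measurable_ln.
  apply: measurable_sum => j; apply: measurable_funM; first exact: measurable_cst.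
  exact: measurable_lik.
move=> t _; rewrite lee_fin !normrM ler_wpM2l// [leRHS]ger0_norm//.
exact: ln_mlik_bound.
Qed.

(** The true input [i] and the filter vector [w] are separate arguments: one output moves the first
    by [P] and the second by [predict]. The first symbol contributes [gain 0], and integrating the
    shorter block against the first symbol shifts every other gain by one iteration. *)
Lemma lik_ln_integral n i w : simplex c w ->
  (\int[TL n]_t (lik P q i t * ln (mlik P q w t))%:E =
   (- \sum_(k < n) gain k i w)%:E)%E.
Proof.
elim: n i w => [|n IH] i w wc.
  rewrite tuple_integral0 big_ord0 oppr0 /mlik; under eq_bigr do rewrite mulr1.
  by rewrite wc.2 ln1 mulr0.
rewrite tuple_fubini; last exact: lik_ln_integrable.
have [m mE] := tuple_lebesgue_sigma_finite R n.
have [IHi IH1 _ _] := lik_integrals n.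
have likm j : (\int[m]_t (lik P q j t)%:E = 1%:E)%E by rewrite mE IH1.
have likmi j : m.-integrable setT (fun t => (lik P q j t)%:E) by rewrite mE.
pose pw z := predict P (q ^~ z) w.
have pwc z : simplex c (pw z) by exact: next_simplex.
have lnm z j : (\int[m]_t (lik P q j t * ln (mlik P q (pw z) t))%:E =
    (- \sum_(k < n) gain k j (pw z))%:E)%E by rewrite mE IH.
have lnmi z j : m.-integrable setT (fun t => (lik P q j t * ln (mlik P q (pw z) t))%:E).
  by rewrite mE; exact: lik_ln_integrable.
transitivity (\int[mu]_z (q i z * ln (weight (q ^~ z) w) +
   \sum_(k < n) - 1 * (q i z * \sum_j P i j * gain k j (pw z)))%:E)%E.
  apply: eq_integral => z _; rewrite -mE; set W := ln (weight _ _).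
  rewrite (eq_integral (fun t : n.-tuple RT => (\sum_j (q i z * P i j * W * lik P q j t + q i z * P i j * (lik P q j t * ln (mlik P q (pw z) t))))%:E)).
    rewrite (integral_lincomb (fun j => q i z * P i j * W) (fun j => q i z * P i j) likmi likm (lnmi z) (lnm z)).
    congr EFin; rewrite big_split/=; congr (_ + _).
      under eq_bigr do rewrite mulr1.
      by rewrite -mulr_suml -mulr_sumr P_sum mulr1.
    under eq_bigr do rewrite mulrN mulr_sumr.
    rewrite sumrN exchange_big/= -sumrN; apply: eq_bigr => k _.
    by rewrite mulN1r mulr_sumr; congr (- _); apply: eq_bigr => j _; rewrite mulrA.
  move=> t _ /=; rewrite ln_mlik_cons// -/W -/(pw z); congr EFin.
  rewrite -mulrA mulr_suml mulr_sumr.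
  by apply: eq_bigr => j _; ring.
have gi (k : 'I_n) := integrable_EFinZ (-1) (gain_integrable k i wc).
under eq_integral do rewrite EFinD.
rewrite integralD//=; [|exact: ln_integrable|]; last first.
  exact: integrable_EFin_sum.
rewrite (integral_EFin (ln_integrable i wc)).
have -> := integral_EFin_sum gi (fun k => integral_EFinZ (-1) (gain_integrable k i wc) (integral_EFin (gain_integrable k i wc))).
rewrite -EFinD big_ord_recl /= opprD opprK; congr (_ + _)%:E.
by rewrite -sumrN; apply: eq_bigr => k _; rewrite mulN1r.
Qed.

Lemma plogp_integral (pi : 'rV[R]_l) n : simplex c (fun i => pi 0 i) ->
  (TL n.+1).-integrable setT (@plogp R l pi P q n) /\
  block_entropy pi P q n = \sum_i pi 0 i * \sum_(k < n.+1) gain k i (fun i => pi 0 i).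
Proof.
move=> pic; have [m mE] := tuple_lebesgue_sigma_finite R n.+1.
pose w := fun i => pi 0 i.
have E : (@plogp R l pi P q n) = (fun t => (\sum_i pi 0 i * (lik P q i t * ln (mlik P q w t)))%:E).
  apply/funext => t; rewrite /plogp hmc_densityE// -/w; congr EFin.
  by rewrite {1}/mlik mulr_suml; apply: eq_bigr => i _; rewrite mulrA.
have hl i : m.-integrable setT (fun t => (lik P q i t * ln (mlik P q w t))%:E).
  by rewrite mE; exact: lik_ln_integrable.
have hE i : (\int[m]_t (lik P q i t * ln (mlik P q w t))%:E =
    (- \sum_(k < n.+1) gain k i w)%:E)%E by rewrite mE; exact: lik_ln_integral.
have hi i := integrable_EFinZ (pi 0 i) (hl i).
split.
  by rewrite E -mE; exact: integrable_EFin_sum.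
rewrite /block_entropy E -mE.
rewrite (integral_EFin_sum hi (F := fun i => pi 0 i * - \sum_(k < n.+1) gain k i w)).
  by rewrite /= -sumrN; apply: eq_bigr => i _; rewrite mulrN opprK.
by move=> i; exact: (integral_EFinZ _ (hl i) (hE i)).
Qed.

End block_entropy_formula.

(** * Gaussian densities *)

Ltac continuity_at_zero := rewrite /continuous_at; cbv beta; repeat
  lazymatch goal with
  | |- context [nbhs (fmap (fun _ => ?c) _)] => exact: cvg_cst
  | |- context [nbhs (fmap (fun t => t) _)] => exact: cvg_id
  | |- context [nbhs (fmap (fun t => (@?A t) + (@?B t)) _)] => apply: (@cvgD _ _ _ _ _ A B)
  | |- context [nbhs (fmap (fun t => - (@?A t)) _)] => apply: (@cvgN _ _ _ _ _ A)
  | |- context [nbhs (fmap (fun t => (@?A t) * (@?B t)) _)] => apply: (@cvgM _ _ _ _ A B)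
  end.

Section gaussian_bounds.
Variable R : realType.
Implicit Types (k z : R).
Local Notation mu := (@lebesgue_measure R).

Lemma poly_le_expR k z : 0 < k -> 1 + z ^+ 2 <= (1 + k^-1) * expR (k * z ^+ 2).
Proof.
move=> k0; have y0 : 0 <= k * z ^+ 2 by rewrite mulr_ge0 ?sqr_ge0// ltW.
have k'0 : 0 <= k^-1 by rewrite invr_ge0 ltW.
apply: (@le_trans _ _ ((1 + k^-1) * (1 + k * z ^+ 2))).
  have -> : (1 + k^-1) * (1 + k * z ^+ 2) = 1 + z ^+ 2 + (k * z ^+ 2 + k^-1).
    by field; rewrite gt_eqF.
  by rewrite lerDl addr_ge0.
by rewrite ler_wpM2l ?addr_ge0// expR_ge1Dx.
Qed.

Lemma quadratic_le (a b c z : R) : 0 < a ->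
  - (a * z ^+ 2 + b * z + c) <= b ^+ 2 / (2 * a) + `|c| - a / 2 * z ^+ 2.
Proof.
move=> a0; have h : 0 <= a / 2 * (z + b / a) ^+ 2 by rewrite mulr_ge0 ?sqr_ge0// divr_ge0// ltW.
have e : a / 2 * (z + b / a) ^+ 2 = a / 2 * z ^+ 2 + b * z + b ^+ 2 / (2 * a).
  by field; rewrite gt_eqF.
have := ler_norm (- c); rewrite normrN; move: h; rewrite e; lra.
Qed.

Lemma quadratic_upper (a b c : R) : 0 < a ->
  exists2 C, 0 <= C & forall z, - (a * z ^+ 2 + b * z + c) <= C - a / 2 * z ^+ 2.
Proof.
move=> a0; exists (b ^+ 2 / (2 * a) + `|c|); last by move=> z; exact: quadratic_le.
by rewrite addr_ge0// divr_ge0 ?sqr_ge0// mulr_ge0// ltW.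
Qed.

(** The way small parameters are chosen below: a strict inequality at 0 persists for small positive
    values, and finitely many such conditions are intersected. *)
Lemma near_zero_lt (F : R -> R) (b : R) : {for 0, continuous F} -> F 0 < b ->
  \forall t \near 0^'+, F t < b.
Proof.
move=> cF Fb; apply: cvg_within; apply: (cF [set y | y < b]).
exact: open_nbhs_nbhs (conj (@open_lt _ b) Fb).
Qed.

(** The normal density in the parameters 1 / sigma and mu / sigma, for which the exponent is a
    polynomial in the parameters. *)
Definition gauss_pdf (rho m z : R) : R :=
  normal_peak 1 * rho * expR (- ((rho * z - m) ^+ 2 / 2)).

Lemma normal_peak1_gt0 : 0 < normal_peak 1 :> R.
Proof. by apply: normal_peak_gt0; exact: oner_neq0. Qed.

Lemma normal_pdf_gauss (s m z : R) : 0 < s ->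
  normal_pdf m s z = gauss_pdf s^-1 (m / s) z.
Proof.
move=> s0; rewrite normal_pdfE ?gt_eqF// /gauss_pdf /normal_fun; congr (_ * _).
  rewrite /normal_peak expr1n mul1r -mulrnAr sqrtrM ?sqr_ge0//.
  by rewrite sqrtr_sqr gtr0_norm// invfM mulrC.
by congr expR; rewrite -mulr_natl; field; rewrite gt_eqF.
Qed.

Lemma continuous_quadratic_exp (b c e f : R) :
  continuous (fun z => b * expR (c * z ^+ 2 + e * z + f)).
Proof.
move=> z; apply: cvgMr; apply: (cvg_comp _ expR); last exact: continuous_expR.
apply: cvgD; last exact: cvg_cst.
apply: cvgD; apply: cvgMr; last exact: cvg_id.
exact: exprn_continuous.
Qed.

Lemma exponent_quadratic (rho m w : R) z : w * (1 + z ^+ 2) - (rho * z - m) ^+ 2 / 2 =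
  - ((rho ^+ 2 / 2 - w) * z ^+ 2 + - (rho * m) * z + (m ^+ 2 / 2 - w)).
Proof. by field. Qed.

Lemma continuous_gauss (b rho m w : R) :
  continuous (fun z => b * expR (w * (1 + z ^+ 2) - (rho * z - m) ^+ 2 / 2)).
Proof.
rewrite (_ : (fun z => _) = (fun z => b * expR (- (rho ^+ 2 / 2 - w) * z ^+ 2 + (rho * m) * z + - (m ^+ 2 / 2 - w)))).
  exact: continuous_quadratic_exp.
by apply/funext => z; rewrite exponent_quadratic; congr (_ * expR _); ring.
Qed.

Lemma gauss_dominated_gauss (b rho m w : R) : 0 <= b -> 0 < rho -> w <= rho ^+ 2 / 4 ->
  gauss_dominated (fun z => b * expR (w * (1 + z ^+ 2) - (rho * z - m) ^+ 2 / 2)).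
Proof.
move=> b0 rho0 wle; have a0 : 0 < rho ^+ 2 / 2 - w.
  by have := exprn_gt0 2 rho0; lra.
have [C C0 hC] := quadratic_upper (- (rho * m)) (m ^+ 2 / 2 - w) a0.
exists (b * expR C), ((rho ^+ 2 / 2 - w) / 2); split=> [|z]; first exact: divr_gt0.
rewrite ger0_norm ?mulr_ge0 ?expR_ge0// -mulrA -expRD ler_wpM2l// ler_expR exponent_quadratic.
exact: hC.
Qed.

Lemma gauss_pdf_expand (rho m z : R) : gauss_pdf rho m z =
  normal_peak 1 * rho * expR (0 * (1 + z ^+ 2) - (rho * z - m) ^+ 2 / 2).
Proof. by rewrite mul0r add0r. Qed.

Lemma continuous_gauss_pdf (rho m : R) : continuous (gauss_pdf rho m).
Proof.
rewrite (_ : gauss_pdf rho m = (fun z => normal_peak 1 * rho * expR (0 * (1 + z ^+ 2) - (rho * z - m) ^+ 2 / 2))).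
  exact: continuous_gauss.
by apply/funext => z; exact: gauss_pdf_expand.
Qed.

Lemma gauss_dominated_gauss_pdf (rho m : R) : 0 < rho -> gauss_dominated (gauss_pdf rho m).
Proof.
move=> rho0; rewrite (_ : gauss_pdf rho m = (fun z => normal_peak 1 * rho * expR (0 * (1 + z ^+ 2) - (rho * z - m) ^+ 2 / 2))).
  apply: gauss_dominated_gauss => //; last by rewrite divr_ge0 ?sqr_ge0.
  by rewrite mulr_ge0 ?(ltW rho0)// ltW ?normal_peak1_gt0.
by apply/funext => z; exact: gauss_pdf_expand.
Qed.

Lemma integral_gauss_pdf (rho m : R) : 0 < rho -> \int[mu]_z gauss_pdf rho m z = 1.
Proof.
move=> rho0; rewrite /Rintegral -[RHS]/(fine 1%E); congr fine.
rewrite -(integral_normal_pdf (m / rho) rho^-1); apply: eq_integral => z _.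
by rewrite normal_pdf_gauss ?invr_gt0// invrK divfK ?gt_eqF.
Qed.

Lemma gauss_pdf_gt0 (rho m z : R) : 0 < rho -> 0 < gauss_pdf rho m z.
Proof. by move=> rho0; rewrite mulr_gt0 ?expR_gt0// mulr_gt0// normal_peak1_gt0. Qed.

(** The analytic bound that [gauss_pdf_bound] gives when both parameters are within [t] of [rho0]
    and [m0], whose absolute values are at most [Y]. *)
Definition gauss_majorant (rho0 m0 Y t z : R) : R := normal_peak 1 * (`|rho0| + t) *
  expR (t * (2 * Y + t) * (1 + z ^+ 2) - (rho0 * z - m0) ^+ 2 / 2).

(** With x = 1 + z^2 and w = t (2 Y + t), exp (w x) <= 1 + w x exp (w x). Up to the factor 1 + t /
    rho0, the majorant exceeds the density by at most [w] times a fixed integrable function [B], so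
    its mass tends to 1 with [t]. *)
Lemma gauss_majorant_integral (rho0 m0 Y e : R) : 0 < rho0 -> 0 <= Y -> 0 < e ->
  \forall t \near 0^'+, gauss_dominated (gauss_majorant rho0 m0 Y t) /\
    \int[mu]_z gauss_majorant rho0 m0 Y t z <= 1 + e.
Proof.
move=> r0 Y0 e0; have r2 := exprn_gt0 2 r0.
(* One factor exp (w0 x) covers exp (w x) for w <= w0, another absorbs the polynomial x; together
   they have rate rho0^2 / 4, the largest that [gauss_dominated_gauss] admits. *)
have np0 := normal_peak1_gt0; pose w0 := rho0 ^+ 2 / 8.
pose B z := normal_peak 1 * rho0 * (1 + w0^-1) *
  expR (w0 * 2 * (1 + z ^+ 2) - (rho0 * z - m0) ^+ 2 / 2).
have w00 : 0 < w0 by rewrite divr_gt0.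
have w0'0 : 0 <= w0^-1 by rewrite invr_ge0 ltW.
have b0 : 0 <= normal_peak 1 * rho0 * (1 + w0^-1).
  by rewrite !mulr_ge0 ?(ltW r0) ?(ltW np0) ?addr_ge0.
have cB : continuous B by exact: continuous_gauss.
have dB : gauss_dominated B.
  by apply: gauss_dominated_gauss => //; rewrite /w0; lra.
have iB := gauss_dominated_integrable cB dB.
set C := \int[mu]_z B z.
have h1 : \forall t \near 0^'+, t * (2 * Y + t) < w0.
  by apply: near_zero_lt; [continuity_at_zero|rewrite mul0r].
have h2 : \forall t \near 0^'+, (1 + t / rho0) * (1 + t * (2 * Y + t) * C) < 1 + e.
  by apply: near_zero_lt; [continuity_at_zero|rewrite !mul0r !addr0 mulr1 ltrDl].
near=> t.
have t0 : 0 < t by near: t; exact: nbhs_right_gt.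
have wt : t * (2 * Y + t) < w0 by near: t.
have Ct : (1 + t / rho0) * (1 + t * (2 * Y + t) * C) < 1 + e by near: t.
have dm : gauss_dominated (gauss_majorant rho0 m0 Y t).
  apply: gauss_dominated_gauss => //; last by move: wt; rewrite /w0; lra.
  by rewrite mulr_ge0 ?(ltW np0)// addr_ge0// ltW.
split=> //; apply: le_trans (ltW Ct).
set w := t * (2 * Y + t); have w_ge0 : 0 <= w.
  by rewrite mulr_ge0 ?(ltW t0)// addr_ge0 ?(ltW t0)// mulr_ge0.
have cq := @continuous_gauss_pdf rho0 m0.
have dq := gauss_dominated_gauss_pdf m0 r0.
have iq := gauss_dominated_integrable cq dq.
have cm : continuous (gauss_majorant rho0 m0 Y t) by exact: continuous_gauss.
have im := gauss_dominated_integrable cm dm.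
have iwB : mu.-integrable setT (EFin \o (fun z => w * B z)).
  by rewrite (_ : _ \o _ = (fun z => w%:E * (B z)%:E)%E)//; exact: integrableZl.
have isum : mu.-integrable setT (EFin \o (fun z => gauss_pdf rho0 m0 z + w * B z)).
  rewrite (_ : _ \o _ = ((EFin \o gauss_pdf rho0 m0) \+ (EFin \o (fun z => (w * B z)%R)))%E)//.
  exact: integrableD.
have -> : 1 + w * C = \int[mu]_z (gauss_pdf rho0 m0 z + w * B z).
  by rewrite RintegralD// RintegralZl// integral_gauss_pdf.
rewrite -RintegralZl//; apply: le_Rintegral => //.
  rewrite (_ : _ \o _ = (fun z => (1 + t / rho0)%:E * (gauss_pdf rho0 m0 z + w * B z)%:E)%E)//.
  exact: integrableZl.
move=> z _; rewrite /gauss_majorant ger0_norm ?(ltW r0)// -/w.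
have -> : normal_peak 1 * (rho0 + t) = (1 + t / rho0) * (normal_peak 1 * rho0).
  by field; rewrite gt_eqF.
rewrite -mulrA ler_wpM2l ?addr_ge0 ?divr_ge0 ?(ltW t0) ?(ltW r0)//.
rewrite /gauss_pdf /B; set E := (rho0 * z - m0) ^+ 2 / 2; set x := 1 + z ^+ 2.
have x1 : 1 <= x by rewrite lerDl sqr_ge0.
have -> : normal_peak 1 * rho0 * expR (- E) + w * (normal_peak 1 * rho0 * (1 + w0^-1) * expR (w0 * 2 * x - E)) =
  normal_peak 1 * rho0 * ((1 + w * ((1 + w0^-1) * expR (w0 * 2 * x))) * expR (- E)).
  by rewrite expRD; ring.
rewrite ler_wpM2l ?mulr_ge0 ?(ltW r0) ?(ltW np0)// expRD ler_wpM2r ?expR_ge0//.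
have wx0 : 0 <= w * x by rewrite mulr_ge0// (le_trans ler01).
have h : expR (w * x) <= 1 + w * x * expR (w * x).
  have := expR_ge1Dx (- (w * x)); rewrite -(ler_pM2l (expR_gt0 (w * x))) -expRD subrr expR0; lra.
apply: le_trans h _; rewrite lerD2l -mulrA ler_wpM2l//.
apply: (@le_trans _ _ ((1 + w0^-1) * expR (w0 * x) * expR (w0 * x))); last first.
  by rewrite -mulrA -expRD ler_wpM2l ?addr_ge0// ler_expR; lra.
apply: ler_pM; rewrite ?expR_ge0 ?(le_trans ler01)//; last first.
  by rewrite ler_expR ler_wpM2r ?(le_trans ler01)// ltW.
apply: le_trans (poly_le_expR z w00) _; rewrite ler_wpM2l ?addr_ge0// ler_expR ler_wpM2l ?(ltW w00)//.
by rewrite lerDr.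
Unshelve. all: by end_near.
Qed.

End gaussian_bounds.

(** * Gaussian densities with analytic parameters *)

Section analytic_gaussian.
Variables (R : realType) (d : nat) (a : 'rV[R]_d) (r : R).
Hypothesis r_gt0 : 0 < r.
Local Notation AN := (analytic_bound a r).

(** The exponential series without its constant term, so that the bound vanishes with [M]. *)
Lemma analytic_bound_expB1 f M : AN f M -> AN (fun s => expR (f s) - 1) (M * expR M).
Proof.
move=> fM; have M0 := analytic_bound_ge0 fM.
have E (y : R) : series (fun n => (if n == 0%N then 0 else (n`!%:R)^-1) * y ^+ n) @ \oo --> expR y - 1.
  have : series (exp_coeff y) n - 1 @[n --> \oo] --> expR y - 1.
    by apply: cvgB; [exact: is_cvg_series_exp_coeff|exact: cvg_cst].
  apply: cvg_trans; apply: near_eq_cvg; exists 1%N => // -[//|n] _.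
  rewrite /series/= !big_nat_recl// mul0r add0r {1}/exp_coeff/= expr0 fact0 divr1 addrAC subrr add0r.
  by apply: eq_bigr => k _; rewrite exp_coeffE mulrC.
have le1 : expR M - 1 <= M * expR M.
  have := expR_ge1Dx (- M); rewrite -(ler_pM2l (expR_gt0 M)) -expRD subrr expR0; lra.
apply: analytic_bound_le le1 _.
apply: (analytic_bound_powerseries r_gt0 (c := fun n => if n == 0%N then 0 else (n`!%:R)^-1) (F := fun y => expR y - 1) fM).
  rewrite (_ : (fun n => _) = (fun n => (if n == 0%N then 0 else (n`!%:R)^-1) * M ^+ n)); first exact: E.
  by apply/funext => n; rewrite ger0_norm//; case: ifP.
by move=> y _; exact: E.
Qed.

Lemma analytic_bound_near_mul f f0 h h0 t t' : AN (fun s => f s - f0) t -> AN (fun s => h s - h0) t' ->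
  AN (fun s => f s * h s - f0 * h0) (t * (`|h0| + t') + `|f0| * t').
Proof.
move=> ft ht; have hb : AN h (`|h0| + t').
  apply: analytic_bound_ext (analytic_boundD r_gt0 (analytic_bound_cst a r_gt0 h0) ht) => s _.
  by rewrite addrC subrK.
apply: analytic_bound_ext (analytic_boundD r_gt0 (analytic_boundM r_gt0 ft hb) (analytic_bound_scale f0 ht)) => s _.
by ring.
Qed.

Lemma analytic_bound_near_inv f b t : 0 < b -> t <= b / 2 -> AN (fun s => f s - b) t ->
  AN (fun s => (f s)^-1 - b^-1) (2 * t / b ^+ 2).
Proof.
move=> b0 tb ft; have t0 := analytic_bound_ge0 ft.
have tb' : t < b by apply: le_lt_trans tb _; lra.
have h := analytic_bound_scale b^-1 (analytic_boundM r_gt0 ft (analytic_bound_inv r_gt0 ft tb')).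
apply: (@analytic_bound_le _ _ _ _ _ (`|b^-1| * (t * (b - t)^-1))).
  rewrite ger0_norm ?invr_ge0 ?(ltW b0)//.
  have -> : 2 * t / b ^+ 2 = b^-1 * (t * (b / 2)^-1) by field; rewrite gt_eqF.
  rewrite ler_wpM2l ?invr_ge0 ?(ltW b0)// ler_wpM2l// lef_pV2 ?posrE ?divr_gt0 ?subr_gt0//; lra.
apply: analytic_bound_ext (analytic_boundN h) => s Ds.
have fs : f s != 0.
  have := analytic_bound_norm ft Ds; rewrite ler_norml => /andP[fs _].
  by rewrite gt_eqF//; lra.
by field; rewrite fs gt_eqF.
Qed.

Section exponent.
Variables (rho m : 'rV[R]_d -> R) (rho0 m0 Y t z : R).
Hypotheses (rho_near : AN (fun s => rho s - rho0) t) (m_near : AN (fun s => m s - m0) t).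
Hypotheses (rho0Y : `|rho0| <= Y) (m0Y : `|m0| <= Y).

Let t0 : 0 <= t := analytic_bound_ge0 rho_near.
Let Y0 : 0 <= Y := le_trans (normr_ge0 _) rho0Y.

Lemma one_add_norm_sqr : (1 + `|z|) ^+ 2 <= 2 * (1 + z ^+ 2).
Proof.
have := sqr_ge0 (1 - `|z|); have : `|z| ^+ 2 = z ^+ 2 by rewrite real_normK ?num_real.
nra.
Qed.

Lemma exponent_affine_near :
  AN (fun s => (rho s * z - m s) - (rho0 * z - m0)) (t * (1 + `|z|)).
Proof.
have := analytic_boundB r_gt0 (analytic_bound_scale z rho_near) m_near.
have -> : `|z| * t + t = t * (1 + `|z|) by ring.
by apply: analytic_bound_ext => s _; ring.
Qed.

Lemma affine0_le : `|rho0 * z - m0| <= Y * (1 + `|z|).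
Proof.
apply: le_trans (ler_normB _ _) _; rewrite normrM mulrDr mulr1 addrC.
by apply: lerD => //; rewrite ler_wpM2r.
Qed.

Lemma exponent_affine_bound :
  AN (fun s => rho s * z - m s) ((Y + t) * (1 + `|z|)).
Proof.
have := analytic_boundD r_gt0 (analytic_bound_cst a r_gt0 (rho0 * z - m0)) exponent_affine_near.
move=> h; apply: (@analytic_bound_le _ _ _ _ _ (`|rho0 * z - m0| + t * (1 + `|z|))).
  by rewrite mulrDl lerD2r affine0_le.
by apply: analytic_bound_ext h => s _; rewrite addrC subrK.
Qed.

(** Difference of squares: the factors have bounds t (1 + |z|) and (2 Y + t) (1 + |z|), and (1 +
    |z|)^2 <= 2 (1 + z^2). *)
Lemma exponent_near :
  AN (fun s => (rho s * z - m s) ^+ 2 / 2 - (rho0 * z - m0) ^+ 2 / 2)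
    (t * (2 * Y + t) * (1 + z ^+ 2)).
Proof.
have hs := analytic_boundD r_gt0 exponent_affine_bound (analytic_bound_cst a r_gt0 (rho0 * z - m0)).
have h := analytic_bound_scale 2^-1 (analytic_boundM r_gt0 exponent_affine_near hs).
apply: (@analytic_bound_le _ _ _ _ _ (`|2^-1| * (t * (1 + `|z|) * ((Y + t) * (1 + `|z|) + `|rho0 * z - m0|)))).
  rewrite ger0_norm ?invr_ge0//.
  apply: (@le_trans _ _ (2^-1 * (t * (1 + `|z|) * ((2 * Y + t) * (1 + `|z|))))).
    rewrite ler_wpM2l ?invr_ge0// ler_wpM2l ?mulr_ge0 ?addr_ge0//.
    by have := affine0_le; lra.
  have -> : 2^-1 * (t * (1 + `|z|) * ((2 * Y + t) * (1 + `|z|))) =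
    t * (2 * Y + t) * ((1 + `|z|) ^+ 2 / 2) by field.
  apply: ler_wpM2l; first by rewrite mulr_ge0// addr_ge0// mulr_ge0.
  by rewrite ler_pdivrMr// mulrC one_add_norm_sqr.
by apply: analytic_bound_ext h => s _; field.
Qed.

Lemma exponent_bound : AN (fun s => (rho s * z - m s) ^+ 2 / 2) ((Y + t) ^+ 2 * (1 + z ^+ 2)).
Proof.
have h := analytic_bound_scale 2^-1 (analytic_boundX r_gt0 2 exponent_affine_bound).
apply: (@analytic_bound_le _ _ _ _ _ (`|2^-1| * ((Y + t) * (1 + `|z|)) ^+ 2)).
  rewrite ger0_norm ?invr_ge0// exprMn mulrCA ler_wpM2l ?sqr_ge0//.
  by rewrite ler_pdivrMl// one_add_norm_sqr.
by apply: analytic_bound_ext h => s _; rewrite mulrC.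
Qed.

(** The Gaussian at the base point is factored out as a constant and only the deviation of the
    exponent is majorized: majorizing the whole exponent would lose its sign, and with it the decay
    in [z]. *)
Lemma gauss_pdf_bound : AN (fun s => gauss_pdf (rho s) (m s) z)
  (normal_peak 1 * (`|rho0| + t) * expR (t * (2 * Y + t) * (1 + z ^+ 2) - (rho0 * z - m0) ^+ 2 / 2)).
Proof.
have hr : AN rho (`|rho0| + t).
  apply: analytic_bound_ext (analytic_boundD r_gt0 (analytic_bound_cst a r_gt0 rho0) rho_near) => s _.
  by rewrite addrC subrK.
have he := analytic_bound_scale (expR (- ((rho0 * z - m0) ^+ 2 / 2)))
  (analytic_bound_exp r_gt0 (analytic_boundN exponent_near)).
have := analytic_bound_scale (normal_peak 1) (analytic_boundM r_gt0 hr he).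
rewrite (ger0_norm (ltW (normal_peak1_gt0 R))) (ger0_norm (expR_ge0 _)).
set A := expR (- _); set B := expR (t * _ * _) => h.
apply: (@analytic_bound_le _ _ _ _ _ (normal_peak 1 * ((`|rho0| + t) * (A * B)))).
  by rewrite [X in expR X]addrC expRD -/A -/B !mulrA.
apply: analytic_bound_ext h => s _; rewrite /A -expRD /gauss_pdf -mulrA; congr (_ * (_ * expR _)).
by ring.
Qed.

End exponent.

Lemma analytic_bound_ln f f0 t : 0 < f0 -> t <= f0 / 2 -> AN (fun s => f s - f0) t ->
  AN (fun s => ln (f s)) (`|ln f0| + 1).
Proof.
move=> f00 tf ft; have t0 := analytic_bound_ge0 ft.
have h1 : AN (fun s => f0^-1 * (f s - f0)) (1 / 2).
  apply: analytic_bound_le (analytic_bound_scale f0^-1 ft).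
  by rewrite ger0_norm ?invr_ge0 ?(ltW f00)// mulrC ler_pdivrMr// mulrC; lra.
have h2 : (1 / 2 : R) < 1 by lra.
have := analytic_boundD r_gt0 (analytic_bound_cst a r_gt0 (ln f0)) (analytic_bound_ln1p r_gt0 h1 h2).
have -> : 1 / 2 / (1 - 1 / 2) = 1 :> R by field.
apply: analytic_bound_ext => s Ds.
have := analytic_bound_norm ft Ds; rewrite ler_norml => /andP[fs _].
have fs0 : 0 < f s by lra.
rewrite -lnM ?posrE//; first by congr ln; field; rewrite gt_eqF.
have -> : 1 + f0^-1 * (f s - f0) = f s / f0 by field; rewrite gt_eqF.
exact: divr_gt0.
Qed.

Lemma ln_gauss_pdf_bound rho m rho0 m0 Y t z : 0 < rho0 -> rho0 <= Y -> `|m0| <= Y ->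
  t <= rho0 / 2 -> AN (fun s => rho s - rho0) t -> AN (fun s => m s - m0) t ->
  AN (fun s => ln (gauss_pdf (rho s) (m s) z))
     ((`|ln (normal_peak 1)| + (`|ln rho0| + 1) + (2 * Y) ^+ 2) * (1 + z ^+ 2)).
Proof.
move=> r0 rY mY tr rt mt; have t0 := analytic_bound_ge0 rt.
have rY' : `|rho0| <= Y by rewrite ger0_norm// ltW.
have hl := analytic_bound_ln r0 tr rt.
have := analytic_boundB r_gt0 (analytic_boundD r_gt0 (analytic_bound_cst a r_gt0 (ln (normal_peak 1))) hl)
  (exponent_bound z rt mt rY' mY).
set c1 := `|ln (normal_peak 1)| + _ => h.
have c10 : 0 <= c1 by rewrite !addr_ge0.
apply: (@analytic_bound_le _ _ _ _ _ (c1 + (Y + t) ^+ 2 * (1 + z ^+ 2))).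
  rewrite mulrDl lerD ?ler_peMr ?lerDl ?sqr_ge0// ler_wpM2r ?addr_ge0 ?sqr_ge0//.
  by rewrite ler_sqr ?nnegrE; lra.
apply: analytic_bound_ext h => s Ds.
have := analytic_bound_norm rt Ds; rewrite ler_norml => /andP[rs _].
have rs0 : 0 < rho s by lra.
by rewrite /gauss_pdf !lnM ?posrE ?expR_gt0 ?mulr_gt0 ?normal_peak1_gt0// expRK.
Qed.

End analytic_gaussian.

(** * Likelihood ratios against the state of largest variance *)

Section gaussian_ratio.
Variables (R : realType) (rho1 m1 rho2 m2 Y : R).
Hypotheses (rho1_gt0 : 0 < rho1) (rho12 : rho1 < rho2).
Hypotheses (rho1Y : rho1 <= Y) (rho2Y : rho2 <= Y) (m1Y : `|m1| <= Y) (m2Y : `|m2| <= Y).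

Let rho2_gt0 : 0 < rho2. Proof. exact: lt_trans rho12. Qed.

Let E1 z : R := (rho1 * z - m1) ^+ 2 / 2.
Let E2 z : R := (rho2 * z - m2) ^+ 2 / 2.
(** Half of the gap between the leading coefficients of the two exponents; the other half absorbs
    the terms of lower degree. *)
Let kappa : R := (rho2 ^+ 2 - rho1 ^+ 2) / 4.

Let kappa_gt0 : 0 < kappa.
Proof. by rewrite divr_gt0// subr_gt0 ltr_sqr ?nnegrE ?ltW. Qed.

Let exponent_gap : exists2 C, 0 <= C & forall z, E1 z - E2 z <= C - kappa * z ^+ 2.
Proof.
have k0 : 0 < (rho2 ^+ 2 - rho1 ^+ 2) / 2 by move: kappa_gt0; rewrite /kappa; lra.
have [C C0 hC] := quadratic_upper (rho1 * m1 - rho2 * m2) ((m2 ^+ 2 - m1 ^+ 2) / 2) k0.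
exists C => // z.
have -> : E1 z - E2 z = - ((rho2 ^+ 2 - rho1 ^+ 2) / 2 * z ^+ 2 + (rho1 * m1 - rho2 * m2) * z +
    (m2 ^+ 2 - m1 ^+ 2) / 2) by rewrite /E1 /E2; field.
by apply: le_trans (hC z) _; rewrite /kappa; lra.
Qed.

Lemma gauss_pdf_ratio (r1 m1' r2 m2' z : R) : r1 != 0 ->
  gauss_pdf r2 m2' z / gauss_pdf r1 m1' z =
  r2 / r1 * expR ((r1 * z - m1') ^+ 2 / 2 - (r2 * z - m2') ^+ 2 / 2).
Proof.
move=> r10; rewrite /gauss_pdf expRD expRN expRN.
by field; rewrite r10 !gt_eqF ?expR_gt0// normal_peak1_gt0.
Qed.

(** The exponent is perturbed by a multiple of 1 + z^2, unbounded in [z], but it is multiplied by a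
    ratio decaying like exp (- kappa z^2), as [rho1 < rho2]: this gives uniformity in [z]. The
    polydisc is quantified after [t], since its radius is chosen later. *)
Lemma gauss_ratio_near (e : R) : 0 < e -> \forall t \near 0^'+,
  forall d (a : 'rV[R]_d) (r : R) (f1 h1 f2 h2 : 'rV[R]_d -> R), 0 < r ->
  analytic_bound a r (fun s => f1 s - rho1) t -> analytic_bound a r (fun s => h1 s - m1) t ->
  analytic_bound a r (fun s => f2 s - rho2) t -> analytic_bound a r (fun s => h2 s - m2) t ->
  forall z, analytic_bound a r (fun s => gauss_pdf (f2 s) (h2 s) z / gauss_pdf (f1 s) (h1 s) z -
     gauss_pdf rho2 m2 z / gauss_pdf rho1 m1 z) e.
Proof.
move=> e0; have [C C0 hC] := exponent_gap.
have Y0 : 0 <= Y := le_trans (ltW rho1_gt0) rho1Y.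
pose w t := 2 * (t * (2 * Y + t)).
(* Bounds (1 + z^2) exp (E1 - E2) exp (w (1 + z^2)) for w <= kappa / 2: half of the decay absorbs
   the polynomial, half the perturbation. *)
pose C2 := (1 + (kappa / 2)^-1) * expR (C + kappa / 2).
pose N t := t * (`|rho1^-1| + 2 * t / rho1 ^+ 2) + `|rho2| * (2 * t / rho1 ^+ 2).
have n1 : \forall t \near 0^'+, w t < kappa / 2.
  by apply: near_zero_lt; [rewrite /w; continuity_at_zero|rewrite /w mul0r mulr0 divr_gt0].
have n2 : \forall t \near 0^'+, t < rho1 / 2.
  by apply: near_zero_lt; [continuity_at_zero|rewrite divr_gt0].
have n3 : \forall t \near 0^'+, N t * (expR C + w t * C2) + `|rho2 / rho1| * (w t * C2) < e.
  rewrite /N /w; move: (rho1 ^+ 2)^-1 `|_^-1| `|rho2| `|rho2 / rho1| C2 (expR C) => v1 v2 v3 v4 v5 v6.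
  by apply: near_zero_lt; [continuity_at_zero|rewrite !(mul0r, mulr0, addr0)].
near=> t => d a r f1 h1 f2 h2 r0 f1t h1t f2t h2t z.
have t0 : 0 < t by near: t; exact: nbhs_right_gt.
have wk : w t < kappa / 2 by near: t.
have tr : t < rho1 / 2 by near: t.
have Ne : N t * (expR C + w t * C2) + `|rho2 / rho1| * (w t * C2) < e by near: t.
have w0 : 0 <= w t by rewrite !mulr_ge0 ?addr_ge0 ?mulr_ge0 ?(ltW t0).
have r1Y : `|rho1| <= Y by rewrite ger0_norm// ltW.
have r2Y : `|rho2| <= Y by rewrite ger0_norm// ltW.
have ratio := analytic_bound_near_mul r0 f2t (analytic_bound_near_inv r0 rho1_gt0 (ltW tr) f1t).
rewrite -/(N t) in ratio.
have ex := analytic_boundB r0 (exponent_near r0 z f1t h1t r1Y m1Y) (exponent_near r0 z f2t h2t r2Y m2Y).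
have {}ex : analytic_bound a r (fun s => ((f1 s * z - h1 s) ^+ 2 / 2 - (f2 s * z - h2 s) ^+ 2 / 2) -
    (E1 z - E2 z)) (w t * (1 + z ^+ 2)).
  rewrite (_ : w t * _ = t * (2 * Y + t) * (1 + z ^+ 2) + t * (2 * Y + t) * (1 + z ^+ 2)); last by rewrite /w; ring.
  by apply: analytic_bound_ext ex => s _; rewrite /E1 /E2; ring.
have E0 : expR (E1 z - E2 z) <= expR C.
  rewrite ler_expR; apply: le_trans (hC z) _; rewrite gerBl mulr_ge0 ?sqr_ge0//; exact: ltW.
have exe : analytic_bound a r (fun s => expR ((f1 s * z - h1 s) ^+ 2 / 2 - (f2 s * z - h2 s) ^+ 2 / 2) -
    expR (E1 z - E2 z)) (w t * C2).
  have h := analytic_bound_scale (expR (E1 z - E2 z)) (analytic_bound_expB1 r0 ex).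
  move: h; rewrite (ger0_norm (expR_ge0 _)) => h.
  apply: (@analytic_bound_le _ _ _ _ _ (expR (E1 z - E2 z) * (w t * (1 + z ^+ 2) * expR (w t * (1 + z ^+ 2))))).
    rewrite (_ : _ * _ = w t * ((1 + z ^+ 2) * (expR (E1 z - E2 z) * expR (w t * (1 + z ^+ 2))))); last by ring.
    rewrite ler_wpM2l//.
    apply: (@le_trans _ _ ((1 + (kappa / 2)^-1) * expR (kappa / 2 * z ^+ 2) *
        (expR (C - kappa * z ^+ 2) * expR (kappa / 2 * (1 + z ^+ 2))))); last first.
      have k0 : 0 <= (kappa / 2)^-1 by rewrite invr_ge0 divr_ge0// ltW.
      by rewrite /C2 -mulrA -!expRD; apply: ler_wpM2l; rewrite ?addr_ge0// ler_expR; lra.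
    apply: ler_pM; rewrite ?mulr_ge0 ?expR_ge0 ?addr_ge0 ?sqr_ge0//.
      by apply: poly_le_expR; rewrite divr_gt0.
    apply: ler_pM; rewrite ?expR_ge0 ?ler_expR//.
    by rewrite ler_wpM2r ?addr_ge0 ?sqr_ge0// ltW.
  apply: analytic_bound_ext h => s _.
  by rewrite mulrBr mulr1 -expRD [_ + (_ - _)]addrC subrK.
have h := analytic_bound_near_mul r0 ratio exe.
have N0 := analytic_bound_ge0 ratio.
apply: (@analytic_bound_le _ _ _ _ _ (N t * (`|expR (E1 z - E2 z)| + w t * C2) + `|rho2 / rho1| * (w t * C2))).
  apply: le_trans (ltW Ne); rewrite lerD2r ler_wpM2l// lerD2r.
  by rewrite ger0_norm ?expR_ge0.
apply: analytic_bound_ext h => s Ds.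
have := analytic_bound_norm f1t Ds; rewrite ler_norml => /andP[fs _].
by rewrite !gauss_pdf_ratio// gt_eqF//; lra.
Unshelve. all: by end_near.
Qed.

Lemma gauss_ratio_le : exists G : R, forall z, gauss_pdf rho2 m2 z / gauss_pdf rho1 m1 z <= G.
Proof.
have [C C0 hC] := exponent_gap; exists (rho2 / rho1 * expR C) => z.
rewrite gauss_pdf_ratio ?gt_eqF// ler_wpM2l ?divr_ge0 ?(ltW rho1_gt0) ?(ltW rho2_gt0)// ler_expR.
apply: le_trans (hC z) _; rewrite gerBl mulr_ge0 ?sqr_ge0//; exact: ltW.
Qed.

End gaussian_ratio.

(** * Convergence to the entropy rate *)

Section scaled_weights.
Variables (R : realType) (l : nat).
Implicit Types (P : 'M[R]_l) (w : 'I_l -> R).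

Lemma weight_scale (k : R) (g : 'I_l -> R) w : weight (fun i => k * g i) w = k * weight g w.
Proof. by rewrite /weight mulr_sumr; apply: eq_bigr => i _; rewrite mulrCA. Qed.

(** Prediction sees the likelihoods only up to a common factor, so the densities may be replaced by
    their ratios to the one of [istar]. *)
Lemma predict_scale (k : R) P (g : 'I_l -> R) w j : k != 0 ->
  predict P (fun i => k * g i) w j = predict P g w j.
Proof.
move=> k0; rewrite /predict weight_scale; under eq_bigr do rewrite mulrCA -mulrA.
by rewrite -mulr_sumr -mulf_div divff// mul1r.
Qed.

End scaled_weights.

Section entropy_rate_limit.
Variables (R : realType) (d : nat) (a : 'rV[R]_d) (r : R) (l : nat).
Hypothesis r_gt0 : 0 < r.
Local Notation AN := (analytic_bound a r).
Local Notation D := (polydisc a r).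
Local Notation mu := (@lebesgue_measure R).
Variables (Pi : 'rV[R]_d -> 'M[R]_l) (Pi0 : 'M[R]_l) (q : 'rV[R]_d -> 'I_l -> R -> R).
Variables (Q : 'I_l -> R -> R) (g0 : R -> 'I_l -> R) (istar : 'I_l).
Variables (c eta G de C0 : R).
Hypotheses (c_gt0 : 0 < c) (c_le : c <= 1 / 2) (lc1 : l%:R * c < 1).
Hypotheses (eta_gt0 : 0 < eta) (de_le1 : de <= 1).
Local Notation tau := (step_error l G de).
Hypothesis tau_le : tau eta <= c ^+ 2 / 2.
Hypothesis tau_le' : 3 * (l%:R * (4 * tau eta / c ^+ 2)) <= c / 16.
Hypothesis tau0_le : 6 * (4 * tau 0 / c ^+ 2) / c <= c / 2 * eta.
Hypothesis eta_le : l%:R * eta <= c / 16.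
Hypothesis excess_le : (1 - l%:R * c + l%:R * de) ^+ 2 <= (1 - c / 4) * (1 - l%:R * c).
Hypothesis growth_le : (1 + c / 8) * (1 + l%:R * de) <= 1 + c / 4.
Hypothesis Pi0_ge : forall i j, c <= Pi0 i j.
Hypothesis Pi0_sum : forall i, \sum_j Pi0 i j = 1.
Hypothesis Pi_ge : forall s, D s -> forall i j, c <= Pi s i j.
Hypothesis Pi_sum : forall s, D s -> forall i, \sum_j Pi s i j = 1.
Hypothesis Pi_near : forall i j, AN (fun s => Pi s i j - Pi0 i j) de.
Hypothesis q_gt0 : forall s, D s -> forall i z, 0 < q s i z.
Hypothesis q_cont : forall s, D s -> forall i, continuous (q s i).
Hypothesis q_int : forall s, D s -> forall i, \int[mu]_z q s i z = 1.
Hypothesis qQ : forall i z, AN (fun s => q s i z) (Q i z).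
Hypothesis Q_cont : forall i, continuous (Q i).
Hypothesis Q_dom : forall i, gauss_dominated (Q i).
Hypothesis Q_int : forall i, \int[mu]_z Q i z <= 1 + c / 8.
Hypothesis g0_ge0 : forall z i, 0 <= g0 z i.
Hypothesis g0_le : forall z i, g0 z i <= G.
Hypothesis g0_star : forall z, g0 z istar = 1.
Hypothesis ratio_near : forall z i, AN (fun s => q s i z / q s istar z - g0 z i) de.
Hypothesis ln_q_star : forall z, AN (fun s => ln (q s istar z)) (C0 * (1 + z ^+ 2)).

Local Notation X := (near_simplex a r c eta).
(** [K] is the loss allowed to l1 bounds, small enough for (1 - c) K^2 <= rho (1 - c / 4), where 1 -
    c / 4 is left for the inverse weight ratio. [lam] is reached because (1 + c / 4) rho = lam - c^2
    / 8. *)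
Local Notation K := (1 + c / 16).
Local Notation rho := (1 - c / 2).
Local Notation lam := (1 - c / 4).
Let g z s i := q s i z / q s istar z.

Let l1 : 1 <= l%:R :> R.
Proof. by rewrite ler1n (leq_ltn_trans _ (ltn_ord istar)). Qed.

Let de0 : 0 <= de := analytic_bound_ge0 (Pi_near istar istar).

Let eta_c : eta <= c / 16.
Proof. by apply: le_trans eta_le; rewrite ler_peMl// ltW. Qed.

Let K2 : K <= 2. Proof. by have := c_le; lra. Qed.

Let K1 : 1 <= K. Proof. by have := c_gt0; lra. Qed.

Let KK4 : K * K <= 4.
Proof. by have := K2; have := K1; nra. Qed.

Let KKt t : 0 <= t -> t <= eta -> K * (K * t) <= 4 * eta.
Proof.
move=> t0 te; rewrite mulrA; apply: ler_pM => //.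
by rewrite mulr_ge0// (le_trans ler01 K1).
Qed.

Let small t : 0 <= t -> t <= eta -> K * (K * t) < 1 / 2.
Proof.
move=> t0 te; apply: le_lt_trans (KKt t0 te) _.
by have := eta_c; have := c_le; lra.
Qed.

Let contraction t : 0 <= t -> t <= eta -> (1 - c) * (K * K) <= rho * (1 - K * (K * t)).
Proof.
move=> t0 te; have h := KKt t0 te; have r0 : 0 <= rho by have := c_le; lra.
apply: (@le_trans _ _ (rho * (1 - 4 * eta))); last by rewrite ler_wpM2l// lerD2l lerN2.
apply: (@le_trans _ _ (rho * (1 - c / 4))); last first.
  by rewrite ler_wpM2l//; have := eta_c; lra.
have := c_gt0; have := c_le; nra.
Qed.

Let g_ge0 z s : D s -> forall i, 0 <= g z s i.
Proof. by move=> Ds i; rewrite divr_ge0// ltW// q_gt0. Qed.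

Let g_star z s : D s -> g z s istar = 1.
Proof. by move=> Ds; rewrite /g divff// gt_eqF// q_gt0. Qed.

Let next_step z x s : D s -> next Pi q z x s = step_next Pi (g z) x s.
Proof.
move=> Ds; have q0 : q s istar z != 0 by rewrite gt_eqF// q_gt0.
apply/funext => j; rewrite /next /step_next -(predict_scale _ (g z s) _ _ q0).
by congr predict; apply/funext => i; rewrite /g mulrC divfK.
Qed.

Let weight_g z s w : D s -> weight (q s ^~ z) w = q s istar z * weight (g z s) w.
Proof.
move=> Ds; have q0 : q s istar z != 0 by rewrite gt_eqF// q_gt0.
by rewrite -weight_scale; congr weight; apply/funext => i; rewrite /g mulrC divfK.
Qed.

Let near_of x : X x -> exists2 xi : 'I_l -> R, simplex c xi & forall i, AN (fun s => x s i - xi i) eta.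
Proof.
move=> [xD [xi xic xxi]]; exists xi => //.
by apply: (close_cst_near r_gt0 c_gt0 xic xxi) => s Ds; exact: (xD s Ds).2.
Qed.

Let next_near z x : X x -> X (next Pi q z x).
Proof.
move=> Xx; have [h1 [xi xic h2]] : X (step_next Pi (g z) x).
  apply: (near_simplex_step r_gt0 c_gt0 c_le de_le1 Pi0_ge Pi0_sum Pi_ge Pi_sum Pi_near
    (g0_ge0 z) (g0_le z) (g0_star z) (g_ge0 z) (g_star z) (ratio_near z) (K := K) (rho := rho) _ _ _ _ _ _ _ _ _ Xx) => //.
  - by rewrite lerD2l.
  - by rewrite lerD2l.
  - by apply: lt_trans (small (ltW eta_gt0) (lexx _)) _; lra.
  - exact: contraction (ltW eta_gt0) (lexx _).
  - by have := c_gt0; lra.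
  - by apply: le_trans tau0_le _; rewrite opprB addrC subrK.
  - by have := eta_c; have := c_le; lra.
split=> [s Ds|]; first by rewrite next_step//; exact: h1.
exists xi => // i k; apply: analytic_bound_ext (h2 i k) => s Ds.
by rewrite next_step.
Qed.

Let next_close z x y t : X x -> X y -> t <= eta -> close a r x y t ->
  close a r (next Pi q z x) (next Pi q z y) (rho * t).
Proof.
move=> Xx Xy te xyt; have t0 := analytic_bound_ge0 (xyt istar istar).
have [xi xic yxi] := near_of Xy.
have h : close a r (step_next Pi (g z) x) (step_next Pi (g z) y) (rho * t).
  apply: (close_step r_gt0 c_gt0 c_le de_le1 Pi0_ge Pi0_sum Pi_ge Pi_near
    (g0_ge0 z) (g0_le z) (g0_star z) (g_ge0 z) (g_star z) (ratio_near z) xic Xy.1 yxi tau_le Xx.1 xyt (K := K)).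
  - by rewrite lerD2l.
  - by rewrite lerD2l.
  - by apply: lt_trans (small t0 te) _; lra.
  - exact: contraction.
by move=> i k; apply: analytic_bound_ext (h i k) => s Ds; rewrite !next_step.
Qed.

Let weight_g_gt0 z s w : D s -> simplex c w -> 0 < weight (g z s) w.
Proof.
move=> Ds wc; apply: (weight_gt0_of_simplex istar c_gt0 wc) => i.
by rewrite divr_gt0// q_gt0.
Qed.

Let C1 := C0 + (`|ln c| + `|ln G| + 1).

(** After division by the density of [istar], the weight at the base point lies between [c] and [G].
    All growth in [z] thus comes from the logarithm of that density, which is quadratic. *)
Let ln_weight_bound z x : X x -> AN (fun s => ln (weight (q s ^~ z) (x s))) (C1 * (1 + z ^+ 2)).
Proof.
move=> Xx; have [xi xic xxi] := near_of Xx.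
have h := weight_near r_gt0 istar c_gt0 de_le1 (g0_ge0 z) (g0_le z) (ratio_near z) xic xxi.
set S := weight (g0 z) xi.
have Sc : c <= S by exact: (weight_ge (ltW c_gt0) xic (g0_ge0 z) (g0_star z)).
have SG : S <= G.
  rewrite /S /weight -[leRHS]mul1r -xic.2 mulr_suml; apply: ler_sum => i _.
  by rewrite ler_wpM2l// (le_trans (ltW c_gt0))// xic.1.
have S0 : 0 < S by exact: lt_le_trans Sc.
have c2 : c ^+ 2 / 2 <= S / 2.
  rewrite ler_pM2r//; apply: le_trans Sc; rewrite expr2 ler_piMl ?(ltW c_gt0)//.
  by have := c_le; lra.
have hl := analytic_bound_ln r_gt0 S0 (le_trans tau_le c2) h.
have lnS : `|ln S| <= `|ln c| + `|ln G|.
  have l_c : ln c <= ln S by rewrite ler_ln ?posrE.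
  have l_G : ln S <= ln G by rewrite ler_ln ?posrE// (lt_le_trans S0).
  have := ler_norm (ln G); have := ler_norm (- ln c); rewrite normrN ler_norml.
  have := normr_ge0 (ln c); have := normr_ge0 (ln G); lra.
have := analytic_boundD r_gt0 (ln_q_star z) hl => hs.
apply: (@analytic_bound_le _ _ _ _ _ (C0 * (1 + z ^+ 2) + (`|ln S| + 1))).
  rewrite /C1 mulrDl lerD2l; apply: (@le_trans _ _ (`|ln c| + `|ln G| + 1)); first by rewrite lerD2r.
  by rewrite ler_peMr ?addr_ge0// lerDl sqr_ge0.
apply: analytic_bound_ext hs => s Ds; rewrite weight_g// lnM ?posrE ?q_gt0//.
by apply: weight_g_gt0 => //; exact: Xx.1.
Qed.

Let ln_weight_close z x y t : X x -> X y -> t <= eta -> close a r x y t ->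
  AN (fun s => ln (weight (q s ^~ z) (x s)) - ln (weight (q s ^~ z) (y s))) (8 * t).
Proof.
move=> Xx Xy te xyt; have t0 := analytic_bound_ge0 (xyt istar istar).
have [xi xic yxi] := near_of Xy.
have h : AN (fun s => weight (g z s) (x s) / weight (g z s) (y s) - 1) (K * (K * t)).
  apply: (weight_ratio_near r_gt0 c_gt0 c_le de_le1
    (g0_ge0 z) (g0_le z) (g0_star z) (g_ge0 z) (g_star z) (ratio_near z) xic Xy.1 yxi tau_le Xx.1 xyt (K := K)).
  - by rewrite lerD2l.
  - by rewrite lerD2l.
have sm := small t0 te; have sm1 : K * (K * t) < 1 by apply: lt_trans sm _; lra.
have KKt4 : K * (K * t) <= 4 * t by rewrite mulrA ler_wpM2r.
have KKt0 := analytic_bound_ge0 h.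
(* With v = K (K t): v / (1 - v) <= 2 v since v < 1/2, and v <= 4 t, whence the constant 8. *)
apply: (@analytic_bound_le _ _ _ _ _ (K * (K * t) / (1 - K * (K * t)))).
  by rewrite ler_pdivrMr ?subr_gt0//; move: (K * (K * t)) sm KKt4 KKt0 => v; nra.
apply: analytic_bound_ext (analytic_bound_ln1p r_gt0 h sm1) => s Ds.
have xs := weight_g_gt0 z Ds (Xx.1 s Ds); have ys := weight_g_gt0 z Ds (Xy.1 s Ds).
rewrite !weight_g// !lnM ?posrE ?q_gt0// opprD addrACA subrr add0r.
by rewrite [1 + _]addrC subrK ln_div ?posrE.
Qed.

Let Pi_l1 i : l1_bound a r (fun s => Pi s i) (1 + l%:R * de).
Proof.
apply: (l1_bound_near r_gt0 (v0 := Pi0 i) (K := 1) _ _ (Pi_near i)) => // j.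
exact: le_trans (ltW c_gt0) _.
Qed.

Let Pi_excess i : l1_bound a r (fun s j => Pi s i j - c) (1 - l%:R * c + l%:R * de).
Proof.
apply: (l1_bound_near r_gt0 (v0 := fun j => Pi0 i j - c) (K := 1 - l%:R * c) (e := de)) => // [j||j].
- by rewrite subr_ge0.
- by rewrite sumrB Pi0_sum sumr_const card_ord -[_ *+ _]mulr_natl.
- by apply: analytic_bound_ext (Pi_near i j) => s _; rewrite opprB addrA subrK.
Qed.

Let KP_ge1 : 1 <= 1 + l%:R * de. Proof. by rewrite lerDl mulr_ge0. Qed.

Let excess_sqr : (1 - l%:R * c + l%:R * de) * (1 - l%:R * c + l%:R * de) <= lam * (1 - l%:R * c).
Proof. by rewrite -expr2. Qed.

Let Q_growth i : (\int[mu]_z Q i z) * (1 + l%:R * de) <= 1 + c / 4.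
Proof. by apply: le_trans growth_le; rewrite ler_wpM2r// (le_trans ler01 KP_ge1). Qed.

Let rho_le1 : rho <= 1. Proof. by have := c_gt0; lra. Qed.
Let rho_ge0 : 0 <= rho. Proof. by have := c_le; lra. Qed.
Let lam_lt1 : lam < 1. Proof. by have := c_gt0; lra. Qed.
Let Mrho : (1 + c / 4) * rho < lam. Proof. by have := c_gt0; nra. Qed.

Let limit := gain_iter_limit r_gt0 istar c_gt0 eta_gt0 lc1 rho_le1 Pi_ge Pi_sum q_gt0 q_cont q_int
  qQ Q_cont Q_dom Pi_l1 KP_ge1 Pi_excess excess_sqr Q_growth next_near next_close
  ln_weight_bound ln_weight_close (lexx lam) Mrho lam_lt1 rho_ge0.

(** Stationarity writes each entry as an average of entries of [Pi s], all at least [c], so a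
    stationary law is an admissible initial vector for the filter. *)
Let stationary_simplex s (p : 'rV[R]_l) : D s -> stationary_distribution (Pi s) p ->
  simplex c (fun i => p 0 i).
Proof.
move=> Ds [p0 p1 pP]; split=> // j; rewrite -pP mxE -[leLHS]mul1r -p1 mulr_suml.
by apply: ler_sum => i _; rewrite ler_wpM2l// Pi_ge.
Qed.

Let q_integrable s i : D s -> mu.-integrable setT (EFin \o q s i).
Proof.
move=> Ds; apply: gauss_dominated_integrable; first exact: q_cont.
apply: (gauss_dominatedM ler01 (Q_dom i)) => z; rewrite mulr1.
exact: (analytic_bound_norm (qQ i z) Ds).
Qed.

(** [h] is obtained before the stationary law is given: the iterates converge uniformly in the input
    and the initial vector, so one limit serves every [p]. *)
Theorem entropy_rate_analytic_bound : exists h Mh, AN h Mh /\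
  forall s (p : 'rV[R]_l), D s -> stationary_distribution (Pi s) p ->
    entropy_rate_defined p (Pi s) (q s) /\ entropy_rate p (Pi s) (q s) = h s.
Proof.
have [h [Mh [hM [C hC]]]] := limit.
exists h, Mh; split=> // s p Ds ps; have pc := stationary_simplex Ds ps.
pose C3 := \sum_i `|\int[mu]_z (q s i z * (C1 * (1 + z ^+ 2)))|.
have qv i := quadratic_integrable r_gt0 istar c_gt0 eta_gt0 Pi_ge Pi_sum q_cont qQ Q_dom ln_weight_bound i Ds.
have qv_le i : \int[mu]_z (q s i z * (C1 * (1 + z ^+ 2))) <= C3.
  by apply: le_trans (ler_norm _) _; rewrite /C3 (bigD1 i)//= lerDl sumr_ge0.
have lnW z w : simplex c w -> `|ln (weight (q s ^~ z) w)| <= C1 * (1 + z ^+ 2).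
  move=> wc; apply: (analytic_bound_norm (ln_weight_bound z (x := fun=> w) _) Ds).
  by apply: near_simplex_cst => //; exact: ltW.
have lnI i w (wc : simplex c w) :=
  ln_weight_integrable r_gt0 istar c_gt0 eta_gt0 Pi_ge Pi_sum q_gt0 q_cont qQ Q_dom ln_weight_bound i Ds wc.
have gainI k i w (wc : simplex c w) := gain_iter_integrable r_gt0 istar c_gt0 eta_gt0 lc1 rho_le1 Pi_ge Pi_sum
  q_gt0 q_cont q_int qQ Q_cont Q_dom Pi_l1 KP_ge1 Pi_excess excess_sqr Q_growth next_near next_close
  ln_weight_bound ln_weight_close (lexx lam) Mrho rho_ge0 k i Ds wc.
have formula n : (tuple_lebesgue R n.+1).-integrable setT (plogp p (Pi s) (q s) (n:=n)) /\
  block_entropy p (Pi s) (q s) n = \sum_i p 0 i * \sum_(k < n.+1) gain_iter Pi q k s i (fun i => p 0 i).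
  exact: (plogp_integral istar c_gt0 (Pi_ge Ds) (Pi_sum Ds) (q_gt0 Ds) (q_cont Ds)
    (fun i => q_integrable i Ds) (q_int Ds) qv qv_le lnW lnI gainI).
pose u k := \sum_i p 0 i * gain_iter Pi q k s i (fun i => p 0 i).
have u_cvg : u @ \oo --> h s.
  have b0 : C * lam ^+ k @[k --> \oo] --> (0 : R).
    rewrite -[X in _ --> X](mulr0 C); apply: cvgMr; apply: cvg_expr.
    by rewrite ger0_norm//; have := c_le; lra.
  apply/cvgrPdist_le => e e0; move/cvgrPdist_le: b0 => /(_ e e0).
  apply: filterS => k; rewrite sub0r normrN => Ck; rewrite distrC.
  apply: le_trans (le_trans (ler_norm _) Ck).
  have -> : u k - h s = \sum_i p 0 i * (gain_iter Pi q k s i (fun i => p 0 i) - h s).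
    by under [RHS]eq_bigr do rewrite mulrBr; rewrite sumrB -mulr_suml; case: ps => _ -> _; rewrite mul1r.
  apply: le_trans (ler_norm_sum _ _ _) _; have [p0 p1 _] := ps.
  rewrite -[leRHS]mul1r -[X in _ <= X * _]p1 mulr_suml.
  apply: ler_sum => i _; rewrite normrM (ger0_norm (p0 i)) ler_wpM2l//.
  exact: hC.
(* A block of index n has n + 1 symbols and n + 1 gains, so the normalized entropy is exactly a
   Cesaro mean of [u]. *)
have seqE : entropy_seq p (Pi s) (q s) = arithmetic_mean u.
  apply/funext => n; rewrite /entropy_seq (formula n).2 /arithmetic_mean/= mulrC; congr (_ * _).
  rewrite /series/= big_mkord /u exchange_big/=; apply: eq_bigr => i _.
  by rewrite mulr_sumr.
have rate_cvg : entropy_seq p (Pi s) (q s) @ \oo --> h s by rewrite seqE; exact: cesaro.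
split; last by rewrite /entropy_rate; apply: cvg_lim.
by split=> [n|]; [exact: (formula n).1|apply/cvg_ex; exists (h s)].
Qed.

End entropy_rate_limit.

(** * Small polydiscs around the channel parameters *)

Section channel_parameters.
Variable R : realType.

Lemma near_zero_ex (P : set R) : (\forall t \near 0^'+, P t) -> exists2 t, 0 < t & P t.
Proof.
move=> nP; have nP0 : \forall t \near 0^'+, P t /\ 0 < t.
  by apply: filterI nP _; exact: nbhs_right_gt.
by have [t [tP t0]] := @filter_ex _ _ (at_right_proper_filter 0) _ nP0; exists t.
Qed.

Variables (m l : nat).
Variables (e0 : 'rV[R]_m) (sigma0 mu0 : 'rV[R]_l).
Hypothesis sigma0_pos : forall i, 0 < sigma0 0 i.
Local Notation a := (row_mx e0 (row_mx sigma0 mu0)).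
Local Notation sigma s i := (lsubmx (rsubmx (s : 'rV[R]_(m + (l + l)))) 0 i).
Local Notation mean s i := (rsubmx (rsubmx (s : 'rV[R]_(m + (l + l)))) 0 i).

Lemma sigma_near r i : 0 < r -> analytic_bound a r (fun s => sigma s i - sigma0 0 i) r.
Proof.
move=> r0; apply: analytic_bound_ext (analytic_bound_coord a r0 (rshift m (lshift l i))) => s _.
by rewrite row_mxEr row_mxEl !mxE.
Qed.

Lemma mean_near r i : 0 < r -> analytic_bound a r (fun s => mean s i - mu0 0 i) r.
Proof.
move=> r0; apply: analytic_bound_ext (analytic_bound_coord a r0 (rshift m (rshift l i))) => s _.
by rewrite !row_mxEr !mxE.
Qed.

Lemma channel_parameters_near t : 0 < t -> \forall r \near 0^'+, forall i,
  [/\ analytic_bound a r (fun s => (sigma s i)^-1 - (sigma0 0 i)^-1) t,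
      analytic_bound a r (fun s => mean s i / sigma s i - mu0 0 i / sigma0 0 i) t &
      forall s, polydisc a r s -> 0 < sigma s i].
Proof.
move=> t0; apply: filter_forall => i; have s0 := sigma0_pos i.
have n1 : \forall r \near 0^'+, r < sigma0 0 i / 2.
  by apply: near_zero_lt; [continuity_at_zero|rewrite divr_gt0].
have n2 : \forall r \near 0^'+, 2 * r / sigma0 0 i ^+ 2 < t.
  by move: (sigma0 0 i ^+ 2)^-1 => v; apply: near_zero_lt; [continuity_at_zero|rewrite mulr0 mul0r].
have n3 : \forall r \near 0^'+, r * (`|(sigma0 0 i)^-1| + 2 * r / sigma0 0 i ^+ 2) +
    `|mu0 0 i| * (2 * r / sigma0 0 i ^+ 2) < t.
  move: (sigma0 0 i ^+ 2)^-1 `|(sigma0 0 i)^-1| `|mu0 0 i| => v1 v2 v3.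
  by apply: near_zero_lt; [continuity_at_zero|rewrite !(mulr0, mul0r, addr0)].
near=> r; have r0 : 0 < r by near: r; exact: nbhs_right_gt.
have rs : r < sigma0 0 i / 2 by near: r.
have inv := analytic_bound_near_inv r0 s0 (ltW rs) (sigma_near i r0).
split=> [||s Ds].
- by apply: analytic_bound_le inv; apply: ltW; near: r.
- by apply: analytic_bound_le (analytic_bound_near_mul r0 (mean_near i r0) inv); apply: ltW; near: r.
- have := analytic_bound_norm (sigma_near i r0) Ds; rewrite ler_norml => /andP[].
  by move: rs; lra.
Unshelve. all: by end_near.
Qed.

Lemma lsubmx_near (f : 'rV[R]_m -> R) t : real_analytic_at f e0 -> 0 < t ->
  \forall r \near 0^'+, analytic_bound a r (fun s => f (lsubmx s) - f e0) t.
Proof.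
move=> /real_analytic_bound[r0 r00 [M fM]] t0.
have n1 : \forall r \near 0^'+, r < r0 by apply: near_zero_lt; [continuity_at_zero|].
have n2 : \forall r \near 0^'+, r / r0 * M < t by apply: near_zero_lt; [continuity_at_zero|rewrite !mul0r].
near=> r; have rp : 0 < r by near: r; exact: nbhs_right_gt.
have rr0 : r <= r0 by apply: ltW; near: r.
apply: analytic_bound_lsubmx (analytic_bound_le _ (analytic_bound_shrink rp rr0 fM)) => //.
by apply: ltW; near: r.
Unshelve. all: by end_near.
Qed.

Lemma lsubmx_open (U : set 'rV[R]_m) : open U -> U e0 ->
  \forall r \near 0^'+, forall s, polydisc a r s -> U (lsubmx s).
Proof.
move=> oU Ue; have /nbhs_ballP[e /= ep eU] : nbhs e0 U by exact: open_nbhs_nbhs.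
have n1 : \forall r \near 0^'+, r < e by apply: near_zero_lt; [continuity_at_zero|].
apply: filterS n1 => r re s Ds; apply: eU; split=> // i j; rewrite ord1 /ball/=.
have := Ds (lshift (l + l) j); rewrite row_mxEl mxE distrC => h.
exact: lt_trans re.
Qed.

Lemma polydisc_near d (b : 'rV[R]_d) r : 0 < r -> \forall s \near b, polydisc b r s.
Proof.
move=> r0; apply/nbhs_ballP; exists r => //= s [_ bs] i.
by have := bs 0 i; rewrite /ball/= distrC.
Qed.

End channel_parameters.

(** * Choice of the constants *)

Section constants.
Variables (R : realType) (l : nat) (c G : R).
Hypotheses (c_gt0 : 0 < c) (lc1 : l%:R * c < 1) (G0 : 0 <= G).
Local Notation tau := (step_error l G).

(** For de <= eta the step error is at most eta times l (3 G + 4), so these conditions hold for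
    small [eta], uniformly in [de]. *)
Lemma eta_exists : exists2 eta, 0 < eta & l%:R * eta <= c / 16 /\ forall de, de <= eta ->
  tau de eta <= c ^+ 2 / 2 /\ 3 * (l%:R * (4 * tau de eta / c ^+ 2)) <= c / 16.
Proof.
pose B := l%:R * (3 * G + 4).
have c2 := exprn_gt0 2 c_gt0.
have n1 : \forall t \near 0^'+, t * B < c ^+ 2 / 2.
  by apply: near_zero_lt; [continuity_at_zero|rewrite mul0r divr_gt0].
have n2 : \forall t \near 0^'+, 3 * (l%:R * (4 * (t * B) / c ^+ 2)) < c / 16.
  move: (c ^+ 2)^-1 => v.
  by apply: near_zero_lt; [continuity_at_zero|rewrite !(mulr0, mul0r) divr_gt0].
have n3 : \forall t \near 0^'+, t * l%:R < c / 16.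
  by apply: near_zero_lt; [continuity_at_zero|rewrite mul0r divr_gt0].
have [eta eta0 [[h1 h2] h3]] := near_zero_ex (filterI (filterI n1 n2) n3).
exists eta => //; split=> [|de dee]; first by rewrite mulrC ltW.
have tB : tau de eta <= eta * B.
  rewrite /step_error /B [leRHS]mulrCA ler_wpM2l//.
  have G2 : 0 <= 2 + G by rewrite addr_ge0.
  by have := ler_wpM2l G2 dee; lra.
split; first exact: le_trans tB (ltW h1).
apply: le_trans (ltW h2); rewrite ler_wpM2l// ler_wpM2l// ler_wpM2r ?invr_ge0 ?sqr_ge0//.
by rewrite ler_wpM2l.
Qed.

(** Here [eta] is already fixed: [step_error] at 0 is proportional to [de], so it can be made small
    relative to [eta]. The excess condition is strict at de = 0 because c / 4 < l c. *)
Lemma perturbation_exists eta : 0 < eta -> (1 : R) <= l%:R -> exists2 de, 0 < de & [/\ de <= eta, de <= 1, de <= c,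
  6 * (4 * tau de 0 / c ^+ 2) / c <= c / 2 * eta &
  (1 - l%:R * c + l%:R * de) ^+ 2 <= (1 - c / 4) * (1 - l%:R * c) /\
  (1 + c / 8) * (1 + l%:R * de) <= 1 + c / 4].
Proof.
move=> eta0 l1; have lcc : c <= l%:R * c by rewrite ler_peMl// ltW.
have n1 : \forall t \near 0^'+, t < eta by apply: near_zero_lt; [continuity_at_zero|].
have n2 : \forall t \near 0^'+, t < 1 :> R by apply: near_zero_lt; [continuity_at_zero|].
have n3 : \forall t \near 0^'+, t < c by apply: near_zero_lt; [continuity_at_zero|].
have n4 : \forall t \near 0^'+, 6 * (4 * tau t 0 / c ^+ 2) / c < c / 2 * eta.
  rewrite /step_error; move: (c ^+ 2)^-1 => v;
  apply: near_zero_lt; first by continuity_at_zero.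
  by rewrite !(mulr0, mul0r, addr0) mulr_gt0// divr_gt0.
have n5 : \forall t \near 0^'+, (1 - l%:R * c + l%:R * t) * (1 - l%:R * c + l%:R * t) < (1 - c / 4) * (1 - l%:R * c).
  apply: near_zero_lt; first by continuity_at_zero.
  rewrite mulr0 addr0 ltr_pM2r ?subr_gt0//; have := c_gt0; lra.
have n6 : \forall t \near 0^'+, (1 + c / 8) * (1 + l%:R * t) < 1 + c / 4.
  by apply: near_zero_lt; [continuity_at_zero|rewrite mulr0 addr0 mulr1 ltrD2l; have := c_gt0; lra].
have [de de0 [[[h1 h2] [h3 h4]] [h5 h6]]] := near_zero_ex (filterI (filterI (filterI n1 n2) (filterI n3 n4)) (filterI n5 n6)).
by exists de => //; rewrite expr2; split; try (split); exact: ltW.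
Qed.

End constants.

Theorem mainTheorem5 (R : realType) (m l : nat)
  (Omega : set 'rV[R]_m)
  (Omega_open : open Omega)
  (Omega_connected : connected Omega)
  (Omega_bounded : bounded_set Omega)
  (Pi : 'rV[R]_m -> 'M[R]_l)
  (Pi_stochastic : forall eps, Omega eps -> stochastic (Pi eps))
  (Pi_analytic : forall eps, Omega eps -> forall i j,
     real_analytic_at (fun e => Pi e i j) eps)
  (pi : 'rV[R]_m -> 'rV[R]_l)
  (pi_stationary : forall eps, Omega eps ->
     stationary_distribution (Pi eps) (pi eps))
  (eps0 : 'rV[R]_m)
  (eps0_in : Omega eps0)
  (Pi_pos : forall i j, 0 < Pi eps0 i j)
  (sigma0 mu0 : 'rV[R]_l)
  (sigma0_pos : forall i, 0 < sigma0 0 i)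
  (sigma0_dom : exists i, forall j, j != i -> sigma0 0 j < sigma0 0 i) :
  let theta0 : 'rV[R]_(m + (l + l)) := row_mx eps0 (row_mx sigma0 mu0) in
  let eps (theta : 'rV[R]_(m + (l + l))) := lsubmx theta in
  let q (theta : 'rV[R]_(m + (l + l))) :=
    gaussian_channel (lsubmx (rsubmx theta)) (rsubmx (rsubmx theta)) in
  (\forall theta \near theta0,
     entropy_rate_defined (pi (eps theta)) (Pi (eps theta)) (q theta)) /\
  real_analytic_at
    (fun theta => entropy_rate (pi (eps theta)) (Pi (eps theta)) (q theta))
    theta0.
Proof.
move=> theta0 eps q; have [istar dom] := sigma0_dom.
have l1 : 1 <= l%:R :> R by rewrite ler1n (leq_ltn_trans _ (ltn_ord istar)).
have nc : \forall x \near 0^'+, forall i j, x * 2 < Pi eps0 i j.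
  apply: filter_forall => i; apply: filter_forall => j.
  by apply: near_zero_lt; [continuity_at_zero|rewrite mul0r].
(* Entries above 2 c at [eps0] stay at least [c] when perturbed by de <= c, and l c < 1 leaves
   positive mass once [c] is removed from every entry of a row. *)
have [c c0 [[c_half lc1] Pic]] : exists2 c, 0 < c & (c < 1 / 2 /\ c * l%:R < 1) /\ forall i j, c * 2 < Pi eps0 i j.
  apply: near_zero_ex; apply: filterI; first apply: filterI.
  - by apply: near_zero_lt; [continuity_at_zero|].
  - by apply: near_zero_lt; [continuity_at_zero|rewrite mul0r].
  - exact: nc.
have {}lc1 : l%:R * c < 1 by rewrite mulrC.
pose rho0 i := (sigma0 0 i)^-1; pose m0 i := mu0 0 i / sigma0 0 i.
have rho0_gt0 i : 0 < rho0 i by rewrite invr_gt0.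
(* In terms of 1 / sigma, the state of largest variance has the smallest parameter, hence the
   slowest decaying density. *)
have rho0_dom j : j != istar -> rho0 istar < rho0 j.
  by move=> ji; rewrite ltf_pV2 ?posrE// dom.
pose Y := \sum_i (`|rho0 i| + `|m0 i|).
have Y_ge i : `|rho0 i| + `|m0 i| <= Y.
  by rewrite /Y (bigD1 i)//= lerDl sumr_ge0// => j _; rewrite addr_ge0.
have Y_rho i : `|rho0 i| <= Y by apply: le_trans (Y_ge i); rewrite lerDl.
have Y_m i : `|m0 i| <= Y by apply: le_trans (Y_ge i); rewrite lerDr.
have Y_rho' i : rho0 i <= Y by exact: le_trans (ler_norm _) (Y_rho i).
have Y0 : 0 <= Y := le_trans (normr_ge0 _) (Y_rho istar).
pose g0 z i := gauss_pdf (rho0 i) (m0 i) z / gauss_pdf (rho0 istar) (m0 istar) z.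
have g0_ge0 z i : 0 <= g0 z i by rewrite divr_ge0// ltW// gauss_pdf_gt0.
have g0_star z : g0 z istar = 1 by rewrite /g0 divff// gt_eqF// gauss_pdf_gt0.
have [G G0 g0_le] : exists2 G, 0 <= G & forall z i, g0 z i <= G.
  have /fin_all_exists[G' hG] i : exists G, forall z, g0 z i <= G.
    have [->|ji] := eqVneq i istar; first by exists 1 => z; rewrite g0_star.
    exact: gauss_ratio_le (rho0_gt0 istar) (rho0_dom _ ji).
  exists (\sum_i `|G' i|) => [|z i]; first by rewrite sumr_ge0.
  apply: le_trans (hG i z) _; apply: le_trans (ler_norm _) _.
  by rewrite (bigD1 i)//= lerDl sumr_ge0.
have [eta eta0 [eta_le tauP]] := @eta_exists R l c G c0 G0.
have [de de0 [de_eta de1 dec tau0 [excess growth]]] := @perturbation_exists R l c G c0 lc1 eta eta0 l1.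
have [tau1 tau2] := tauP de de_eta.
have c8 : 0 < c / 8 by exact: divr_gt0.
have nQ : \forall t \near 0^'+, forall i, gauss_dominated (gauss_majorant (rho0 i) (m0 i) Y t) /\
    \int[lebesgue_measure]_z gauss_majorant (rho0 i) (m0 i) Y t z <= 1 + c / 8.
  by apply: filter_forall => i; exact: gauss_majorant_integral.
have ng : \forall t \near 0^'+, forall i, i != istar ->
    forall d (a : 'rV[R]_d) (r : R) (f1 h1 f2 h2 : 'rV[R]_d -> R), 0 < r ->
    analytic_bound a r (fun s => f1 s - rho0 istar) t -> analytic_bound a r (fun s => h1 s - m0 istar) t ->
    analytic_bound a r (fun s => f2 s - rho0 i) t -> analytic_bound a r (fun s => h2 s - m0 i) t ->
    forall z, analytic_bound a r (fun s => gauss_pdf (f2 s) (h2 s) z / gauss_pdf (f1 s) (h1 s) z - g0 z i) de.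
  apply: filter_forall => i; have [->|ii] := eqVneq i istar; first exact: nearW.
  have := gauss_ratio_near (rho0_gt0 istar) (rho0_dom _ ii) (Y_rho' istar) (Y_rho' i) (Y_m istar) (Y_m i) de0.
  by apply: filterS => t ht _.
have nt : \forall t \near 0^'+, t < rho0 istar / 2.
  by apply: near_zero_lt; [continuity_at_zero|rewrite divr_gt0].
(* [t] bounds the variation of 1 / sigma and mu / sigma; the radius [r] comes last and realizes both
   [t] and [de]. *)
have [t t0 [[Qt gt] trho]] := near_zero_ex (filterI (filterI nQ ng) nt).
have npar := channel_parameters_near eps0 mu0 sigma0_pos t0.
have nPi : \forall r \near 0^'+, forall i j,
    analytic_bound theta0 r (fun s => Pi (lsubmx s) i j - Pi eps0 i j) de.
  apply: filter_forall => i; apply: filter_forall => j.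
  exact: (lsubmx_near _ _ (Pi_analytic _ eps0_in i j)).
have nOm := lsubmx_open sigma0 mu0 Omega_open eps0_in.
have [r r0 [[par PiN] Om]] := near_zero_ex (filterI (filterI npar nPi) nOm).
have qE s i z : polydisc theta0 r s ->
    q s i z = gauss_pdf (lsubmx (rsubmx s) 0 i)^-1 (rsubmx (rsubmx s) 0 i / lsubmx (rsubmx s) 0 i) z.
  by move=> Ds; have [_ _ sp] := par i; rewrite -normal_pdf_gauss// sp.
have qfE s i : polydisc theta0 r s ->
    q s i = gauss_pdf (lsubmx (rsubmx s) 0 i)^-1 (rsubmx (rsubmx s) 0 i / lsubmx (rsubmx s) 0 i).
  by move=> Ds; apply/funext => z; exact: qE.
have rho_gt0 s i : polydisc theta0 r s -> 0 < (lsubmx (rsubmx s) 0 i)^-1.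
  by move=> Ds; have [_ _ sp] := par i; rewrite invr_gt0 sp.
have [h [Mh [hM hE]]] : exists h Mh, analytic_bound theta0 r h Mh /\
    forall s (p : 'rV[R]_l), polydisc theta0 r s -> stationary_distribution (Pi (lsubmx s)) p ->
    entropy_rate_defined p (Pi (lsubmx s)) (q s) /\ entropy_rate p (Pi (lsubmx s)) (q s) = h s.
  have Pi_ge s i j : polydisc theta0 r s -> c <= Pi (lsubmx s) i j.
    move=> Ds; have := analytic_bound_norm (PiN i j) Ds; rewrite ler_norml => /andP[h _].
    by have := Pic i j; move: h dec; lra.
  have Pi0_ge i j : c <= Pi eps0 i j by have := Pic i j; have := c0; lra.
  apply: (entropy_rate_analytic_bound r0 (Pi0 := Pi eps0) (g0 := g0) (istar := istar)
    (Q := fun i z => gauss_majorant (rho0 i) (m0 i) Y t z)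
    (C0 := `|ln (normal_peak 1)| + (`|ln (rho0 istar)| + 1) + (2 * Y) ^+ 2)
    c0 (ltW c_half) lc1 eta0 de1 tau1 tau2 tau0 eta_le excess growth) => //.
  - by move=> i; exact: (Pi_stochastic _ eps0_in).2.
  - by move=> s Ds i j; exact: Pi_ge.
  - by move=> s Ds i; exact: (Pi_stochastic _ (Om s Ds)).2.
  - by move=> s Ds i z; rewrite qE// gauss_pdf_gt0// rho_gt0.
  - by move=> s Ds i; rewrite qfE//; exact: continuous_gauss_pdf.
  - by move=> s Ds i; rewrite qfE// integral_gauss_pdf// rho_gt0.
  - move=> i z; have [h1 h2 _] := par i.
    by apply: analytic_bound_ext (gauss_pdf_bound r0 z h1 h2 (Y_rho i) (Y_m i)) => s Ds; rewrite qE.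
  - by move=> i; exact: continuous_gauss.
  - by move=> i; exact: (Qt i).1.
  - by move=> i; exact: (Qt i).2.
  - move=> z i; have [h1 h2 _] := par i; have [h1' h2' _] := par istar.
    (* The ratio of [istar] to itself is identically 1; for the other states the variances differ
       strictly and the ratio estimate applies. *)
    have [->|ii] := eqVneq i istar.
      apply: (@analytic_bound_ext _ _ _ _ (fun=> 0)) => [s Ds|].
        by rewrite g0_star divff ?subrr// gt_eqF// qE// gauss_pdf_gt0// rho_gt0.
      by apply: analytic_bound_le (analytic_bound_cst _ r0 0); rewrite normr0 ltW.
    by apply: analytic_bound_ext (gt i ii _ _ _ _ _ _ _ r0 h1' h2' h1 h2 z) => s Ds; rewrite !qE.
  - move=> z; have [h1 h2 _] := par istar.
    apply: analytic_bound_ext (ln_gauss_pdf_bound r0 z (rho0_gt0 istar) (Y_rho' istar) (Y_m istar) (ltW trho) h1 h2) => s Ds.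
    by rewrite qE.
have st s : polydisc theta0 r s -> stationary_distribution (Pi (lsubmx s)) (pi (lsubmx s)).
  by move=> Ds; exact: pi_stationary (Om s Ds).
split.
  have := polydisc_near theta0 r0; apply: filterS => s Ds.
  exact: (hE _ _ Ds (st s Ds)).1.
apply: (analytic_bound_real_analytic r0 (M := Mh)).
apply: analytic_bound_ext hM => s Ds.
by rewrite (hE _ _ Ds (st s Ds)).2.
Qed.
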